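(* Let $d\ge1$ be an integer, $0<\alpha<d+1$, and let $1\le p,q\le\infty$ satisfy $\frac1p-\left(1-\frac{\alpha}{d+1}\right)<\frac1q\le\frac1p$. Then $$\|K_\alpha\|_{L^p\to L^q}\le\|K_\alpha^+\|_{L^p\to L^q}\le\left(\frac{\Gamma(d+1)\,\Gamma\!\left(d+1-\frac{\alpha}{1-(p^{-1}-q^{-1})}\right)}{\Gamma^2\!\left(d+1-\frac{\alpha}{2(1-(p^{-1}-q^{-1}))}\right)}\right)^{1-\left(\frac1p-\frac1q\right)}.$$ In particular, when $q=\infty$, these inequalities are equalities.
   Context: $\mathbb{B}^d$ is the open unit ball of $\mathbb{C}^d$ with Lebesgue measure $dv$ normalized so that $v(\mathbb{B}^d)=1$; $\langle z,w\rangle=\sum_j z_j\overline{w_j}$; $L^p=L^p(\mathbb{B}^d,dv)$. For $\alpha\in\mathbb{R}$ and $f\in L^1(\mathbb{B}^d,dv)$, $$K_\alpha f(z)=\int_{\mathbb{B}^d}\frac{f(w)}{(1-\langle z,w\rangle)^\alpha}\,dv(w),\qquad K_\alpha^+f(z)=\int_{\mathbb{B}^d}\frac{f(w)}{|1-\langle z,w\rangle|^\alpha}\,dv(w),\qquad z\in\mathbb{B}^d$$ (principal branch of the power). $\Gamma$ is the Gamma function, $\|T\|_{L^p\to L^q}$ is the operator norm, and $1/\infty=0$. *)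

(* Defs.v *)
From HB Require Import structures.
From mathcomp Require Import all_boot all_order all_algebra.
From mathcomp Require Import complex.
From mathcomp Require Import all_classical all_reals all_analysis.
From mathcomp Require Import measurable_realfun.
From mathcomp Require Import ring lra.
Import numFieldNormedType.Exports.

Set Implicit Arguments.
Unset Strict Implicit.
Unset Printing Implicit Defensive.

Import Order.TTheory GRing.Theory Num.Theory.
Import Normc.

Local Open Scope classical_set_scope.
Local Open Scope ring_scope.
Local Open Scope complex_scope.

(* The Borel sigma-algebra of C = R^2 is transported from the product
   sigma-algebra of R * R. *)
Definition complex_display : measure_display.
Proof. exact: default_measure_display. Qed.

Section complex_measurable.
Variable R : realType.

Definition pair_of_complex (z : R[i]) : R * R := (complex.Re z, complex.Im z).
Definition complex_of_pair (x : R * R) : R[i] := x.1 +i* x.2.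

Lemma pair_of_complexK : cancel pair_of_complex complex_of_pair.
Proof. by case. Qed.
Lemma complex_of_pairK : cancel complex_of_pair pair_of_complex.
Proof. by case. Qed.

Definition complex_measurable : set (set R[i]) :=
  [set A | measurable (complex_of_pair @^-1` A)].

Let complex_measurable0 : complex_measurable set0.
Proof. by rewrite /complex_measurable /= preimage_set0. Qed.

Let complex_measurableC A : complex_measurable A -> complex_measurable (~` A).
Proof. by move=> mA; rewrite /complex_measurable /= preimage_setC; exact: measurableC. Qed.

Let complex_measurable_bigcup (F : (set R[i])^nat) :
  (forall i, complex_measurable (F i)) -> complex_measurable (\bigcup_i F i).
Proof.
move=> mF; rewrite /complex_measurable /= preimage_bigcup.
exact: bigcupT_measurable.
Qed.

HB.instance Definition _ := isPointed.Build R[i] 0.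
HB.instance Definition _ := @isMeasurable.Build complex_display R[i]
  complex_measurable complex_measurable0 complex_measurableC
  complex_measurable_bigcup.

Lemma measurable_complex_of_pair : measurable_fun setT complex_of_pair.
Proof. by move=> _ A mA; rewrite setTI. Qed.

Lemma measurable_pair_of_complex : measurable_fun setT pair_of_complex.
Proof.
move=> _ A mA; rewrite setTI; rewrite /measurable /= /complex_measurable /=.
rewrite -comp_preimage (_ : _ \o _ = id) ?preimage_id//.
by apply/funext => -[].
Qed.

End complex_measurable.

Section sigma_finite_constructions.
Context d1 d2 (T1 : measurableType d1) (T2 : measurableType d2) (R : realType).
Local Open Scope ereal_scope.

Lemma sigma_finite_pushforward (mu : {measure set T1 -> \bar R})
    (f : T1 -> T2) (g : T2 -> T1) :
  measurable_fun setT g -> cancel f g -> cancel g f ->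
  sigma_finite setT mu -> sigma_finite setT (pushforward mu f).
Proof.
move=> mg fK gK [F UF mF]; exists (fun n => g @^-1` F n).
  by rewrite -preimage_bigcup -UF preimage_setT.
move=> n; have [mFn Fnoo] := mF n; split.
  by rewrite -[X in measurable X]setTI; exact: mg.
rewrite /pushforward -comp_preimage (_ : g \o f = id) ?preimage_id//.
exact/funext.
Qed.

Lemma sigma_finite_product (m1 : {sigma_finite_measure set T1 -> \bar R})
    (m2 : {sigma_finite_measure set T2 -> \bar R}) :
  sigma_finite setT (m1 \x m2).
Proof.
have /sigma_finiteP[F [TF ndF Foo]] := sigma_finiteT m1.
have /sigma_finiteP[G [TG ndG Goo]] := sigma_finiteT m2.
exists (fun n => F n `*` G n).
  rewrite -setXTT TF TG predeqE => -[x y]; split.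
    move=> [/= [n _ Fnx] [k _ Gky]]; exists (maxn n k) => //; split.
    - by move: x Fnx; exact/subsetPset/ndF/leq_maxl.
    - by move: y Gky; exact/subsetPset/ndG/leq_maxr.
  by move=> [n _ []/= ? ?]; split; exists n.
move=> k; have [? ?] := Foo k; have [? ?] := Goo k.
split; first exact: measurableX.
by rewrite product_measure1E// lte_mul_pinfty// ge0_fin_numE.
Qed.

End sigma_finite_constructions.

Section lebesgueC.
Variable R : realType.
Local Open Scope ereal_scope.

Definition lebesgueC : set R[i] -> \bar R :=
  pushforward (@lebesgue_measure R \x @lebesgue_measure R) (@complex_of_pair R).

Let lebesgueC0 : lebesgueC set0 = 0.
Proof. have mf := @measurable_complex_of_pair R; exact: measure0. Qed.

Let lebesgueC_ge0 A : 0 <= lebesgueC A.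
Proof. have mf := @measurable_complex_of_pair R; exact: measure_ge0. Qed.

Let lebesgueC_sigma_additive : semi_sigma_additive lebesgueC.
Proof. have mf := @measurable_complex_of_pair R; exact: measure_semi_sigma_additive. Qed.

HB.instance Definition _ := isMeasure.Build _ _ _ lebesgueC
  lebesgueC0 lebesgueC_ge0 lebesgueC_sigma_additive.

Let lebesgueC_sigma_finite : sigma_finite setT lebesgueC.
Proof.
have h := sigma_finite_product (@lebesgue_measure R) (@lebesgue_measure R).
apply: (sigma_finite_pushforward _ _ _ h).
- exact: measurable_pair_of_complex.
- exact: complex_of_pairK.
- exact: pair_of_complexK.
Qed.

HB.instance Definition _ := Measure_isSigmaFinite.Build _ _ _ lebesgueC
  lebesgueC_sigma_finite.

End lebesgueC.

(* Lebesgue measure on C^d (points of C^d are d-tuples): the d-fold product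
   of Lebesgue measure on C, by recursion on d. *)
Section lebesgueCn.
Variable R : realType.
Local Open Scope ereal_scope.

Definition cons_pair n (x : R[i] * n.-tuple R[i]) : n.+1.-tuple R[i] :=
  [tuple of x.1 :: x.2].
Definition uncons n (t : n.+1.-tuple R[i]) : R[i] * n.-tuple R[i] :=
  (thead t, [tuple of behead t]).

Lemma cons_pairK n : cancel (@cons_pair n) (@uncons n).
Proof. by case=> a t; congr pair; exact/val_inj. Qed.

Lemma unconsK n : cancel (@uncons n) (@cons_pair n).
Proof. by move=> t; rewrite [RHS]tuple_eta. Qed.

Lemma measurable_cons_pair n : measurable_fun setT (@cons_pair n).
Proof. exact: measurable_cons. Qed.

Lemma measurable_uncons n : measurable_fun setT (@uncons n).
Proof.
apply: measurable_fun_pair; first exact: measurable_tnth.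
exact: measurable_behead.
Qed.

Section cons_measure.
Variables (n : nat) (mu : {sigma_finite_measure set (n.-tuple R[i]) -> \bar R}).

Definition cons_measure : set (n.+1.-tuple R[i]) -> \bar R :=
  pushforward (@lebesgueC R \x mu) (@cons_pair n).

Let cons_measure0 : cons_measure set0 = 0.
Proof. have mf := @measurable_cons_pair n; exact: measure0. Qed.

Let cons_measure_ge0 A : 0 <= cons_measure A.
Proof. have mf := @measurable_cons_pair n; exact: measure_ge0. Qed.

Let cons_measure_sigma_additive : semi_sigma_additive cons_measure.
Proof. have mf := @measurable_cons_pair n; exact: measure_semi_sigma_additive. Qed.

HB.instance Definition _ := isMeasure.Build _ _ _ cons_measure
  cons_measure0 cons_measure_ge0 cons_measure_sigma_additive.

Let cons_measure_sigma_finite : sigma_finite setT cons_measure.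
Proof.
have h := sigma_finite_product (@lebesgueC R) mu.
apply: (sigma_finite_pushforward _ _ _ h).
- exact: measurable_uncons.
- exact: cons_pairK.
- exact: unconsK.
Qed.

HB.instance Definition _ := Measure_isSigmaFinite.Build _ _ _ cons_measure
  cons_measure_sigma_finite.

End cons_measure.

Fixpoint lebesgueCn n : {sigma_finite_measure set (n.-tuple R[i]) -> \bar R} :=
  if n is m.+1 then cons_measure (lebesgueCn m) else \d_[tuple].

End lebesgueCn.

Section ball.
Variables (R : realType) (d : nat).

(* <z, w> *)
Definition cdot (z w : d.-tuple R[i]) : R[i] :=
  \sum_(j < d) tnth z j * conjc (tnth w j).

Definition unit_ball : set (d.-tuple R[i]) :=
  [set z | \sum_(j < d) normc (tnth z j) ^+ 2 < 1].

Lemma measurable_Re : measurable_fun setT (@complex.Re R).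
Proof. exact: (measurableT_comp measurable_fst (@measurable_pair_of_complex R)). Qed.

Lemma measurable_Im : measurable_fun setT (@complex.Im R).
Proof. exact: (measurableT_comp measurable_snd (@measurable_pair_of_complex R)). Qed.

Lemma sqr_normcE (z : R[i]) :
  normc z ^+ 2 = complex.Re z ^+ 2 + complex.Im z ^+ 2.
Proof. by case: z => a b; rewrite /normc sqr_sqrtr// addr_ge0// sqr_ge0. Qed.

Lemma measurable_unit_ball : measurable unit_ball.
Proof.
pose f (z : d.-tuple R[i]) : R :=
  \sum_(j < d) (complex.Re (tnth z j) ^+ 2 + complex.Im (tnth z j) ^+ 2).
have mf : measurable_fun setT f.
  apply: measurable_sum => j; apply: measurable_funD; apply: measurable_funX.
  - exact: (measurableT_comp measurable_Re (@measurable_tnth _ _ _ j)).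
  - exact: (measurableT_comp measurable_Im (@measurable_tnth _ _ _ j)).
rewrite (_ : unit_ball = setT `&` f @^-1` `]-oo, 1[%classic).
  exact: mf.
rewrite setTI; apply/funext => z; apply/propext.
rewrite /unit_ball /preimage/= in_itv/= /f.
by under [in X in _ <-> X]eq_bigr do rewrite -sqr_normcE.
Qed.

End ball.

Section ball_volume.
Variable R : realType.
Local Open Scope ereal_scope.

Let itv (r : R) : set R := `[(- r)%R, r]%classic.
Let square (r : R) : set R[i] := [set z | itv r (complex.Re z) /\ itv r (complex.Im z)].
Let box (r : R) d : set (d.-tuple R[i]) := [set z | forall j, square r (tnth z j)].

Let measurable_itv r : measurable (itv r).
Proof. exact: measurable_itv. Qed.

Let measurable_square r : measurable (square r).
Proof.
have -> : square r = @pair_of_complex R @^-1` (itv r `*` itv r).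
  by apply/seteqP; split.
rewrite -[X in measurable X]setTI; apply: measurable_pair_of_complex => //.
exact: measurableX.
Qed.

Let measurable_box r d : measurable (@box r d).
Proof.
have -> : @box r d = \bigcap_(j in [set: 'I_d]) ((fun z => tnth z j) @^-1` square r).
  by apply/seteqP; split => z /= h j; [move=> _|]; exact: h.
apply: fin_bigcap_measurable => [|j _]; first exact: finite_finset.
by rewrite -[X in measurable X]setTI; exact: measurable_tnth.
Qed.

Let lebesgueC_square (r : R) : (0 <= r)%R ->
  lebesgueC (square r) = ((r + r) * (r + r))%R%:E.
Proof.
move=> r0; rewrite /lebesgueC /pushforward.
have -> : @complex_of_pair R @^-1` square r = itv r `*` itv r.
  by apply/seteqP; split.
transitivity (lebesgue_measure (itv r) * lebesgue_measure (itv r)).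
  by rewrite product_measure1E//; exact: measurable_itv.
rewrite /itv lebesgue_measure_itv/= lte_fin.
case: ifPn => [_|]; first by rewrite opprK -EFinM.
rewrite -leNgt => h; have -> : r = 0%R by apply/eqP; lra.
by rewrite mule0 addr0 mulr0.
Qed.

Let lebesgueCn_box (r : R) d : (0 <= r)%R ->
  lebesgueCn R d (@box r d) = (((r + r) * (r + r)) ^+ d)%R%:E.
Proof.
move=> r0; elim: d => [|n IH] /=.
  by rewrite diracE mem_set// => -[].
rewrite /cons_measure /pushforward.
have -> : @cons_pair R n @^-1` @box r n.+1 = square r `*` @box r n.
  apply/seteqP; split => -[z t] /=.
  - move=> h; split; first by have := h ord0; rewrite tnth0.
    by move=> j; have := h (lift ord0 j); rewrite tnthS.
  - move=> [hz ht] j; have [k ->|->] := unliftP ord0 j; last by rewrite tnth0.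
    by rewrite tnthS; exact: ht.
transitivity (lebesgueC (square r) * lebesgueCn R n (@box r n)).
  by rewrite product_measure1E//; exact: measurable_box.
by rewrite IH lebesgueC_square// -EFinM -exprS.
Qed.

Lemma unit_ball_volume_lty d : lebesgueCn R d (@unit_ball R d) < +oo.
Proof.
apply: (@le_lt_trans _ _ (lebesgueCn R d (@box 1%R d))); last first.
  by rewrite lebesgueCn_box// ltry.
apply: le_measure.
- by rewrite inE; exact: measurable_unit_ball.
- by rewrite inE; exact: measurable_box.
move=> z; rewrite /unit_ball/= => h j.
have {h} : (complex.Re (tnth z j) ^+ 2 + complex.Im (tnth z j) ^+ 2 < 1)%R.
  rewrite -sqr_normcE; apply: le_lt_trans h; rewrite (bigD1 j)//= lerDl.
  by apply: sumr_ge0 => i _; exact: sqr_ge0.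
rewrite /square /itv/= !in_itv/=.
move: (complex.Re _) (complex.Im _) => a b ab.
have [a1 b1] : (a ^+ 2 <= 1 /\ b ^+ 2 <= 1)%R.
  by have := sqr_ge0 a; have := sqr_ge0 b; split; lra.
by split; rewrite -ler_norml -(@expr_le1 _ 2)// real_normK// num_real.
Qed.

Lemma unit_ball_volume_gt0 d : 0 < lebesgueCn R d (@unit_ball R d).
Proof.
have d0 : (0 <= d%:R :> R)%R by rewrite ler0n.
pose r : R := (2 * (d%:R + 1))^-1%R.
have r0 : (0 < r)%R by rewrite invr_gt0; lra.
have rd : (r * d%:R <= 1 / 2)%R.
  have : (r * (2 * (d%:R + 1)) = 1)%R by rewrite /r mulVf//; lra.
  by nra.
have r1 : (r <= 1 / 2)%R.
  have : (r * (2 * (d%:R + 1)) = 1)%R by rewrite /r mulVf//; lra.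
  by nra.
apply: (@lt_le_trans _ _ (lebesgueCn R d (@box r d))).
  by rewrite lebesgueCn_box ?ltW// lte_fin exprn_gt0// mulr_gt0// addr_gt0.
apply: le_measure.
- by rewrite inE; exact: measurable_box.
- by rewrite inE; exact: measurable_unit_ball.
move=> z h; rewrite /unit_ball/=.
apply: (@le_lt_trans _ _ (\sum_(j < d) (2 * (r * r)))%R).
  apply: ler_sum => j _; rewrite sqr_normcE.
  have [] := h j; rewrite /itv/= !in_itv/=.
  move: (complex.Re _) (complex.Im _) => a b /andP[? ?] /andP[? ?].
  by nra.
rewrite sumr_const card_ord -mulr_natr.
by nra.
Qed.

End ball_volume.

(* Normalized Lebesgue measure on the ball, as a measure on C^d that vanishes
   off the ball. *)
Section ball_measure.
Variables (R : realType) (d : nat).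
Local Open Scope ereal_scope.

Let vol_inv_ge0 : (0 <= (fine (lebesgueCn R d (@unit_ball R d)))^-1)%R.
Proof. by rewrite invr_ge0 fine_ge0// measure_ge0. Qed.

Definition dv : set (d.-tuple R[i]) -> \bar R :=
  mscale (NngNum vol_inv_ge0) (mrestr (lebesgueCn R d) (@measurable_unit_ball R d)).

HB.instance Definition _ := Measure.on dv.

Let dv_setT : dv setT = 1.
Proof.
transitivity ((fine (lebesgueCn R d (@unit_ball R d)))^-1%:E *
  lebesgueCn R d (setT `&` @unit_ball R d)); first by [].
rewrite setTI.
have := @unit_ball_volume_gt0 R d; have := @unit_ball_volume_lty R d.
case: (lebesgueCn R d (@unit_ball R d)) => [x /= _|//|//]; rewrite lte_fin => x0.
by rewrite -EFinM mulVf// gt_eqF.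
Qed.

HB.instance Definition _ := Measure_isProbability.Build _ _ _ dv dv_setT.

End ball_measure.

Section operators.
Variables (R : realType) (d : nat).
Implicit Types (f : d.-tuple R[i] -> R[i]) (z w : d.-tuple R[i]) (p q : \bar R).

(* Principal argument, in ]-pi, pi] (for z != 0). *)
Definition carg (z : R[i]) : R :=
  if 0 <= complex.Im z then acos (complex.Re z / normc z)
  else - acos (complex.Re z / normc z).

(* Principal branch of z^a, a real. *)
Definition cpow (z : R[i]) (a : R) : R[i] :=
  (normc z `^ a * cos (a * carg z)) +i* (normc z `^ a * sin (a * carg z)).

Definition cintegral (D : set (d.-tuple R[i])) f : R[i] :=
  (\int[@dv R d]_(w in D) complex.Re (f w)) +i*
  (\int[@dv R d]_(w in D) complex.Im (f w)).

(* Functions on the ball are represented by functions on C^d; their values off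
   the ball are irrelevant, and set to 0 for the images of the operators. *)
Definition Kop (alpha : R) f : d.-tuple R[i] -> R[i] := fun z =>
  if z \in @unit_ball R d then
    cintegral (@unit_ball R d) (fun w => f w / cpow (1 - cdot z w) alpha)
  else 0.

Definition Kop_plus (alpha : R) f : d.-tuple R[i] -> R[i] := fun z =>
  if z \in @unit_ball R d then
    cintegral (@unit_ball R d) (fun w => f w / (normc (1 - cdot z w) `^ alpha)%:C)
  else 0.

Definition cLnorm p f : \bar R := Lnorm (@dv R d) p (fun z => (normc (f z))%:E).

Definition opnorm p q (T : (d.-tuple R[i] -> R[i]) -> d.-tuple R[i] -> R[i]) :
    \bar R :=
  ereal_sup [set cLnorm q (T f) |
    f in [set f | measurable_fun setT f /\ (cLnorm p f <= 1)%E]].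

End operators.

Definition Gamma (R : realType) (x : R) : R :=
  \int[lebesgue_measure]_(t in `]0, +oo[%classic) (t `^ (x - 1) * expR (- t)).

(* 1/p as a real number, with 1/+oo = 0. *)
Definition rinv (R : realType) (p : \bar R) : R := fine (p^-1)%E.

(* Main.v *)
Require Import Defs.
From mathcomp Require Import all_boot all_order all_algebra.
From mathcomp Require Import complex.
From mathcomp Require Import all_classical all_reals all_analysis.
From mathcomp Require Import measurable_realfun ess_sup_inf ring lra.

(** Put [r = alpha / s] and [A = sup_z \int |1 - <z, w>|^(-r) dv(w)]. Factor
    [|1 - <z, w>|^(-alpha) * g] as the product of [(k * g^p)^(1/q)], [k^(1 - 1/p)]
    and [(g^p)^(1/p - 1/q)] with [k = |1 - <z, w>|^(-r)]; the weighted AM-GM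
    inequality and Tonelli's theorem bound the norm of [K_alpha^+] by [A^s], and
    [K_alpha] is dominated pointwise by [K_alpha^+].

    By unitary invariance the integral depends on [|z|] only. On the sphere
    [|z| = 1] it reduces to an integral over the disc, computed by writing
    [1 - lambda = x (1 + i t)], which separates into beta integrals. That the
    value on the sphere dominates the value inside comes from averaging over the
    [N]-th roots of unity, with [N] tending to infinity.

    When [q = +oo], the function of modulus proportional to [k_(z0)^(1/p)] whose
    phase cancels that of the kernel at [z0] is extremal for the evaluation at
    [z0]; its image is continuous at [z0], so that its essential supremum is at
    least its value at [z0]; then [z0] tends to the sphere. *)
Import Order.TTheory GRing.Theory Num.Theory.
Import numFieldNormedType.Exports Normc.

Set Implicit Arguments.
Unset Strict Implicit.
Unset Printing Implicit Defensive.

Local Open Scope classical_set_scope.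
Local Open Scope ring_scope.

(** * Gamma, beta and Cauchy integrals *)

Section line_integrals.
Variable R : realType.
Local Open Scope ereal_scope.
Local Notation mu := (@lebesgue_measure R).
Implicit Types (f : R -> \bar R) (a c : R).

(** In the three-factor splitting the powers of [k] add up to [1/q + (1 - 1/p) = s], which forces
    [r = alpha / s]. The factor with exponent [1 - 1/p] costs [A^(1 - 1/p)] at each point [z];
    integrating the remaining factor in [z] costs [A^(1/q)]. Behind the comparison of the sphere
    with the interior lies the fact that the mean of [|1 - rho * l * x|^(-r)] over the circle
    [|x| = 1] is nondecreasing in [rho]. The mean over the [N]-th roots of unity satisfies this only
    up to an error. The corresponding sums of logarithms are logarithms of explicit polynomials, so
    the error of the whole sum is bounded independently of [N], and division by [N] removes it.
    Unitary invariance rests on translations and positive dilations alone: a plane rotation is a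
    product of shears, and a shear is a translation in one variable whose amount depends on the
    other. *)

Lemma ge0_integral_shift f a : measurable_fun setT f -> (forall x, 0 <= f x) ->
  \int[mu]_x f (x + a)%R = \int[mu]_x f x.
Proof.
move=> mf f0.
pose phi : measurableTypeR R -> measurableTypeR R := fun x => (x + a)%R.
have mphi : measurable_fun setT phi by exact: measurable_funD.
rewrite [RHS](@eq_measure_integral _ _ _ _ (pushforward mu phi)).
  by rewrite ge0_integral_pushforward.
move=> A mA _; apply: lebesgue_measure_unique => //= _ [[x y]] _ <-.
rewrite /pushforward /=.
have -> : phi @^-1` `]x, y] = `](x - a)%R, (y - a)%R]%classic.
  by apply/seteqP; split => t; rewrite /phi /= !in_itv/= ltrBlDr lerBrDr.
rewrite !lebesgue_measure_itv/= !lte_fin ltrD2r; case: ifP => // _.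
by rewrite -!EFinB; congr EFin; ring.
Qed.

(** As for translations, the image measure takes the right values on half-open intervals, and these
    determine Lebesgue measure. The factor [c] stands on the left so that nothing is divided in
    [\bar R]. *)
Lemma ge0_integral_scale f c : measurable_fun setT f -> (forall x, 0 <= f x) ->
  (0 < c)%R -> c%:E * \int[mu]_x f (c * x)%R = \int[mu]_x f x.
Proof.
move=> mf f0 c0.
pose phi : measurableTypeR R -> measurableTypeR R := fun x => (c * x)%R.
have mphi : measurable_fun setT phi by exact: measurable_funM.
pose k : {nonneg R} := NngNum (ltW c0).
rewrite [RHS](@eq_measure_integral _ _ _ _ (mscale k (pushforward mu phi))).
  by rewrite ge0_integral_mscale// ge0_integral_pushforward.
move=> A mA _; apply: lebesgue_measure_unique => //= _ [[x y]] _ <-.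
rewrite /mscale/= /pushforward /=.
have -> : phi @^-1` `]x, y] = `](x / c)%R, (y / c)%R]%classic.
  by apply/seteqP; split => t; rewrite /phi /= !in_itv/= ltr_pdivrMr// ler_pdivlMr// mulrC.
rewrite !lebesgue_measure_itv/= !lte_fin ltr_pM2r ?invr_gt0//.
case: ifPn => _; last by rewrite mule0.
by rewrite -EFinB -EFinM -mulrBl mulrC divfK// gt_eqF.
Qed.

End line_integrals.

Section measurability.
Context d (T : measurableType d) (R : realType).
Implicit Types f g : T -> R.

Lemma measurable_oppr_fun f :
  measurable_fun setT f -> measurable_fun setT (fun x => - f x).
Proof. exact: measurableT_comp (@oppr_measurable _ _). Qed.

Lemma measurable_expR_fun f :
  measurable_fun setT f -> measurable_fun setT (fun x => expR (f x)).
Proof. exact: measurableT_comp (@measurable_expR _). Qed.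

Lemma measurable_powR_fun f a :
  measurable_fun setT f -> measurable_fun setT (fun x => f x `^ a).
Proof. exact: measurableT_comp (measurable_powR _). Qed.

(* Extended by 0, whereas MathComp's [powR] is 1 on negative numbers. *)
Definition ppow (a t : R) : R := if 0 < t then t `^ a else 0.

Lemma measurable_ppow f a :
  measurable_fun setT f -> measurable_fun setT (fun x => ppow a (f x)).
Proof.
move=> mf; apply: (@measurable_fun_ifT _ _ _ _ (fun x => f x `^ a) (cst 0)) => //.
  exact: measurable_fun_ltr.
exact: measurable_powR_fun.
Qed.

End measurability.

Ltac meas := repeat match goal with
  | |- measurable_fun _ (fun x => EFin _) => apply/measurable_EFinP
  | |- measurable_fun _ (EFin \o _) => apply/measurable_EFinP
  | |- measurable_fun _ (fun x => GRing.opp _) => apply: measurable_oppr_fun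
  | |- measurable_fun _ (fun x => GRing.add _ (GRing.opp _)) => apply: measurable_funB
  | |- measurable_fun _ (fun x => GRing.add _ _) => apply: measurable_funD
  | |- measurable_fun _ (fun x => GRing.mul _ _) => apply: measurable_funM
  | |- measurable_fun _ (fun x => GRing.exp _ _) => apply: measurable_funX
  | |- measurable_fun _ (fun x => expR _) => apply: measurable_expR_fun
  | |- measurable_fun _ (fun x => powR _ _) => apply: measurable_powR_fun
  | |- measurable_fun _ (fun x => ppow _ _) => apply: measurable_ppow
  | |- measurable_fun _ (ppow _) => apply: measurable_ppow
  | |- measurable_fun _ expR => exact: measurable_expR
  | |- measurable_fun _ fst => exact: measurable_fst
  | |- measurable_fun _ snd => exact: measurable_snd
  | |- measurable_fun _ (fun x => fst _) => apply: measurableT_comp measurable_fst _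
  | |- measurable_fun _ (fun x => snd _) => apply: measurableT_comp measurable_snd _
  | |- _ => by []
  end.

Ltac side := first [by meas | by move=> *; rewrite ?mulr_ge0// ltW
  | by move=> *; rewrite lee_fin ?mulr_ge0// ltW].

Section power.
Variable R : realType.
Implicit Types a c t : R.

Lemma ppow_ge0 a t : 0 <= ppow a t.
Proof. by rewrite /ppow; case: ifP => // _; exact: powR_ge0. Qed.

Lemma ppowE a t : 0 < t -> ppow a t = t `^ a.
Proof. by rewrite /ppow => ->. Qed.

Lemma le0_ppow a t : t <= 0 -> ppow a t = 0.
Proof. by rewrite /ppow leNgt => /negbTE ->. Qed.

Lemma ppowM a c t : 0 < c -> ppow a (c * t) = c `^ a * ppow a t.
Proof.
move=> c0; have [t0|t0] := ltP 0 t; last first.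
  by rewrite !le0_ppow ?mulr0// pmulr_rle0.
by rewrite !ppowE ?mulr_gt0// powRM// ltW.
Qed.

Lemma gt0_powRD t a c : 0 < t -> t `^ (a + c) = t `^ a * t `^ c.
Proof. by move=> t0; rewrite powRD//; apply/implyP => _; rewrite gt_eqF. Qed.

Lemma powR_mul_self a t : 0 < t -> t * t `^ (a - 1) = t `^ a.
Proof.
by move=> t0; rewrite -{1}(powRr1 (ltW t0)) -gt0_powRD// addrC subrK.
Qed.

End power.

Section gamma.
Variable R : realType.
#[local] Hint Extern 0 (is_true (0 <= ppow _ _)%R) => exact: ppow_ge0 : core.
#[local] Hint Extern 0 (is_true (0 <= expR _)%R) => exact: expR_ge0 : core.
#[local] Hint Extern 0 (is_true (0 <= powR _ _)%R) => exact: powR_ge0 : core.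
Local Open Scope ereal_scope.
Local Notation mu := (@lebesgue_measure R).
Implicit Types x y m t u : R.

(* Extended-real valued, so that Tonelli's theorem applies without integrability. *)
Definition gam x : \bar R := \int[mu]_t (ppow (x - 1) t * expR (- t))%:E.
Definition bet x y : \bar R :=
  \int[mu]_t (ppow (x - 1) t * ppow (y - 1) (1 - t))%:E.

Lemma tonelliR (f : R -> R -> R) :
  measurable_fun setT (fun z : R * R => f z.1 z.2) ->
  (forall x y, (0 <= f x y)%R) ->
  \int[mu]_x \int[mu]_y (f x y)%:E = \int[mu]_y \int[mu]_x (f x y)%:E.
Proof.
move=> mf f0.
apply: (fubini_tonelli (m1 := mu) (m2 := mu) (fun z : R * R => (f z.1 z.2)%:E)) => //.
  exact/measurable_EFinP.
by move=> z; rewrite lee_fin.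
Qed.

Lemma ge0_integralMl d (T : measurableType d) (nu : {measure set T -> \bar R})
    (c : R) (f : T -> R) :
  measurable_fun setT f -> (forall z, (0 <= f z)%R) -> (0 <= c)%R ->
  \int[nu]_z (c * f z)%:E = c%:E * \int[nu]_z (f z)%:E.
Proof.
move=> mf f0 c0; under eq_integral do rewrite EFinM.
rewrite ge0_integralZl_EFin//; first by move=> z _; rewrite lee_fin.
exact/measurable_EFinP.
Qed.

Lemma ge0_integralMr d (T : measurableType d) (nu : {measure set T -> \bar R})
    (K : \bar R) (f : T -> R) :
  measurable_fun setT f -> (forall z, (0 <= f z)%R) -> 0 <= K ->
  (\int[nu]_z (f z)%:E) * K = \int[nu]_z ((f z)%:E * K).
Proof.
move=> mf f0 K0; rewrite ge0_integralZr//; first exact/measurable_EFinP.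
by move=> z _; rewrite lee_fin.
Qed.

Lemma ge0_integralMlR (c : R) (f : R -> R) :
  measurable_fun setT f -> (forall t, (0 <= f t)%R) -> (0 <= c)%R ->
  \int[mu]_t (c * f t)%:E = c%:E * \int[mu]_t (f t)%:E.
Proof. exact: (@ge0_integralMl _ (measurableTypeR R) mu). Qed.

Lemma ge0_integralMrR (K : \bar R) (f : R -> R) :
  measurable_fun setT f -> (forall t, (0 <= f t)%R) -> 0 <= K ->
  (\int[mu]_t (f t)%:E) * K = \int[mu]_t ((f t)%:E * K).
Proof. exact: (@ge0_integralMr _ (measurableTypeR R) mu). Qed.

Lemma ge0_integral_shiftE (f : R -> R) a : measurable_fun setT f -> (forall x, (0 <= f x)%R) ->
  \int[mu]_x (f (x + a)%R)%:E = \int[mu]_x (f x)%:E.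
Proof.
by move=> mf f0; apply: (@ge0_integral_shift _ (EFin \o f)) => //; exact/measurable_EFinP.
Qed.

Lemma ge0_integral_scaleE (f : R -> R) c : measurable_fun setT f -> (forall x, (0 <= f x)%R) ->
  (0 < c)%R -> \int[mu]_x (f x)%:E = c%:E * \int[mu]_x (f (c * x)%R)%:E.
Proof.
move=> mf f0 c0; apply/esym/(@ge0_integral_scale _ (EFin \o f)) => //; first exact/measurable_EFinP.
Qed.

Lemma gam_ge0 x : 0 <= gam x.
Proof. by apply: integral_ge0 => t _; rewrite lee_fin mulr_ge0. Qed.

(** The shift [u - t] in the inner integral merges the two exponentials into [expR (- u)]; after
    Tonelli, the scaling [t := u * t] extracts [u ^ (x + y - 1)] and leaves the beta integrand. The
    identity is one between elements of [[0, +oo]]. *)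
Lemma gam_bet x y : gam x * gam y = gam (x + y) * bet x y.
Proof.
have mg z : measurable_fun setT (fun t : R => ppow (z - 1) t * expR (- t))%R by meas.
have g0 z t : (0 <= ppow (z - 1) t * expR (- t))%R by rewrite mulr_ge0.
have b0 : 0 <= bet x y by apply: integral_ge0 => t _; rewrite lee_fin mulr_ge0.
have gy := gam_ge0 y; rewrite /gam ge0_integralMrR//.
transitivity (\int[mu]_t \int[mu]_u (ppow (x - 1) t * ppow (y - 1) (u - t) * expR (- u))%:E).
  apply: eq_integral => t _; rewrite -ge0_integralMlR//.
  rewrite -(@ge0_integral_shiftE _ (- t)%R) //; last 2 first.
  - by meas.
  - by move=> u; rewrite mulr_ge0.
  apply: eq_integral => u _; congr EFin.
  rewrite opprB [(t - u)%R]addrC expRD [(expR (- u) * _)%R]mulrC expRN; field.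
  by rewrite gt_eqF ?expR_gt0.
etransitivity; first apply: (tonelliR (f := fun t u =>
    ppow (x - 1) t * ppow (y - 1) (u - t) * expR (- u))%R).
- by meas.
- by move=> t u; rewrite !mulr_ge0.
rewrite ge0_integralMrR//.
apply: eq_integral => u _.
have [u0|u0] := ltP 0%R u; last first.
  rewrite (@le0_ppow _ (x + y - 1))// mul0r mul0e.
  under eq_integral => t _.
    have -> : (ppow (x - 1) t * ppow (y - 1) (u - t) * expR (- u) = 0)%R.
      have [t0|t0] := ltP 0%R t; last by rewrite le0_ppow ?mul0r.
      by rewrite (@le0_ppow _ (y - 1))%R ?mulr0 ?mul0r//; lra.
    over.
  by rewrite integral0.
rewrite (@ge0_integral_scaleE _ u)//; last 2 first.
- by meas.
- by move=> t; rewrite !mulr_ge0.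
rewrite -!ge0_integralMlR//; try side.
apply: eq_integral => t _; congr EFin.
rewrite (_ : u - u * t = u * (1 - t))%R; last by ring.
rewrite !ppowM// (@ppowE _ (x + y - 1))//.
rewrite (_ : x + y - 1 = x + (y - 1))%R; last by ring.
by rewrite (@gt0_powRD _ u x (y - 1))// -(@powR_mul_self _ x u)//; ring.
Qed.

Definition gauss : \bar R := \int[mu]_y (expR (- y ^+ 2))%:E.
(** This is the beta integral B(x, 1/2) in the variable [y ^+ 2]. It differs from [bet x x] by an
    affine substitution only, and comparing the two yields Legendre's duplication formula. *)
Definition semi x : \bar R := \int[mu]_y (ppow (x - 1) (1 - y ^+ 2))%:E.
Definition cauchy m : \bar R := \int[mu]_y ((1 + y ^+ 2) `^ (- m))%:E.

Lemma gauss_ge0 : 0 <= gauss.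
Proof. by apply: integral_ge0 => t _; rewrite lee_fin. Qed.

Lemma semi_ge0 x : 0 <= semi x.
Proof. by apply: integral_ge0 => t _; rewrite lee_fin. Qed.

Let one_plus_sqr_gt0 y : (0 < 1 + y ^+ 2)%R.
Proof. by rewrite ltr_wpDr// sqr_ge0. Qed.

(** The shift [t - y ^+ 2] absorbs the Gaussian into [expR (- t)]; after Tonelli, scaling [y] by the
    square root of [t] separates the variables and accounts for the extra 1/2 in the argument. *)
Lemma gam_semi x : gam x * gauss = gam (x + 2^-1) * semi x.
Proof.
have s0 := semi_ge0 x; have g0 := gam_ge0 x.
rewrite muleC /gauss ge0_integralMrR//; last by meas.
transitivity (\int[mu]_y \int[mu]_t (ppow (x - 1) (t - y ^+ 2) * expR (- t))%:E).
  apply: eq_integral => y _; rewrite -ge0_integralMlR//; last 2 first.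
  - by meas.
  - by move=> t; rewrite mulr_ge0.
  rewrite -(@ge0_integral_shiftE _ (- y ^+ 2)%R) //; last 2 first.
  - by meas.
  - by move=> u; rewrite !mulr_ge0.
  apply: eq_integral => t _; congr EFin.
  by rewrite mulrCA -expRD; congr (_ * expR _)%R; ring.
etransitivity; first apply: (tonelliR (f := fun y t =>
    ppow (x - 1) (t - y ^+ 2) * expR (- t))%R).
- by meas.
- by move=> t u; rewrite !mulr_ge0.
rewrite /gam ge0_integralMrR//; last 2 first.
- by meas.
- by move=> t; rewrite mulr_ge0.
apply: eq_integral => t _.
have [t0|t0] := ltP 0%R t; last first.
  rewrite (@le0_ppow _ (x + 2^-1 - 1))// mul0r mul0e.
  under eq_integral => y _.
    have -> : (ppow (x - 1) (t - y ^+ 2) * expR (- t) = 0)%R.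
      by rewrite le0_ppow ?mul0r// subr_le0 (le_trans t0)// sqr_ge0.
    over.
  by rewrite integral0.
have st0 : (0 < Num.sqrt t)%R by rewrite sqrtr_gt0.
rewrite (@ge0_integral_scaleE _ (Num.sqrt t))//; last 2 first.
- by meas.
- by move=> y; rewrite !mulr_ge0.
rewrite -!ge0_integralMlR//; try side.
apply: eq_integral => y _; congr EFin.
rewrite exprMn sqr_sqrtr ?ltW// (_ : t - t * y ^+ 2 = t * (1 - y ^+ 2))%R; last by ring.
rewrite ppowM// (@ppowE _ (x + 2^-1 - 1))//.
rewrite (_ : x + 2^-1 - 1 = 2^-1 + (x - 1))%R; last by ring.
by rewrite (@gt0_powRD _ t 2^-1 (x - 1))// powR12_sqrt ?ltW//; ring.
Qed.

Lemma bet_semi x : bet x x = (2 `^ (1 - 2 * x))%:E * semi x.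
Proof.
rewrite /bet -(@ge0_integral_shiftE _ 2^-1%R); last 2 first.
- by meas.
- by move=> t; rewrite mulr_ge0.
rewrite (@ge0_integral_scaleE _ 2^-1%R)//; last 2 first.
- by meas.
- by move=> t; rewrite mulr_ge0.
rewrite -!ge0_integralMlR//; try side.
apply: eq_integral => y _; congr EFin.
have -> : (2^-1 * y + 2^-1 = 2^-1 * (1 + y))%R by ring.
have -> : (1 - 2^-1 * (1 + y) = 2^-1 * (1 - y))%R by field.
rewrite !ppowM ?invr_gt0//.
have -> : (2^-1 `^ (x - 1) = 2 `^ (1 - x) :> R)%R.
  by rewrite -powR_inv1// -powRrM; congr powR; ring.
have -> : (2^-1 = 2 `^ (- 1) :> R)%R by rewrite powR_inv1.
have -> : (1 - 2 * x = -1 + (1 - x) + (1 - x))%R by ring.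
rewrite !gt0_powRD//.
have -> : ppow (x - 1) (1 - y ^+ 2) = (ppow (x - 1) (1 + y) * ppow (x - 1) (1 - y))%R.
  have [y1|y1] := leP (1 + y)%R 0%R.
    by rewrite le0_ppow ?(@le0_ppow _ _ (1 + y))// ?mul0r//; nra.
  have [y2|y2] := leP (1 - y)%R 0%R.
    by rewrite le0_ppow ?(@le0_ppow _ _ (1 - y))// ?mulr0//; nra.
  rewrite !ppowE//; last by nra.
  by rewrite -powRM ?ltW//; congr powR; ring.
by ring.
Qed.

(** Scaling [t] by [1 + y ^+ 2] writes [(1 + y ^+ 2) ^ (- m) * gam m] as the integral of
    [t ^ (m - 1) * expR (- t * (1 + y ^+ 2))]. After Tonelli, scaling [y] by [t ^ (- 1/2)] splits
    off the Gaussian and lowers the argument by 1/2. *)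
Lemma gam_cauchy m : gam m * cauchy m = gam (m - 2^-1) * gauss.
Proof.
have s0 := gauss_ge0; have g0 := gam_ge0 m.
rewrite muleC /cauchy ge0_integralMrR//; last by meas.
transitivity (\int[mu]_y \int[mu]_t (ppow (m - 1) t * expR (- (t * (1 + y ^+ 2))))%:E).
  apply: eq_integral => y _.
  rewrite [X in _ * X](@ge0_integral_scaleE _ (1 + y ^+ 2)%R) //; last 2 first.
  - by meas.
  - by move=> t; rewrite mulr_ge0.
  rewrite -!ge0_integralMlR//; try side.
  apply: eq_integral => t _; congr EFin.
  rewrite ppowM// powRN [((1 + y ^+ 2) * t)%R]mulrC.
  rewrite (_ : _ * (_ * (_ * _ * _)) = ((1 + y ^+ 2) `^ m)^-1 *
    ((1 + y ^+ 2) * (1 + y ^+ 2) `^ (m - 1)) *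
    (ppow (m - 1) t * expR (- (t * (1 + y ^+ 2)))))%R; last by ring.
  by rewrite powR_mul_self// mulVf ?mul1r// gt_eqF// powR_gt0.
etransitivity; first apply: (tonelliR (f := fun y t =>
    ppow (m - 1) t * expR (- (t * (1 + y ^+ 2))))%R).
- by meas.
- by move=> t u; rewrite !mulr_ge0.
rewrite /gam ge0_integralMrR//; try side.
apply: eq_integral => t _.
have [t0|t0] := ltP 0%R t; last first.
  rewrite (@le0_ppow _ (m - 2^-1 - 1))// mul0r mul0e.
  under eq_integral do rewrite le0_ppow// mul0r.
  by rewrite integral0.
have st0 : (0 < t `^ (- 2^-1))%R by rewrite powR_gt0.
rewrite (@ge0_integral_scaleE _ (t `^ (- 2^-1))%R)//; try side.
rewrite -!ge0_integralMlR//; try side.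
apply: eq_integral => y _; congr EFin.
rewrite exprMn.
have -> : (t * (1 + t `^ (- 2^-1) ^+ 2 * y ^+ 2) = t + y ^+ 2)%R.
  rewrite -powR_mulrn// -powRrM (_ : - 2^-1 * 2%:R = - 1)%R; last by field.
  by rewrite powR_inv1 ?ltW//; field; rewrite gt_eqF.
rewrite !ppowE// (_ : m - 2^-1 - 1 = - 2^-1 + (m - 1))%R; last by ring.
by rewrite (@gt0_powRD _ t (- 2^-1) (m - 1))// opprD expRD; ring.
Qed.

End gamma.

(** * Finiteness of the gamma integral and the duplication formula *)

Section gamma_finite.
Variable R : realType.
Local Open Scope ereal_scope.
Local Notation mu := (@lebesgue_measure R).
Implicit Types x t : R.

Lemma measurable_mem_itv (i : interval R) :
  measurable_fun setT (fun t : R => (t \in i)%:R : R).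
Proof.
have -> : (fun t : R => (t \in i)%:R : R) = \1_[set` i].
  by apply/funext => t; rewrite indicE mem_setE.
exact: measurable_indic.
Qed.

Lemma powR_le_max (a t : R) : (2^-1 <= t)%R -> (t <= 1)%R ->
  (t `^ a <= Num.max 1 (2^-1 `^ a))%R.
Proof.
move=> t2 t1; have t0 : (0 < t)%R by apply: lt_le_trans t2; rewrite invr_gt0.
rewrite le_max; have [a0|a0] := leP 0%R a.
  have e1 : (1 `^ a = 1 :> R)%R by rewrite powR1.
  by rewrite -[X in (_ <= X)%R]e1 ge0_ler_powR// ?nnegrE// ltW.
apply/orP; right; rewrite -(opprK a) !(@powRN _ _ (- a)) lef_pV2 ?posrE ?powR_gt0//.
by rewrite ge0_ler_powR// ?nnegrE ?invr_ge0 ?oppr_ge0// ltW.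
Qed.

(** Self-similarity replaces an antiderivative: doubling [t] sends the part of the truncated
    integrand below 1/2 to the previous truncation, so the truncated integrals satisfy
    [I_(n+1) <= C + 2 ^ (- x) * I_n] with ratio below 1. Monotone convergence passes their common
    bound to the limit. *)
Lemma integral_ppow01_lty x : (0 < x)%R ->
  \int[mu]_t (ppow (x - 1) t * (t < 1)%R%:R)%:E < +oo.
Proof.
move=> x0.
pose h n t : R := (ppow (x - 1) t * (t \in `](2^-1) ^+ n, 1[)%:R)%R.
have mh n : measurable_fun setT (h n).
  by rewrite /h; meas; exact: measurable_mem_itv.
have h0 n t : (0 <= h n t)%R by rewrite /h mulr_ge0// ppow_ge0.
pose C : R := (Num.max 1 (2^-1 `^ (x - 1)))%R.
have C0 : (0 <= C)%R by rewrite /C le_max ler01.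
have q1 : (2 `^ (- x) < 1 :> R)%R.
  rewrite powRN invf_lt1 ?powR_gt0//; have := @gt0_ltr_powR R x x0 1%R 2%R.
  by rewrite powR1; apply; rewrite ?nnegrE//; lra.
(* The fixed point of [M = C + 2 ^ (- x) * M]. *)
pose M : R := (C / (1 - 2 `^ (- x)))%R.
have M0 : (0 <= M)%R by rewrite divr_ge0// subr_ge0 ltW.
have hM n : \int[mu]_t (h n t)%:E <= M%:E.
  elim: n => [|n IH].
    rewrite (eq_integral (cst 0)).
      by rewrite integral0 lee_fin.
    move=> t _; rewrite /h expr0 in_itv/=; have [t1|t1] := boolP (1 < t < 1)%R.
      by move: t1 => /andP[/lt_trans/[apply]]; rewrite ltxx.
    by rewrite mulr0.
  have mh3 : measurable_fun setT (fun t => h n (2 * t))%R.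
    by apply: measurableT_comp (mh n) _; meas.
  have mh2 : measurable_fun setT (fun t => 2 `^ (1 - x) * h n (2 * t))%R by meas.
  apply: (@le_trans _ _ (\int[mu]_t ((C * (t \in `[0%R, 1%R])%:R)%:E +
      (2 `^ (1 - x) * h n (2 * t))%:E))).
    apply: ge0_le_integral => //.
    - by move=> t _; rewrite lee_fin.
    - by apply/measurable_EFinP; exact: mh.
    - apply: emeasurable_funD; first by meas; exact: measurable_mem_itv.
      by apply/measurable_EFinP; exact: mh2.
    - move=> t _; rewrite -EFinD lee_fin.
      have h2 : (0 <= 2 `^ (1 - x) * h n (2 * t))%R by rewrite mulr_ge0 ?powR_ge0.
      rewrite {1}/h in_itv/=.
      have [/andP[t1 t2]|_] := boolP (_ && _); last first.
        by rewrite mulr0 addr_ge0// mulr_ge0.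
      have t0 : (0 < t)%R by apply: lt_trans t1; rewrite exprn_gt0// invr_gt0.
      rewrite mulr1 ppowE//; have [t3|t3] := ltP t 2^-1%R; last first.
        apply: ler_wpDr => //; rewrite in_itv/= (ltW t0) (ltW t2) mulr1.
        by rewrite powR_le_max// ltW.
      apply: ler_wpDl; first by rewrite mulr_ge0.
      rewrite /h in_itv/= ppowM// ppowE// -ltr_pdivrMl// -exprS t1/=.
      rewrite (_ : 2 * t < 1)%R /=; last by lra.
      by rewrite mulr1 mulrA -gt0_powRD// (_ : 1 - x + (x - 1) = 0)%R ?powRr0 ?mul1r//; ring.
  rewrite ge0_integralD//; last 4 first.
  - by move=> t _; rewrite lee_fin mulr_ge0.
  - by meas; exact: measurable_mem_itv.
  - by move=> t _; rewrite lee_fin mulr_ge0// powR_ge0.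
  - by apply/measurable_EFinP; exact: mh2.
  have -> : \int[mu]_t (2 `^ (1 - x) * h n (2 * t))%:E =
            (2 `^ (- x))%:E * \int[mu]_t (h n t)%:E.
    rewrite [in RHS](@ge0_integral_scaleE _ _ 2%R)// muleA -EFinM.
    rewrite -ge0_integralMlR//.
    apply: eq_integral => t _; congr EFin; congr (_ * _)%R.
    by rewrite mulrC -(powR_mul_self (1 - x))// addrAC subrr add0r.
  rewrite ge0_integralMlR//; last first.
    exact: measurable_mem_itv.
  have -> : \int[mu]_t ((t \in `[0%R, 1%R])%:R)%:E = 1.
    have -> : \int[mu]_t ((t \in `[0%R, 1%R])%:R)%:E = \int[mu]_t (\1_`[0%R, 1%R] t)%:E.
      by apply: eq_integral => t _; rewrite indicE mem_setE.
    rewrite integral_indic// setIT// -[LHS]/(lebesgue_measure `[0%R, 1%R]%classic).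
    by rewrite lebesgue_measure_itv/= lte_fin ltr01 -EFinB subr0.
  rewrite mule1 (@le_trans _ _ (C%:E + (2 `^ (- x))%:E * M%:E))//.
    by rewrite leeD2l// lee_wpmul2l// lee_fin powR_ge0.
  rewrite -EFinM -EFinD lee_fin /M le_eqVlt; apply/orP; left; apply/eqP.
  by field; lra.
have nd t : {homo (fun n => (h n t)%:E) : n m / (n <= m)%N >-> n <= m}.
  move=> n m nm; rewrite lee_fin ler_wpM2l ?ppow_ge0// ler_nat !in_itv/=.
  case: (boolP (_ && _)) => // /andP[t1 ->]; rewrite andbT lt0b.
  by apply: le_lt_trans t1; rewrite ler_wiXn2l// ?invr_ge0// invf_le1// ler1n.
have lim_h t : limn (fun n => (h n t)%:E) = (ppow (x - 1) t * (t < 1)%R%:R)%:E.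
  apply/cvg_lim => //; have [t0|t0] := leP t 0%R.
    by under eq_fun do rewrite /h le0_ppow// mul0r; rewrite le0_ppow// mul0r; exact: cvg_cst.
  apply: cvg_near_cst.
  near=> n; rewrite /h in_itv/= (_ : (2^-1 ^+ n < t)%R)//.
  near: n; apply: cvgr_lt t0; apply: cvg_expr.
  by rewrite ger0_norm ?invr_ge0// invf_lt1// ltr1n.
under eq_integral do rewrite -lim_h.
rewrite monotone_convergence//; last 2 first.
- by move=> n; apply/measurable_EFinP; exact: mh.
- by move=> n t _; rewrite lee_fin.
apply: (@le_lt_trans _ _ M%:E); last exact: ltry.
apply: lime_le; last by near=> n; exact: hM.
apply: ereal_nondecreasing_is_cvgn => n m nm; apply: ge0_le_integral => //.
- by move=> t _; rewrite lee_fin.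
- by apply/measurable_EFinP; exact: mh.
- by apply/measurable_EFinP; exact: mh.
- by move=> t _; exact: nd.
Unshelve. all: by end_near. Qed.

Lemma powR_bounded_expR x : {C : R | (0 <= C)%R &
  forall t, (1 <= t)%R -> (t `^ (x - 1) <= C * expR (t / 2))%R}.
Proof.
(* With this [k], [t / 2 = (a + 1) * (t / k)], so [ln (t / k) < t / k] bounds [a * ln (t / k)] by
   [t / 2]; the remaining [a * ln k] gives the constant. *)
pose a : R := `|x - 1|%R; pose k : R := (2 * (a + 1))%R.
have a0 : (0 <= a)%R by exact: normr_ge0.
have k0 : (0 < k)%R by rewrite /k mulr_gt0//; lra.
exists (expR (a * ln k)) => [|t t1]; first exact: expR_ge0.
have t0 : (0 < t)%R by exact: lt_le_trans t1.
rewrite /powR gt_eqF// -expRD ler_expR.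
have lt0 : (0 <= ln t)%R by rewrite ln_ge0.
apply: (@le_trans _ _ (a * ln t)%R); first by rewrite ler_wpM2r// ler_norm.
have e : t = (t / k * k)%R by rewrite divfK// gt_eqF.
rewrite {1}e lnM ?posrE ?divr_gt0// mulrDr addrC lerD2l.
have := @ln_sublinear R (t / k) (divr_gt0 t0 k0) => h.
apply: (@le_trans _ _ (a * (t / k))%R); first by rewrite ler_wpM2l// ltW.
have -> : (t / 2 = (a + 1) * (t / k))%R.
  by rewrite /k; field; apply/eqP; lra.
by rewrite ler_wpM2r ?divr_ge0// ?ltW// ltrDl.
Qed.

Lemma gam_lty x : (0 < x)%R -> gam x < +oo.
Proof.
move=> x0; have [C C0 hC] := powR_bounded_expR x.
have m1 : measurable_fun setT (fun t : R => ppow (x - 1) t * (t < 1)%R%:R)%R.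
  apply: measurable_funM; first by meas.
  have -> : (fun t : R => (t < 1)%R%:R : R) = (fun t => (t \in `]-oo, 1%R[)%:R).
    by apply/funext => t; rewrite in_itv.
  exact: measurable_mem_itv.
(* Half of the decay of [expR (- t)] absorbs the power of [t]; what remains is twice the exponential
   density of rate 1/2, whose integral is 1. *)
have m2 : measurable_fun setT (fun t : R => C * (2 * exponential_pdf 2^-1 t))%R.
  by meas; exact: measurable_exponential_pdf.
have p0 t : (0 <= exponential_pdf 2^-1 t :> R)%R.
  by rewrite exponential_pdf_ge0// invr_ge0.
apply: (@le_lt_trans _ _ (\int[mu]_t ((ppow (x - 1) t * (t < 1)%R%:R)%:E +
    (C * (2 * exponential_pdf 2^-1 t))%:E))).
  apply: ge0_le_integral => //.
  - by move=> t _; rewrite lee_fin mulr_ge0// ?ppow_ge0// expR_ge0.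
  - by meas.
  - apply: emeasurable_funD; apply/measurable_EFinP; [exact: m1|exact: m2].
  - move=> t _; rewrite -EFinD lee_fin.
    have [t0|t0] := leP t 0%R.
      by rewrite le0_ppow// !mul0r addr_ge0// !mulr_ge0.
    have [t1|t1] := ltP t 1%R.
      rewrite mulr1 ler_wpDr ?mulr_ge0// ler_piMr ?ppow_ge0//.
      by rewrite -expR0 ler_expR; lra.
    rewrite mulr0 add0r ppowE// (le_trans (ler_wpM2r (expR_ge0 _) (hC _ t1)))//.
    rewrite (exponential_pdfE _ (ltW t0))/= -mulrA -expRD ler_wpM2l//.
    by rewrite [leRHS]mulrA divff// mul1r ler_expR; lra.
rewrite ge0_integralD//; last 4 first.
- by move=> t _; rewrite lee_fin mulr_ge0// ppow_ge0.
- by apply/measurable_EFinP; exact: m1.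
- by move=> t _; rewrite lee_fin !mulr_ge0.
- by apply/measurable_EFinP; exact: m2.
rewrite lte_add_pinfty//; first exact: integral_ppow01_lty.
have mp := @measurable_exponential_pdf R 2^-1%R.
rewrite ge0_integralMlR//; last 2 first.
- by meas; exact: mp.
- by move=> t; rewrite mulr_ge0.
by rewrite ge0_integralMlR// integral_exponential_pdf// ?invr_gt0// mule1 -EFinM ltry.
Qed.

(** On [[1/2, 1]] the integrand is at least the positive constant [c]: [powR_le_max] at the opposite
    exponent bounds the inverse of the power by [K]. *)
Lemma gam_gt0 x : 0 < gam x.
Proof.
pose K : R := (Num.max 1 (2^-1 `^ (- (x - 1))))%R.
have K0 : (0 < K)%R by rewrite /K lt_max ltr01.
pose c : R := (K^-1 * expR (- 1))%R.
have c0 : (0 < c)%R by rewrite mulr_gt0 ?invr_gt0// expR_gt0.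
apply: (@lt_le_trans _ _ (c%:E * \int[mu]_t ((t \in `[2^-1%R, 1%R])%:R)%:E)).
  have -> : \int[mu]_t ((t \in `[2^-1%R, 1%R])%:R)%:E = \int[mu]_t (\1_`[2^-1%R, 1%R] t)%:E.
    by apply: eq_integral => t _; rewrite indicE mem_setE.
  rewrite integral_indic// setIT// -[X in _ * X]/(lebesgue_measure `[2^-1%R, 1%R]%classic).
  rewrite lebesgue_measure_itv/= lte_fin invf_lt1// ltr1n.
  by rewrite -EFinB -EFinM lte_fin mulr_gt0//; lra.
rewrite -ge0_integralMlR//; last 2 first.
- exact: measurable_mem_itv.
- exact: ltW.
apply: ge0_le_integral => //.
- by move=> t _; rewrite lee_fin mulr_ge0// ltW.
- by meas; exact: measurable_mem_itv.
- by meas.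
move=> t _; rewrite lee_fin in_itv/=.
have [/andP[t1 t2]|_] := boolP (_ && _); last first.
  by rewrite mulr0 mulr_ge0// ?ppow_ge0// expR_ge0.
have t0 : (0 < t)%R by apply: lt_le_trans t1; rewrite invr_gt0.
rewrite mulr1 /c ppowE// ler_pM// ?expR_ge0// ?invr_ge0 ?(ltW K0)//.
  rewrite -(opprK (x - 1)%R) powRN lef_pV2 ?posrE ?powR_gt0//.
  exact: powR_le_max.
by rewrite ler_expR lerN2.
Qed.

Lemma gaussE : @gauss R = (Num.sqrt pi)%:E.
Proof. exact: integralT_gauss. Qed.

Definition gammaR x : R := fine (gam x).

Lemma gammaRE x : (0 < x)%R -> gam x = (gammaR x)%:E.
Proof. by move=> x0; rewrite fineK// ge0_fin_numE ?gam_lty// gam_ge0. Qed.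

Lemma gammaR_gt0 x : (0 < x)%R -> (0 < gammaR x)%R.
Proof. by move=> x0; rewrite -lte_fin -gammaRE// gam_gt0. Qed.

Lemma mule_EFin_eq (a b : R) (y : \bar R) : (0 < a)%R ->
  a%:E * y = b%:E -> y = (b / a)%:E.
Proof.
move=> a0; case: y => [r| |].
- by rewrite -EFinM => -[<-]; congr EFin; field; rewrite gt_eqF.
- by rewrite gt0_muley ?lte_fin.
- by rewrite gt0_muleNy ?lte_fin.
Qed.

Lemma betE x y : (0 < x)%R -> (0 < y)%R ->
  bet x y = (gammaR x * gammaR y / gammaR (x + y))%:E.
Proof.
move=> x0 y0; apply: mule_EFin_eq; first exact/gammaR_gt0/addr_gt0.
by rewrite -gammaRE ?addr_gt0// -gam_bet !gammaRE// EFinM.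
Qed.

(** Legendre's duplication formula as algebra. With [G], [H], [D], [s] standing for Gamma at [x],
    [x - 1/2], [2 * x - 1] and the square root of pi, the two expressions of the beta integral at
    [(x - 1/2, x - 1/2)] give [H * G = p * s * D], which eliminates [H]. *)
Lemma duplication_elim (G H D p s q : R) : (0 < G)%R -> (0 < H)%R -> (0 < D)%R ->
  (s ^+ 2 = q)%R -> (H * H / D = p * (H * s / G))%R ->
  (H * s / G = q * p * D / G ^+ 2)%R.
Proof.
move=> /lt0r_neq0 G0 /lt0r_neq0 H0 /lt0r_neq0 D0 <- dup.
have e : (H * G = p * s * D)%R.
  apply: (@mulfI _ (H / (D * G))%R); first by rewrite mulf_neq0 ?invr_eq0 ?mulf_neq0.
  transitivity (H * H / D)%R; first by field; apply/andP.
  by rewrite dup; field; apply/andP.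
apply: (@mulIf _ (G ^+ 2)%R); first by rewrite expf_neq0.
by transitivity (H * G * s)%R; [field|rewrite e; field].
Qed.

(** The quotient [gam (x - 1/2) / gam x] is rewritten by duplication so that [gammaR (2 * x - 1)]
    appears, which is the denominator of the beta factor it will be multiplied by. *)
Lemma cauchyE x : (2^-1 < x)%R ->
  cauchy x = (pi * 2 `^ (2 - 2 * x) * gammaR (2 * x - 1) / gammaR x ^+ 2)%:E.
Proof.
move=> x2; have x0 : (0 < x)%R by apply: lt_trans x2; rewrite invr_gt0.
have h0 : (0 < x - 2^-1)%R by rewrite subr_gt0.
have d0 : (0 < 2 * x - 1)%R by lra.
have sp : (Num.sqrt pi ^+ 2 = pi :> R)%R by rewrite sqr_sqrtr// pi_ge0.
have hc := gam_cauchy x; have hs := gam_semi (x - 2^-1).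
have hb := bet_semi (x - 2^-1).
rewrite gaussE (gammaRE x0) (gammaRE h0) -EFinM in hc.
rewrite subrK gaussE (gammaRE x0) (gammaRE h0) -EFinM in hs.
have {}hs := mule_EFin_eq (gammaR_gt0 x0) (esym hs).
rewrite hs (betE h0 h0) -EFinM in hb.
have e1 : (x - 2^-1 + (x - 2^-1) = 2 * x - 1)%R by field.
have e2 : (1 - 2 * (x - 2^-1) = 2 - 2 * x)%R by field.
rewrite e1 e2 in hb.
rewrite (mule_EFin_eq (gammaR_gt0 x0) hc); congr EFin.
have [hb'] := hb.
exact: (duplication_elim (gammaR_gt0 x0) (gammaR_gt0 h0) (gammaR_gt0 d0) sp hb').
Qed.

End gamma_finite.

(** * Lebesgue measure on [C^n]: affine maps and unitary invariance *)

Local Open Scope complex_scope.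
Local Notation Re := complex.Re.
Local Notation Im := complex.Im.

Section complex_basics.
Variable R : realType.
Implicit Types (a b z w : R[i]) (c : R).

Lemma complex_ext z w : Re z = Re w -> Im z = Im w -> z = w.
Proof. by case: z w => [? ?] [? ?] /= -> ->. Qed.
Lemma ReD z w : Re (z + w) = Re z + Re w. Proof. by case: z; case: w. Qed.
Lemma ImD z w : Im (z + w) = Im z + Im w. Proof. by case: z; case: w. Qed.
Lemma ReN z : Re (- z) = - Re z. Proof. by case: z. Qed.
Lemma ImN z : Im (- z) = - Im z. Proof. by case: z. Qed.
Lemma ReM z w : Re (z * w) = Re z * Re w - Im z * Im w.
Proof. by case: z; case: w. Qed.
Lemma ImM z w : Im (z * w) = Re z * Im w + Im z * Re w.
Proof. by case: z; case: w. Qed.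
Lemma ReJ z : Re z^* = Re z. Proof. by case: z. Qed.
Lemma ImJ z : Im z^* = - Im z. Proof. by case: z. Qed.
Lemma Re1 : Re (1 : R[i]) = 1. Proof. by []. Qed.
Lemma Im1 : Im (1 : R[i]) = 0. Proof. by []. Qed.
Lemma Re0 : Re (0 : R[i]) = 0. Proof. by []. Qed.
Lemma Im0 : Im (0 : R[i]) = 0. Proof. by []. Qed.
Definition ReImE :=
  (ReD, ImD, ReN, ImN, ReM, ImM, ReJ, ImJ, Re1, Im1, Re0, Im0).

Lemma normc_ge0 z : 0 <= normc z. Proof. by case: z => a b; exact: sqrtr_ge0. Qed.
Lemma normc_conj z : normc z^* = normc z.
Proof. by case: z => a b; rewrite /= sqrrN. Qed.
Lemma normcR c : normc c%:C = `|c|.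
Proof. by rewrite /normc /= expr0n addr0 sqrtr_sqr. Qed.
Lemma normc_eq0 z : (normc z == 0) = (z == 0).
Proof.
apply/eqP/eqP => [/eq0_normc//|->]; exact: normc0.
Qed.

Lemma normr_Re_le z : `|Re z| <= normc z.
Proof.
rewrite -sqrtr_sqr -[leRHS]ger0_norm ?normc_ge0//.
by rewrite -sqrtr_sqr ler_sqrt ?sqr_ge0// sqr_normcE lerDl sqr_ge0.
Qed.

Lemma normr_Im_le z : `|Im z| <= normc z.
Proof.
rewrite -sqrtr_sqr -[leRHS]ger0_norm ?normc_ge0//.
by rewrite -sqrtr_sqr ler_sqrt ?sqr_ge0// sqr_normcE lerDr sqr_ge0.
Qed.

Lemma measurable_complexP d (T : measurableType d) (f : T -> R[i]) :
  measurable_fun setT (fun x => Re (f x)) -> measurable_fun setT (fun x => Im (f x)) ->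
  measurable_fun setT f.
Proof.
move=> mr mi.
have -> : f = (@complex_of_pair R) \o (fun x => (Re (f x), Im (f x))).
  by apply/funext => x; rewrite /= /complex_of_pair /=; case: (f x).
apply: measurableT_comp; first exact: measurable_complex_of_pair.
exact: measurable_fun_pair.
Qed.

Lemma measurable_Re_fun d (T : measurableType d) (f : T -> R[i]) :
  measurable_fun setT f -> measurable_fun setT (fun x => Re (f x)).
Proof. exact: measurableT_comp (@measurable_Re R). Qed.

Lemma measurable_Im_fun d (T : measurableType d) (f : T -> R[i]) :
  measurable_fun setT f -> measurable_fun setT (fun x => Im (f x)).
Proof. exact: measurableT_comp (@measurable_Im R). Qed.

Lemma measurable_normc d (T : measurableType d) (f : T -> R[i]) :
  measurable_fun setT f -> measurable_fun setT (fun x => normc (f x)).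
Proof.
move=> mf; rewrite (_ : (fun x => _) = fun x => (Re (f x) ^+ 2 + Im (f x) ^+ 2) `^ 2^-1).
  apply: measurable_powR_fun; apply: measurable_funD; apply: measurable_funX.
    exact: measurable_Re_fun.
  exact: measurable_Im_fun.
apply/funext => x; rewrite powR12_sqrt ?addr_ge0 ?sqr_ge0//.
by case: (f x).
Qed.

Section closure.
Context d (T : measurableType d).
Variables f g : T -> R[i].
Hypotheses (mf : measurable_fun setT f) (mg : measurable_fun setT g).

Lemma measurable_addc : measurable_fun setT (fun x => f x + g x).
Proof.
by apply: measurable_complexP; [under [X in measurable_fun _ X]eq_fun do rewrite ReD|
  under [X in measurable_fun _ X]eq_fun do rewrite ImD]; apply: measurable_funD;
  (exact: measurable_Re_fun || exact: measurable_Im_fun).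
Qed.

Lemma measurable_oppc : measurable_fun setT (fun x => - f x).
Proof.
by apply: measurable_complexP; [under [X in measurable_fun _ X]eq_fun do rewrite ReN|
  under [X in measurable_fun _ X]eq_fun do rewrite ImN]; apply: measurable_oppr_fun;
  (exact: measurable_Re_fun || exact: measurable_Im_fun).
Qed.

Lemma measurable_mulc : measurable_fun setT (fun x => f x * g x).
Proof.
have [mr mi] := (measurable_Re_fun mf, measurable_Im_fun mf).
have [nr ni] := (measurable_Re_fun mg, measurable_Im_fun mg).
apply: measurable_complexP; [under [X in measurable_fun _ X]eq_fun do rewrite ReM|
  under [X in measurable_fun _ X]eq_fun do rewrite ImM].
  by apply: measurable_funB; apply: measurable_funM.
by apply: measurable_funD; apply: measurable_funM.
Qed.

Lemma measurable_conjc : measurable_fun setT (fun x => (f x)^* ).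
Proof.
apply: measurable_complexP; [under [X in measurable_fun _ X]eq_fun do rewrite ReJ|
  under [X in measurable_fun _ X]eq_fun do rewrite ImJ].
  exact: measurable_Re_fun.
exact/measurable_oppr_fun/measurable_Im_fun.
Qed.

End closure.

End complex_basics.

Ltac cmeas1 := match goal with
  | |- measurable_fun _ (fun x => Re (Complex _ _)) => rewrite /=
  | |- measurable_fun _ (fun x => Im (Complex _ _)) => rewrite /=
  | |- measurable_fun _ (fun x => Re _) => apply: measurable_Re_fun
  | |- measurable_fun _ (fun x => Im _) => apply: measurable_Im_fun
  | |- measurable_fun _ (fun x => normc _) => apply: measurable_normc
  | |- measurable_fun _ (fun x => GRing.add _ _) => apply: measurable_addc
  | |- measurable_fun _ (fun x => GRing.mul _ _) => apply: measurable_mulc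
  | |- measurable_fun _ (fun x => GRing.opp _) => apply: measurable_oppc
  | |- measurable_fun _ (fun x => conjc _) => apply: measurable_conjc
  | |- measurable_fun _ (fun x => Complex _ _) => apply: measurable_complexP
  | |- measurable_fun ?D (GRing.mul ?c) => change (measurable_fun D (fun x => c * x)%R)
  | |- measurable_fun ?D (GRing.add ?c) => change (measurable_fun D (fun x => c + x)%R)
  | |- measurable_fun ?D (@GRing.opp _) =>
      first [exact: oppr_measurable | change (measurable_fun D (fun x => - x)%R)]
  | |- measurable_fun _ (Complex _) => apply: measurable_complexP
  | |- measurable_fun _ (@complex.Re _) => exact: measurable_Re
  | |- measurable_fun _ (@complex.Im _) => exact: measurable_Im
  | |- measurable_fun ?D (@conjc _) => change (measurable_fun D (fun x => conjc x))
  | |- measurable_fun ?D (@normc _) => change (measurable_fun D (fun x => normc x))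
  | |- measurable_fun _ (fun x => (_, _)) => apply: measurable_fun_pair
  end.
Ltac cmeas := repeat first [by [] | exact: measurable_cst | exact: measurable_id
  | cmeas1 | progress meas].

Section complex_measure.
Variable R : realType.
Local Open Scope ereal_scope.
Local Notation mu := (@lebesgue_measure R).
Local Notation muC := (@lebesgueC R).

Lemma ge0_integral_lebesgueC (f : R[i] -> \bar R) :
  measurable_fun setT f -> (forall z, 0 <= f z) ->
  \int[muC]_z f z = \int[mu]_x \int[mu]_y f (x +i* y).
Proof.
move=> mf f0.
have mc := @measurable_complex_of_pair R.
rewrite (@eq_measure_integral _ _ _ setT (pushforward (mu \x mu) (@complex_of_pair R)))//.
rewrite ge0_integral_pushforward//= preimage_setT.
by rewrite (fubini_tonelli1 (m1 := mu) (m2 := mu)) //=; exact: measurableT_comp.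
Qed.

Lemma ge0_integral_lebesgueCn n (f : n.+1.-tuple R[i] -> \bar R) :
  measurable_fun setT f -> (forall z, 0 <= f z) ->
  \int[lebesgueCn R n.+1]_w f w =
  \int[muC]_a \int[lebesgueCn R n]_t f [tuple of a :: t].
Proof.
move=> mf f0 /=.
have mc := @measurable_cons_pair R n.
rewrite (@eq_measure_integral _ _ _ setT (pushforward (muC \x lebesgueCn R n) (@cons_pair R n)))//.
rewrite ge0_integral_pushforward//= preimage_setT.
by rewrite (fubini_tonelli1 (m1 := muC) (m2 := lebesgueCn R n)) //=; exact: measurableT_comp.
Qed.

Let measurable_inner (f : R[i] -> \bar R) :
  measurable_fun setT f -> (forall z, 0 <= f z) ->
  measurable_fun setT (fun x : R => \int[mu]_y f (x +i* y)).
Proof.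
move=> mf f0.
apply: (measurable_fun_fubini_tonelli_F (m2 := mu) (fun z : R * R => f (z.1 +i* z.2)));
  last by [].
exact: measurableT_comp mf (@measurable_complex_of_pair R).
Qed.

Let measurable_slice (f : R[i] -> \bar R) (x : R) :
  measurable_fun setT f -> measurable_fun setT (fun y : R => f (x +i* y)).
Proof.
by move=> mf; apply: measurableT_comp mf _; cmeas.
Qed.

(** As [c] is real, the map acts on real and imaginary parts separately, and each of the two
    contributes one factor [c]. *)
Lemma ge0_integralC_affine (f : R[i] -> \bar R) (c : R) (b : R[i]) :
  measurable_fun setT f -> (forall z, 0 <= f z) -> (0 < c)%R ->
  (c ^+ 2)%:E * \int[muC]_z f (c%:C * z + b)%R = \int[muC]_z f z.
Proof.
move=> mf f0 c0.
have maff : measurable_fun setT (fun z : R[i] => c%:C * z + b)%R by cmeas.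
rewrite !ge0_integral_lebesgueC//; last exact: measurableT_comp maff.
rewrite expr2 EFinM -muleA -[RHS](@ge0_integral_shift _ _ (Re b)); last 2 first.
- exact: measurable_inner.
- by move=> x; exact: integral_ge0.
rewrite -[RHS](@ge0_integral_scale _ _ c)//; last 2 first.
- have := measurable_inner mf f0; move/measurableT_comp; apply.
  by meas.
- by move=> x; exact: integral_ge0.
congr (_ * _); rewrite -ge0_integralZl_EFin//; last 3 first.
- by move=> x _; exact: integral_ge0.
- apply: (@measurable_inner (fun z => f (c%:C * z + b)%R)) => //.
  exact: measurableT_comp maff.
- exact: ltW.
apply: eq_integral => x _.
rewrite -[RHS](@ge0_integral_shift _ _ (Im b))//; last exact: measurable_slice.
rewrite -[RHS](@ge0_integral_scale _ _ c)//.
- congr (_ * _); apply: eq_integral => y _; congr f.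
  by apply: complex_ext; rewrite !ReImE/=; ring.
- by apply: measurableT_comp (measurable_slice _ mf) _; meas.
Qed.

End complex_measure.

(** * Rotations as products of shears *)

Section shears.
Context d (X : measurableType d) (R : realType).
Variables (m : {sigma_finite_measure set X -> \bar R}) (sh : R -> X -> X -> X).
Local Open Scope ereal_scope.
Hypothesis msh : forall t, measurable_fun setT (fun z : X * X => sh t z.1 z.2).
Hypothesis ish : forall t x (g : X -> \bar R), measurable_fun setT g ->
  (forall y, 0 <= g y) -> \int[m]_y g (sh t x y) = \int[m]_y g y.
Implicit Types f : X * X -> \bar R.

Lemma measurable_shear_snd t :
  measurable_fun setT (fun z : X * X => (z.1, sh t z.1 z.2)).
Proof. by apply: measurable_fun_pair; [exact: measurable_fst|exact: msh]. Qed.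

Lemma measurable_shear_fst t :
  measurable_fun setT (fun z : X * X => (sh t z.2 z.1, z.2)).
Proof.
apply: measurable_fun_pair => //.
apply: (measurableT_comp (msh t) (g := fun z => (z.2, z.1))).
exact: measurable_fun_pair.
Qed.

Lemma ge0_integral_shear_snd f t : measurable_fun setT f -> (forall z, 0 <= f z) ->
  \int[m \x m]_z f (z.1, sh t z.1 z.2) = \int[m \x m]_z f z.
Proof.
move=> mf f0.
rewrite (fubini_tonelli1 (m1 := m) (m2 := m) (fun z => f (z.1, sh t z.1 z.2)))//; last first.
  exact: measurableT_comp mf (measurable_shear_snd t).
rewrite (fubini_tonelli1 (m1 := m) (m2 := m) f mf f0).
apply: eq_integral => x _; apply: (@ish t x (fun y => f (x, y))) => //.
exact: measurableT_comp.
Qed.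

Lemma ge0_integral_shear_fst f t : measurable_fun setT f -> (forall z, 0 <= f z) ->
  \int[m \x m]_z f (sh t z.2 z.1, z.2) = \int[m \x m]_z f z.
Proof.
move=> mf f0.
rewrite (fubini_tonelli2 (m1 := m) (m2 := m) (fun z => f (sh t z.2 z.1, z.2)))//; last first.
  exact: measurableT_comp mf (measurable_shear_fst t).
rewrite (fubini_tonelli2 (m1 := m) (m2 := m) f mf f0).
apply: eq_integral => y _; apply: (@ish t y (fun x => f (x, y))) => //.
exact: measurableT_comp.
Qed.

(* A plane rotation other than the half-turn is a product of three shears. *)
Lemma ge0_integral_three_shears f t s : measurable_fun setT f -> (forall z, 0 <= f z) ->
  \int[m \x m]_z f (sh t (sh s (sh t z.2 z.1) z.2) (sh t z.2 z.1),
                     sh s (sh t z.2 z.1) z.2) = \int[m \x m]_z f z.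
Proof.
move=> mf f0.
pose f3 z := f (sh t z.2 z.1, z.2); pose f2 z := f3 (z.1, sh s z.1 z.2).
have m3 : measurable_fun setT f3 by exact: measurableT_comp mf (measurable_shear_fst t).
have m2 : measurable_fun setT f2 by exact: measurableT_comp m3 (measurable_shear_snd s).
apply: etrans (ge0_integral_shear_fst t m2 (fun=> f0 _)) _.
apply: etrans (ge0_integral_shear_snd s m3 (fun=> f0 _)) _.
exact: ge0_integral_shear_fst.
Qed.

End shears.

Section rotations.
Variable R : realType.
Local Open Scope ereal_scope.
Local Notation mu := (@lebesgue_measure R).
Local Notation muC := (@lebesgueC R).
Implicit Types c s : R.

(** For [c = cos a] and [s = sin a], the number [t] is [- tan (a / 2)]: it is the coefficient of the
    two outer shears, the middle one having coefficient [s]. The half-turn is where this tangent is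
    infinite. *)
Let shear_coef c s : (c ^+ 2 + s ^+ 2 = 1)%R -> (c != -1)%R -> exists t,
  (1 + t * s = c /\ t * c + t = - s)%R.
Proof.
move=> cs c1; exists (- (s / (1 + c)))%R.
have c10 : (1 + c != 0)%R by rewrite addrC addr_eq0.
have s2 : (s ^+ 2 = (1 - c) * (1 + c))%R by rewrite -subr_sqr expr1n -cs addrAC subrr add0r.
split; last by field.
by rewrite mulNr [(s / _ * s)%R]mulrAC -expr2 s2 mulfK// subKr.
Qed.

Lemma ge0_integral_rotR (f : R * R -> \bar R) c s :
  (c ^+ 2 + s ^+ 2 = 1)%R -> (c != -1)%R ->
  measurable_fun setT f -> (forall z, 0 <= f z) ->
  \int[mu \x mu]_z f (c * z.1 - s * z.2, s * z.1 + c * z.2)%R = \int[mu \x mu]_z f z.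
Proof.
move=> cs c1 mf f0; have [t [e1 e2]] := shear_coef cs c1.
apply: etrans (@ge0_integral_three_shears _ (measurableTypeR R) R mu
  (fun t x y => y + t * x)%R _ _ f t s mf f0).
- apply: eq_integral => -[x y] _ /=; congr (f (_, _)).
    by rewrite -mulNr -e2 -e1; ring.
  by rewrite -e1; ring.
- by move=> u; meas.
- by move=> u x g mg g0; apply: ge0_integral_shift.
Qed.

Lemma ge0_integral_rotC (f : R[i] * R[i] -> \bar R) c s :
  (c ^+ 2 + s ^+ 2 = 1)%R -> (c != -1)%R ->
  measurable_fun setT f -> (forall z, 0 <= f z) ->
  \int[muC \x muC]_z f (c%:C * z.1 - s%:C * z.2, s%:C * z.1 + c%:C * z.2)%R =
  \int[muC \x muC]_z f z.
Proof.
move=> cs c1 mf f0; have [t [e1 e2]] := shear_coef cs c1.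
apply: etrans (@ge0_integral_three_shears _ _ R muC
  (fun t x y => y + t%:C * x)%R _ _ f t s mf f0).
- apply: eq_integral => -[x y] _ /=; congr (f (_, _)).
    have -> : (- (s%:C * y) = (t * c + t)%:C * y)%R.
      by rewrite e2; apply: complex_ext; rewrite !ReImE/=; ring.
    by apply: complex_ext; rewrite !ReImE/= -e1; ring.
  by apply: complex_ext; rewrite !ReImE/= -e1; ring.
- by move=> u; cmeas.
- move=> u x g mg g0; rewrite -[RHS](@ge0_integralC_affine _ g 1 (u%:C * x)%R)// expr1n mul1e.
  by apply: eq_integral => y _; rewrite mul1r.
Qed.

Let ge0_integralC_phase' (f : R[i] -> \bar R) (u : R[i]) : (Re u != -1)%R ->
  normc u = 1%R -> measurable_fun setT f -> (forall z, 0 <= f z) ->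
  \int[muC]_z f (u * z)%R = \int[muC]_z f z.
Proof.
move=> u1 nu mf f0.
have mg : measurable_fun setT (fun z : R[i] => u * z)%R by cmeas.
have cs : (Re u ^+ 2 + Im u ^+ 2 = 1)%R by rewrite -sqr_normcE nu expr1n.
rewrite !ge0_integral_lebesgueC//; last exact: measurableT_comp mg.
pose F z := f (z.1 +i* z.2).
have mF : measurable_fun setT F.
  exact: measurableT_comp mf (@measurable_complex_of_pair R).
have := @ge0_integral_rotR F (Re u) (Im u) cs u1 mF (fun=> f0 _).
rewrite (fubini_tonelli1 (m1 := mu) (m2 := mu) F mF (fun=> f0 _)).
rewrite (fubini_tonelli1 (m1 := mu) (m2 := mu)
  (fun z => F (Re u * z.1 - Im u * z.2, Im u * z.1 + Re u * z.2)%R)); last 2 first.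
- by apply: measurableT_comp mF _; cmeas.
- by move=> z; exact: f0.
move=> <-; apply: eq_integral => x _; apply: eq_integral => y _; congr f.
by apply: complex_ext; rewrite ReImE/=; ring.
Qed.

(** The half-turn, out of reach of the three shears, is multiplication by ['i] performed twice. *)
Lemma ge0_integralC_phase (f : R[i] -> \bar R) (u : R[i]) :
  normc u = 1%R -> measurable_fun setT f -> (forall z, 0 <= f z) ->
  \int[muC]_z f (u * z)%R = \int[muC]_z f z.
Proof.
move=> nu mf f0; have [u1|u1] := eqVneq (Re u) (-1)%R; last exact: ge0_integralC_phase'.
have nz : normc ('i : R[i]) = 1%R by rewrite /= expr0n expr1n add0r sqrtr1.
have ni : (Re ('i : R[i]) != -1)%R by rewrite /= eq_sym oppr_eq0 oner_eq0.
have mg : measurable_fun setT (fun z : R[i] => f ('i * z)%R).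
  by apply: measurableT_comp mf _; cmeas.
rewrite -[RHS](ge0_integralC_phase' ni nz mf f0).
rewrite -[RHS](ge0_integralC_phase' ni nz mg (fun=> f0 _)).
apply: eq_integral => z _; congr f.
have u2 : (Im u = 0)%R.
  have := sqr_normcE u; rewrite nu u1 => h.
  by apply/eqP; rewrite -sqrf_eq0; apply/eqP; lra.
by apply: complex_ext; rewrite !ReImE u1 u2/=; ring.
Qed.

End rotations.

Section tuples.
Variable R : realType.
Local Notation C := R[i].
Implicit Types n : nat.

Definition nrm2 n (w : n.-tuple C) : R := \sum_(j < n) normc (tnth w j) ^+ 2.
Definition ccons n (a : C) (t : n.-tuple C) : n.+1.-tuple C := [tuple of a :: t].

Lemma thead_ccons n a (t : n.-tuple C) : thead (ccons a t) = a.
Proof. by rewrite /thead tnth0. Qed.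

Lemma nrm2_ge0 n (w : n.-tuple C) : 0 <= nrm2 w.
Proof. by apply: sumr_ge0 => j _; exact: sqr_ge0. Qed.

Lemma nrm2_ccons n a (t : n.-tuple C) : nrm2 (ccons a t) = normc a ^+ 2 + nrm2 t.
Proof.
rewrite /nrm2 big_ord_recl tnth0; congr (_ + _).
by apply: eq_bigr => j _; rewrite tnthS.
Qed.

Lemma cdot_ccons n a b (t s : n.-tuple C) :
  cdot (ccons a t) (ccons b s) = a * conjc b + cdot t s.
Proof.
rewrite /cdot big_ord_recl !tnth0; congr (_ + _).
by apply: eq_bigr => j _; rewrite !tnthS.
Qed.

Lemma tuple_cconsP n (w : n.+1.-tuple C) : exists a t, w = ccons a t.
Proof. by exists (thead w), [tuple of behead w]; exact: tuple_eta. Qed.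

Lemma unit_ballE n (w : n.-tuple C) : unit_ball w = (nrm2 w < 1) :> Prop.
Proof. by []. Qed.

Lemma measurable_sumc d (T : measurableType d) (I : Type) (s : seq I) (F : I -> T -> C) :
  (forall i, measurable_fun setT (F i)) ->
  measurable_fun setT (fun x => \sum_(i <- s) F i x).
Proof.
move=> mF; elim: s => [|i s IH].
  by rewrite (_ : (fun x => _) = cst 0)//; apply/funext => x; rewrite big_nil.
rewrite (_ : (fun x => _) = fun x => F i x + \sum_(i <- s) F i x).
  exact: measurable_addc.
by apply/funext => x; rewrite big_cons.
Qed.

Lemma measurable_tnth_fun d (T : measurableType d) n (f : T -> n.-tuple C) j :
  measurable_fun setT f -> measurable_fun setT (fun x => tnth (f x) j).
Proof. exact: measurableT_comp (@measurable_tnth _ _ _ j). Qed.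

Lemma measurable_nrm2 d (T : measurableType d) n (f : T -> n.-tuple C) :
  measurable_fun setT f -> measurable_fun setT (fun x => nrm2 (f x)).
Proof.
move=> mf; apply: measurable_sum => j; apply: measurable_funX.
exact/measurable_normc/measurable_tnth_fun.
Qed.

Lemma measurable_cdot d (T : measurableType d) n (f g : T -> n.-tuple C) :
  measurable_fun setT f -> measurable_fun setT g ->
  measurable_fun setT (fun x => cdot (f x) (g x)).
Proof.
move=> mf mg; apply: measurable_sumc => j; apply: measurable_mulc.
  exact: measurable_tnth_fun.
exact/measurable_conjc/measurable_tnth_fun.
Qed.

Lemma measurable_thead d (T : measurableType d) n (f : T -> n.+1.-tuple C) :
  measurable_fun setT f -> measurable_fun setT (fun x => thead (f x)).
Proof. exact: measurable_tnth_fun. Qed.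

Lemma measurable_ccons d (T : measurableType d) n (f : T -> C) (g : T -> n.-tuple C) :
  measurable_fun setT f -> measurable_fun setT g ->
  measurable_fun setT (fun x => ccons (f x) (g x)).
Proof. exact: measurable_cons. Qed.

Lemma measurable_mktuple d (T : measurableType d) n (F : 'I_n -> T -> C) :
  (forall j, measurable_fun setT (F j)) ->
  measurable_fun setT (fun x => [tuple F j x | j < n]).
Proof.
move=> mF; apply/measurable_fun_tnthP => j.
rewrite (_ : _ \o _ = F j)//; apply/funext => x.
by rewrite /= tnth_mktuple.
Qed.

End tuples.

Ltac tmeas := repeat first [by [] | exact: measurable_cst | exact: measurable_id
  | match goal with
    | |- measurable_fun _ (fun x => tnth _ _) => apply: measurable_tnth_fun
    | |- measurable_fun _ (fun x => nrm2 _) => apply: measurable_nrm2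
    | |- measurable_fun _ (fun x => cdot _ _) => apply: measurable_cdot
    | |- measurable_fun _ (fun x => thead _) => apply: measurable_thead
    | |- measurable_fun _ (fun x => ccons _ _) => apply: measurable_ccons
    | |- measurable_fun _ (@ccons _ _ _) => apply: measurable_ccons
    | |- measurable_fun _ (@nrm2 _ _) => apply: measurable_nrm2
    | |- measurable_fun _ (@cdot _ _ _) => apply: measurable_cdot
    | |- measurable_fun _ (@thead _ _) => apply: measurable_thead
    end | cmeas1 | progress meas].

(** * Reduction of the inner product to the first coordinate *)

Section unitary_invariance.
Variable R : realType.
Local Open Scope ereal_scope.
Local Notation C := R[i].
Local Notation muC := (@lebesgueC R).
Implicit Types (h : C * R -> \bar R) (n : nat).

(** The conjugate sits on [u] because the substitution [a := u * a] produces [conjc u] in the second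
    slot of [cdot]. *)
Lemma phase_factor (z : C) : exists2 u : C, normc u = 1%R & z = ((normc z)%:C * conjc u)%R.
Proof.
have [->|z0] := eqVneq z 0%R.
  by exists 1%R; rewrite ?normc1// normc0 mul0r.
have n0 : normc z != 0%R by rewrite normc_eq0.
exists ((normc z)^-1%:C * conjc z )%R.
  by rewrite normcM normcR normc_conj ger0_norm ?invr_ge0 ?normc_ge0// mulVf.
by apply: complex_ext; rewrite !ReImE/= ?ReImE; field.
Qed.

(** Once the inner product involves at most two coordinates, the others enter through [nrm2] alone.
    [Gfun] integrates them out and leaves a function of the two that phases and a real rotation can
    act on. *)
Let Gfun n h (z : C * R) : \bar R := \int[lebesgueCn R n]_v h (z.1, z.2 + nrm2 v)%R.

Let Gfun_ge0 n h z : (forall z, 0 <= h z) -> 0 <= Gfun n h z.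
Proof. by move=> h0; exact: integral_ge0. Qed.

Let measurable_Gfun n h : measurable_fun setT h -> (forall z, 0 <= h z) ->
  measurable_fun setT (Gfun n h).
Proof.
move=> mh h0.
apply: (measurable_fun_fubini_tonelli_F (m2 := lebesgueCn R n)
  (fun z : (C * R) * n.-tuple C => h (z.1.1, z.1.2 + nrm2 z.2)%R)); last by [].
by apply: measurableT_comp mh _; tmeas.
Qed.

Let phase_arg (H : C * C -> \bar R) (z0 : C) :
  measurable_fun setT H -> (forall z, 0 <= H z) ->
  (forall u a l, normc u = 1%R -> H (l, u * a)%R = H (l, a)) ->
  \int[muC]_a H (z0 * conjc a, a)%R = \int[muC]_a H ((normc z0)%:C * conjc a, a)%R.
Proof.
move=> mH H0 Hu; have [u nu e] := phase_factor z0.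
rewrite -(@ge0_integralC_phase _ (fun a => H ((normc z0)%:C * conjc a, a)%R) u)//.
  apply: eq_integral => a _; rewrite Hu// {1}e; congr (H (_, _)).
  by rewrite rmorphM mulrA.
by apply: measurableT_comp mH _; tmeas.
Qed.

(** Induction on the dimension. With the first coordinate [a] of [w] frozen, the induction
    hypothesis turns the tail of [z] to its first axis; this is why [h] is a general function that
    also receives [nrm2 w], since freezing [a] translates both of its arguments. The phase of [z0]
    is then absorbed into [a], and a real rotation of the first two coordinates merges [normc z0]
    and [N'] into [N]. *)
Lemma integral_unitary n (z : n.+1.-tuple C) h :
  measurable_fun setT h -> (forall z, 0 <= h z) ->
  \int[lebesgueCn R n.+1]_w h (cdot z w, nrm2 w) =
  \int[lebesgueCn R n.+1]_w h ((Num.sqrt (nrm2 z))%:C * conjc (thead w), nrm2 w)%R.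
Proof.
have mhw n' (z' : n'.+1.-tuple C) (k : C * R -> \bar R) : measurable_fun setT k ->
    measurable_fun setT (fun w => k (cdot z' w, nrm2 w)).
  by move=> mk; apply: measurableT_comp mk _; tmeas.
have mhn n' (r : R) (k : C * R -> \bar R) : measurable_fun setT k ->
    measurable_fun setT (fun w : n'.+1.-tuple C => k (r%:C * conjc (thead w), nrm2 w)%R).
  by move=> mk; apply: measurableT_comp mk _; tmeas.
elim: n z h => [|n IH] z h mh h0; have [z0 [z' ->]] := tuple_cconsP z.
  have mG := @measurable_Gfun 0 h mh h0.
  apply: etrans (ge0_integral_lebesgueCn (mhw _ _ _ mh) (fun=> h0 _)) _.
  apply: etrans _ (esym (ge0_integral_lebesgueCn (mhn _ _ _ mh) (fun=> h0 _))).
  pose H (x : C * C) := Gfun 0 h (x.1, normc x.2 ^+ 2)%R.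
  have mH : measurable_fun setT H by apply: measurableT_comp mG _; tmeas.
  transitivity (\int[muC]_a H (z0 * conjc a, a)%R).
    apply: eq_integral => a _; apply: eq_integral => t _.
    by rewrite -/(ccons a t) cdot_ccons nrm2_ccons /cdot big_ord0 addr0.
  rewrite (@phase_arg H z0 mH (fun=> Gfun_ge0 _ _ h0)).
    apply: eq_integral => a _; apply: eq_integral => t _.
    rewrite -/(ccons a t) nrm2_ccons thead_ccons nrm2_ccons [nrm2 z']big_ord0 addr0.
    by rewrite sqrtr_sqr ger0_norm// normc_ge0.
  by move=> u a l nu; rewrite /H /= normcM nu mul1r.
have mG := @measurable_Gfun n h mh h0.
have G0 := fun x => @Gfun_ge0 n h x h0.
pose N' := Num.sqrt (nrm2 z'); pose N := Num.sqrt (nrm2 (ccons z0 z')).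
have unfold2 (F : C -> C -> C) : measurable_fun setT (fun x : C * C => F x.1 x.2) ->
  \int[muC]_a \int[lebesgueCn R n.+1]_t
    h (F a (thead t), nrm2 (ccons a t)) =
  \int[muC]_a \int[muC]_b Gfun n h (F a b, normc a ^+ 2 + normc b ^+ 2)%R.
  move=> mF; apply: eq_integral => a _.
  have mFa : measurable_fun setT
      (fun t : n.+1.-tuple C => h (F a (thead t), nrm2 (ccons a t))).
    apply: measurableT_comp mh _; apply: measurable_fun_pair; last by tmeas.
    by apply: (measurableT_comp mF (g := fun t => (a, thead t))); tmeas.
  rewrite (ge0_integral_lebesgueCn mFa (fun=> h0 _)).
  apply: eq_integral => b _; apply: eq_integral => v _.
  by rewrite -/(ccons b v) thead_ccons !nrm2_ccons addrA.
apply: etrans (ge0_integral_lebesgueCn (mhw _ _ _ mh) (fun=> h0 _)) _.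
apply: etrans _ (esym (ge0_integral_lebesgueCn (mhn _ _ _ mh) (fun=> h0 _))).
transitivity (\int[muC]_a \int[lebesgueCn R n.+1]_t
    h (z0 * conjc a + N'%:C * conjc (thead t), nrm2 (ccons a t))%R).
  apply: eq_integral => a _.
  have := IH z' (fun x => h (z0 * conjc a + x.1, normc a ^+ 2 + x.2)%R).
  rewrite -/N' => e.
  etransitivity; last etransitivity; last 1 first.
  - apply: eq_integral => t _; rewrite nrm2_ccons; reflexivity.
  - apply: eq_integral => t _; rewrite -/(ccons a t) cdot_ccons nrm2_ccons; reflexivity.
  - by apply: e => //; apply: measurableT_comp mh _; tmeas.
transitivity (\int[muC]_a \int[lebesgueCn R n.+1]_t
    h (N%:C * conjc a, nrm2 (ccons a t))%R); last first.
  apply: eq_integral => a _; apply: eq_integral => t _.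
  by rewrite -/(ccons a t) thead_ccons.
apply: etrans (unfold2 (fun a b => z0 * conjc a + N'%:C * conjc b)%R _) _; first by tmeas.
apply: etrans _ (esym (unfold2 (fun a b => N%:C * conjc a)%R _)); last by tmeas.
pose H (x : C * C) :=
  \int[muC]_b Gfun n h (x.1 + N'%:C * conjc b, normc x.2 ^+ 2 + normc b ^+ 2)%R.
have mH : measurable_fun setT H.
  apply: (measurable_fun_fubini_tonelli_F (m2 := muC) (fun x : (C * C) * C =>
   Gfun n h (x.1.1 + N'%:C * conjc x.2, normc x.1.2 ^+ 2 + normc x.2 ^+ 2)%R)); last by [].
  by apply: measurableT_comp mG _; tmeas.
have H0 x : 0 <= H x by exact: integral_ge0.
have Hu u a l : normc u = 1%R -> H (l, u * a)%R = H (l, a).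
  by move=> nu; rewrite /H /= normcM nu mul1r.
apply: etrans (@phase_arg H z0 mH H0 Hu) _.
rewrite {}/H /= in mH H0 Hu *.
have N2 : (N ^+ 2 = normc z0 ^+ 2 + N' ^+ 2)%R.
  by rewrite !sqr_sqrtr ?nrm2_ge0// nrm2_ccons.
have N0 : (0 <= N)%R by exact: sqrtr_ge0.
have N'0 : (0 <= N')%R by exact: sqrtr_ge0.
have nz0 := normc_ge0 z0.
move: (normc z0) nz0 N N' N0 N'0 N2 {unfold2 mH H0 Hu} => r r0 N N' N0 N'0 N2.
(* If [N = 0] then [z] vanishes: the angle below is undefined, but both integrands coincide. *)
have [NE|Nn0] := eqVneq N 0%R.
  have r00 : r = 0%R by apply/eqP; rewrite -sqrf_eq0; apply/eqP; rewrite NE in N2; nra.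
  have N'00 : N' = 0%R by apply/eqP; rewrite -sqrf_eq0; apply/eqP; rewrite NE in N2; nra.
  apply: eq_integral => a _; apply: eq_integral => b _.
  by rewrite r00 N'00 NE !mul0r addr0.
(* The rotation whose first coordinate is [(r * a + N' * b) / N]. As [c >= 0], it is not the
   half-turn. *)
pose c := (r / N)%R; pose s := (- (N' / N))%R.
have cs : (c ^+ 2 + s ^+ 2 = 1)%R.
  by rewrite /c /s sqrrN !expr_div_n -mulrDl -N2 divff// sqrf_eq0.
have c1 : c != (-1)%R.
  have : (0 <= c)%R by exact: divr_ge0.
  by apply: contraTN => /eqP ->; rewrite -ltNge; lra.
pose F (x : C * C) := Gfun n h (N%:C * conjc x.1, normc x.1 ^+ 2 + normc x.2 ^+ 2)%R.
have mF : measurable_fun setT F by apply: measurableT_comp mG _; tmeas.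
have F0 x : 0 <= F x by exact: G0.
have mF' : measurable_fun setT
    (fun z => F (c%:C * z.1 - s%:C * z.2, s%:C * z.1 + c%:C * z.2)%R).
  by apply: measurableT_comp mF _; tmeas.
apply: etrans _ (fubini_tonelli1 (m1 := muC) (m2 := muC) F mF F0).
apply: etrans _ (ge0_integral_rotC cs c1 mF F0).
apply: etrans _ (esym (fubini_tonelli1 (m1 := muC) (m2 := muC)
  (fun z => F (c%:C * z.1 - s%:C * z.2, s%:C * z.1 + c%:C * z.2)%R) mF' (fun=> F0 _))).
apply: eq_integral => a _; apply: eq_integral => b _; congr (Gfun n h (_, _)).
  have ec : (r = N * c)%R by rewrite /c mulrCA divff// mulr1.
  have es : (N' = - (N * s))%R by rewrite /s mulrN opprK mulrCA divff// mulr1.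
  by apply: complex_ext; rewrite ec es !ReImE/= ?ReImE/=; ring.
rewrite /= !sqr_normcE !ReImE/=.
rewrite -[LHS]mul1r -cs; ring.
Qed.

End unitary_invariance.

(** * Ball volumes and the normalised measure *)

Section volume.
Variable R : realType.
Local Open Scope ereal_scope.
Local Notation C := R[i].
Local Notation muC := (@lebesgueC R).
Implicit Types n : nat.

Definition caff n (c : R) (b w : n.-tuple C) : n.-tuple C :=
  [tuple c%:C * tnth w j + tnth b j | j < n]%R.

Lemma caff_ccons n c b0 a (b t : n.-tuple C) :
  caff c (ccons b0 b) (ccons a t) = ccons (c%:C * a + b0)%R (caff c b t).
Proof.
apply: eq_from_tnth => j; rewrite tnth_mktuple.
have [k ->|->] := unliftP ord0 j; last by rewrite !tnth0.
by rewrite !tnthS tnth_mktuple.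
Qed.

Lemma measurable_caff d (T : measurableType d) n c b (f : T -> n.-tuple C) :
  measurable_fun setT f -> measurable_fun setT (fun x => caff c b (f x)).
Proof.
by move=> mf; apply: measurable_mktuple => j; tmeas.
Qed.

Lemma ge0_integralCn_affine n (f : n.-tuple C -> \bar R) c b :
  measurable_fun setT f -> (forall z, 0 <= f z) -> (0 < c)%R ->
  ((c ^+ 2) ^+ n)%:E * \int[lebesgueCn R n]_w f (caff c b w) =
  \int[lebesgueCn R n]_w f w.
Proof.
move=> mf f0 c0; elim: n f b mf f0 => [|n IH] f b mf f0.
  rewrite expr0 mul1e; apply: eq_integral => w _; congr f.
  by apply: eq_from_tnth => -[].
have [b0 [b' ->]] := tuple_cconsP b.
have mfa : measurable_fun setT (fun w => f (caff c (ccons b0 b') w)).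
  by apply: measurableT_comp mf _; exact: measurable_caff.
rewrite (ge0_integral_lebesgueCn mfa (fun=> f0 _)) (ge0_integral_lebesgueCn mf f0).
have mF : measurable_fun setT (fun a => \int[lebesgueCn R n]_t f (ccons a t)).
  apply: (measurable_fun_fubini_tonelli_F (m2 := lebesgueCn R n)
    (fun x : C * n.-tuple C => f (ccons x.1 x.2))); last by [].
  by apply: measurableT_comp mf _; tmeas.
have F0 a : 0 <= \int[lebesgueCn R n]_t f (ccons a t) by exact: integral_ge0.
rewrite -[RHS](@ge0_integralC_affine _ _ c b0 mF F0 c0).
rewrite exprS EFinM -muleA; congr (_ * _).
rewrite -ge0_integralZl_EFin//; last 3 first.
- by move=> a _; exact: integral_ge0.
- apply: (measurable_fun_fubini_tonelli_F (m2 := lebesgueCn R n)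
    (fun x : C * n.-tuple C => f (caff c (ccons b0 b') (ccons x.1 x.2)))); last by [].
  by apply: measurableT_comp mfa _; tmeas.
- by rewrite exprn_ge0// sqr_ge0.
apply: eq_integral => a _.
rewrite -(IH (fun t => f (ccons (c%:C * a + b0)%R t)) b'); last 2 first.
- by apply: measurableT_comp mf _; tmeas.
- by [].
by congr (_ * _); apply: eq_integral => t _; rewrite -/(ccons a t) caff_ccons.
Qed.

Definition ballvol n : \bar R := lebesgueCn R n (@unit_ball R n).

(** At exponent 0, [ppow] is the indicator of the positive reals. Writing the indicator of the ball
    as [ppow 0 (1 - nrm2 w)] gives it the measurability and scaling rules of [ppow]. *)
Lemma ppow0E (t : R) : ppow 0 t = ((0 < t)%R)%:R%R.
Proof. by rewrite /ppow powRr0; case: ifP. Qed.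

Lemma integral_ballE n (f : n.-tuple C -> \bar R) :
  \int[lebesgueCn R n]_(w in @unit_ball R n) f w =
  \int[lebesgueCn R n]_w ((ppow 0 (1 - nrm2 w))%:E * f w).
Proof.
rewrite integral_mkcond; apply: eq_integral => w _.
rewrite patchE ppow0E subr_gt0 /=.
have -> : (w \in @unit_ball R n) = (nrm2 w < 1)%R.
  by apply/idP/idP; rewrite inE.
by case: ifP; rewrite ?mul1e ?mul0e.
Qed.

Lemma ballvolE n : ballvol n = \int[lebesgueCn R n]_w (ppow 0 (1 - nrm2 w))%:E.
Proof.
rewrite /ballvol -[LHS]mul1e -integral_cst; last exact: measurable_unit_ball.
by rewrite integral_ballE; apply: eq_integral => w _; rewrite mule1.
Qed.

Lemma nrm2_scale n c (w : n.-tuple C) : nrm2 (caff c [tuple 0%R | _ < n] w) = (c ^+ 2 * nrm2 w)%R.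
Proof.
rewrite /nrm2 mulr_sumr; apply: eq_bigr => j _.
by rewrite !tnth_mktuple addr0 normcM normcR exprMn real_normK// num_real.
Qed.

(** A dilation by the square root of [t] multiplies volume in [n] complex dimensions by [t ^ n].
    With [ppow] the formula also covers [t <= 0], that is, the empty slices of the ball over points
    outside the disc. *)
Lemma volume_nrm2_lt n (t : R) :
  \int[lebesgueCn R n]_w (ppow 0 (t - nrm2 w))%:E = (ppow n%:R t)%:E * ballvol n.
Proof.
have [t0|t0] := leP t 0%R.
  rewrite le0_ppow// mul0e integral0_eq// => w _; rewrite le0_ppow//.
  by rewrite subr_le0 (le_trans t0)// nrm2_ge0.
have s0 : (0 < Num.sqrt t)%R by rewrite sqrtr_gt0.
rewrite -(@ge0_integralCn_affine n _ (Num.sqrt t) [tuple 0%R | _ < n])//; last 2 first.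
- by tmeas.
- by move=> w; rewrite lee_fin ppow_ge0.
rewrite sqr_sqrtr ?ltW// ppowE// powR_mulrn ?ltW//; congr (_ * _).
rewrite ballvolE; apply: eq_integral => w _.
rewrite nrm2_scale sqr_sqrtr ?ltW// -{1}(mulr1 t) -mulrBr.
by rewrite ppowM// powRr0 mul1r.
Qed.

Lemma ballvol_fin n : ballvol n = (fine (ballvol n))%:E.
Proof.
by rewrite fineK// ge0_fin_numE ?measure_ge0//; exact: unit_ball_volume_lty.
Qed.

Lemma ballvol_gt0 n : (0 < fine (ballvol n))%R.
Proof. by rewrite -lte_fin -ballvol_fin; exact: unit_ball_volume_gt0. Qed.

Lemma ge0_integral_dv n (f : n.-tuple C -> \bar R) :
  measurable_fun setT f -> (forall w, 0 <= f w) ->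
  \int[@dv R n]_(w in @unit_ball R n) f w =
  ((fine (ballvol n))^-1)%:E * \int[lebesgueCn R n]_w ((ppow 0 (1 - nrm2 w))%:E * f w).
Proof.
move=> mf f0; have mB := @measurable_unit_ball R n.
rewrite -integral_ballE /dv ge0_integral_mscale//; last exact: measurable_funTS.
congr (_ * _); apply: eq_measure_integral => A mA AB.
by rewrite -[LHS]/(lebesgueCn R n (A `&` @unit_ball R n)) setIidl.
Qed.

Lemma dv_setC n : @dv R n (~` @unit_ball R n) = 0.
Proof.
transitivity (((fine (ballvol n))^-1)%:E *
  lebesgueCn R n (~` @unit_ball R n `&` @unit_ball R n)); first by [].
by rewrite setICl measure0 mule0.
Qed.

Lemma integral_dv_ball n (f : n.-tuple C -> \bar R) :
  measurable_fun setT f -> (forall w, 0 <= f w) ->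
  \int[@dv R n]_w f w = \int[@dv R n]_(w in @unit_ball R n) f w.
Proof.
move=> mf f0; have mB := @measurable_unit_ball R n.
rewrite -(setUv (@unit_ball R n)) ge0_integral_setU//; last 3 first.
- exact: measurableC.
- by rewrite setUv.
- by apply/disj_set2P; rewrite setICr.
rewrite [X in _ + X](_ : _ = 0) ?adde0//.
rewrite null_set_integral//; first exact: measurableC.
  exact: measurable_funTS.
exact: dv_setC.
Qed.

End volume.

(** * Moments of the kernel *)

Section disc.
Variable R : realType.
Local Open Scope ereal_scope.
Local Notation C := R[i].
Local Notation mu := (@lebesgue_measure R).
Local Notation muC := (@lebesgueC R).
Implicit Types (n : nat) (r : R).

(** At a unit vector on the first axis the kernel depends on the first coordinate only; the weight
    is, up to [ballvol n], the volume of the slice of the ball swept by the other [n]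
    coordinates. *)
Definition disc_integral n r : \bar R :=
  \int[muC]_a (normc (1 - a) `^ (- r) * ppow n%:R (1 - normc a ^+ 2))%:E.

(** The exponent [1 - r] is [- r] from the kernel plus 1 from the Jacobian; the base of the last
    factor is [1 - normc a ^+ 2] in the coordinates [x], [t]. *)
Let h n r (x t : R) : R :=
  (ppow (1 - r) x * (1 + t ^+ 2) `^ (- (r / 2)) *
   ppow n%:R (2 * x - x ^+ 2 * (1 + t ^+ 2)))%R.

Let h_ge0 n r x t : (0 <= h n r x t)%R.
Proof. by rewrite !mulr_ge0 ?ppow_ge0 ?powR_ge0. Qed.

(* The substitution [1 - a = x * (1 +i* t)]. *)
Let disc_integral_slopes n r :
  disc_integral n r = \int[mu]_x \int[mu]_t (h n r x t)%:E.
Proof.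
pose f (a : C) : \bar R := (normc (1 - a) `^ (- r) * ppow n%:R (1 - normc a ^+ 2))%:E.
have mf : measurable_fun setT f by rewrite /f; cmeas.
have f0 a : 0 <= f a by rewrite lee_fin mulr_ge0 ?powR_ge0 ?ppow_ge0.
pose f1 (a : C) := f (1%:C * a + 1)%R.
have mf1 : measurable_fun setT f1 by apply: measurableT_comp mf _; cmeas.
pose f2 (a : C) := f1 (-1 * a)%R.
have mf2 : measurable_fun setT f2 by apply: measurableT_comp mf1 _; cmeas.
have n1 : (normc (-1 : C) = 1)%R by rewrite normcN normc1.
have -> : disc_integral n r = \int[muC]_a f2 a.
  apply: etrans _ (esym (ge0_integralC_phase n1 mf1 (fun=> f0 _))).
  apply: etrans (esym (ge0_integralC_affine 1%R mf f0 ltr01)) _.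
  by rewrite expr1n mul1e.
apply: etrans (ge0_integral_lebesgueC mf2 (fun=> f0 _)) _.
apply: eq_integral => x _.
have f2E y : f2 (x +i* y) =
    ((x ^+ 2 + y ^+ 2) `^ (- (r / 2)) * ppow n%:R (2 * x - x ^+ 2 - y ^+ 2))%:E.
  rewrite /f2 /f1 /f; congr EFin; congr (_ * ppow _ _)%R.
    rewrite -[normc _]ger0_norm ?normc_ge0// -sqrtr_sqr sqr_normcE !ReImE/=.
    rewrite -powR12_sqrt ?addr_ge0 ?sqr_ge0// -powRrM; congr (_ `^ _)%R; last by field.
    by ring.
  by rewrite sqr_normcE !ReImE/=; ring.
under eq_integral do rewrite f2E.
have [x0|x0] := leP x 0%R.
  rewrite [RHS]integral0_eq; last by move=> t _; rewrite /h le0_ppow// !mul0r.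
  apply: integral0_eq => y _; rewrite le0_ppow ?mulr0//.
  by have := sqr_ge0 x; have := sqr_ge0 y; lra.
rewrite [LHS](@ge0_integral_scaleE _
  (fun y => (x ^+ 2 + y ^+ 2) `^ (- (r / 2)) * ppow n%:R (2 * x - x ^+ 2 - y ^+ 2))%R x)//;
  last 2 first.
- by meas.
- by move=> y; rewrite mulr_ge0 ?powR_ge0 ?ppow_ge0.
rewrite -ge0_integralMlR; last 3 first.
- by meas.
- by move=> y; rewrite mulr_ge0 ?powR_ge0 ?ppow_ge0.
- exact: ltW.
apply: eq_integral => t _; congr EFin.
have t1 : (0 <= 1 + t ^+ 2)%R by rewrite addr_ge0// sqr_ge0.
rewrite /h exprMn (_ : x ^+ 2 + x ^+ 2 * t ^+ 2 = x ^+ 2 * (1 + t ^+ 2))%R; last by ring.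
rewrite powRM ?sqr_ge0// (@ppowE _ (1 - r) x)// -(@powR_mul_self _ (1 - r) x)//.
rewrite -(powR_mulrn 2 (ltW x0)) -powRrM.
have -> : (2%:R * - (r / 2) = 1 - r - 1)%R by field.
rewrite powR_mulrn ?ltW//.
have -> : (2 * x - x ^+ 2 - x ^+ 2 * t ^+ 2 = 2 * x - x ^+ 2 * (1 + t ^+ 2))%R by ring.
by rewrite !mulrA.
Qed.

(** With [T = 1 + t ^+ 2], the line of slope [t] through 1 meets the disc for [0 < x < 2 / T]. The
    scaling [x := (2 / T) * s] maps every chord to []0, 1[] and turns the weight into a power of
    [s * (1 - s)] times one of [T], so the double integral becomes a product. *)
Lemma disc_integralE n r : disc_integral n r =
  (2 `^ (2 * n%:R + 2 - r))%:E * bet (n%:R + 2 - r) (n%:R + 1) *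
  cauchy (n%:R + 2 - r / 2).
Proof.
have b0 : 0 <= bet (n%:R + 2 - r) (n%:R + 1).
  by apply: integral_ge0 => t _; rewrite lee_fin mulr_ge0 ?ppow_ge0.
rewrite disc_integral_slopes.
apply: etrans (tonelliR (f := h n r) _ (h_ge0 n r)) _; first by rewrite /h; meas.
rewrite muleC /cauchy ge0_integralMrR; last 3 first.
- by meas.
- by move=> t; exact: powR_ge0.
- by rewrite mule_ge0// lee_fin powR_ge0.
apply: eq_integral => t _.
have t1 : (0 < 1 + t ^+ 2)%R by rewrite ltr_wpDr// sqr_ge0.
rewrite /h; move: (1 + t ^+ 2)%R t1 => T T0; pose q : R := (2 / T)%R.
have q0 : (0 < q)%R by rewrite divr_gt0.
rewrite muleA -EFinM /h /bet -ge0_integralMlR; last 3 first.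
- by meas.
- by move=> s; rewrite mulr_ge0 ?ppow_ge0.
- by rewrite mulr_ge0 ?powR_ge0.
rewrite [LHS](@ge0_integral_scaleE _ (fun x => ppow (1 - r) x * T `^ (- (r / 2)) *
  ppow n%:R (2 * x - x ^+ 2 * T))%R q)//; last 2 first.
- by meas.
- by move=> s; rewrite !mulr_ge0 ?powR_ge0 ?ppow_ge0.
rewrite -ge0_integralMlR; last 3 first.
- by meas.
- by move=> s; rewrite !mulr_ge0 ?powR_ge0 ?ppow_ge0.
- exact: ltW.
apply: eq_integral => s _; congr EFin.
have [s0|s0] := leP s 0%R.
  rewrite (@le0_ppow _ _ s)// mul0r mulr0.
  by rewrite (@le0_ppow _ (1 - r)) ?mul0r ?mulr0// pmulr_rle0.
have -> : (2 * (q * s) - (q * s) ^+ 2 * T = 2 * q * s * (1 - s))%R.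
  by rewrite /q; field; rewrite gt_eqF.
rewrite !ppowM ?mulr_gt0 ?invr_gt0//.
have -> : ppow (n%:R + 2 - r - 1) s = (s `^ (1 - r) * s `^ n%:R)%R.
  by rewrite ppowE// -gt0_powRD//; congr powR; ring.
rewrite ppowE// addrK.
have powD (a b c : R) : (0 < a)%R -> (a `^ (b + c) = a `^ b * a `^ c)%R by exact: gt0_powRD.
have -> : (T `^ (- (n%:R + 2 - r / 2)) = T `^ (- (r / 2)) * T `^ (r - 2 - n%:R))%R.
  by rewrite -powD//; congr powR; field.
have -> : (q = 2 * T `^ (-1))%R by rewrite /q powR_inv1// ltW.
rewrite !powRM ?powR_ge0// ?mulr_ge0 ?powR_ge0 ?ltW//.
rewrite -!powRrM.
have -> : (T `^ (r - 2 - n%:R) = T `^ (-1) * T `^ (-1 * (1 - r)) * T `^ (-1 * n%:R))%R.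
  by rewrite -!powD//; congr powR; ring.
have -> : (2 `^ (2 * n%:R + 2 - r) = 2 * 2 `^ (1 - r) * 2 `^ n%:R * 2 `^ n%:R)%R.
  rewrite -[X in (X * _ * _ * _)%R](powRr1 (ler0n R 2)) -!powD//.
  by congr powR; ring.
by ring.
Qed.

End disc.

(** * Means over roots of unity *)

Section roots_of_unity_average.
Variable R : realType.
Local Notation C := R[i].

(** The sum of the hypothesis over all pairs is twice the difference of the two sides. *)
Lemma chebyshev_sum (I : eqType) (s : seq I) (X Y : I -> R) :
  {in s &, forall i j, 0 <= (X i - X j) * (Y i - Y j)} ->
  (\sum_(i <- s) X i) * (\sum_(i <- s) Y i) <= (size s)%:R * \sum_(i <- s) X i * Y i.
Proof.
move=> XY.
have : 0 <= \sum_(i <- s) \sum_(j <- s) (X i - X j) * (Y i - Y j).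
  rewrite big_seq; apply: sumr_ge0 => i si.
  by rewrite big_seq; apply: sumr_ge0 => j sj; exact: XY.
have -> : \sum_(i <- s) \sum_(j <- s) (X i - X j) * (Y i - Y j) =
    ((size s)%:R * \sum_(i <- s) X i * Y i - (\sum_(i <- s) X i) * (\sum_(i <- s) Y i)) *+ 2.
  transitivity (\sum_(i <- s) ((size s)%:R * (X i * Y i) + \sum_(j <- s) X j * Y j -
      (X i * \sum_(j <- s) Y j + Y i * \sum_(j <- s) X j))).
    apply: eq_bigr => i _.
    rewrite mulr_natl !mulr_sumr -big_split/=.
    rewrite -[X in X + _ - _](_ : \sum_(j <- s) X i * Y i = _); last first.
      by rewrite big_const_seq count_predT iter_addr_0.
    rewrite -big_split/= -sumrB; apply: eq_bigr => j _; ring.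
  rewrite sumrB !big_split/= -!mulr_sumr -!mulr_suml.
  rewrite big_const_seq count_predT iter_addr_0 -mulr_natl.
  by ring.
by rewrite pmulrn_lge0// subr_ge0.
Qed.

Lemma normcX (m : C) k : normc (m ^+ k) = normc m ^+ k.
Proof. by elim: k => [|k IH]; rewrite ?expr0 ?normc1// !exprS normcM IH. Qed.

(** [X^N - 1] splits over the algebraically closed field; its value at [m^-1], multiplied by
    [m ^+ N], gives the reversed product. The averaging uses only this product and the modulus of
    the roots. *)
Lemma prod_unity_roots (N : nat) : (0 < N)%N -> exists s : seq C,
  [/\ size s = N, forall x, x \in s -> normc x = 1 &
      forall m : C, \prod_(x <- s) (1 - m * x) = 1 - m ^+ N].
Proof.
move=> N0.
have [s hs] := closed_field_poly_normal ('X^N - 1 : {poly C}).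
have lc : lead_coef ('X^N - 1 : {poly C}) = 1.
  by apply/eqP; rewrite -monicE monicXnsubC.
rewrite lc scale1r in hs.
have sz : size s = N.
  by have := size_XnsubC (1 : C) N0; rewrite hs size_prod_XsubC => -[].
have ev (y : C) : \prod_(x <- s) (y - x) = y ^+ N - 1.
  have := congr1 (fun p => p.[y]) hs; rewrite !hornerE => ->.
  by rewrite horner_prod; apply: eq_bigr => x _; rewrite !hornerE.
exists s; split => // [x xs|m].
  have : x ^+ N = 1.
    apply/eqP; rewrite -subr_eq0 -ev; apply/eqP.
    by rewrite (big_rem x)//= subrr mul0r.
  move=> /(congr1 (@normc R)); rewrite normc1 normcX.
  by move/eqP; rewrite pexpr_eq1// ?normc_ge0// => /eqP.
have [->|m0] := eqVneq m 0.
  rewrite expr0n eqn0Ngt N0 subr0 big1// => x _.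
  by rewrite mul0r subr0.
have -> : \prod_(x <- s) (1 - m * x) = \prod_(x <- s) (m * (m^-1 - x)).
  by apply: eq_bigr => x _; rewrite mulrBr mulfV.
rewrite big_split/= ev big_const_seq count_predT iter_mulr_1 sz.
by rewrite mulrBr mulr1 -exprMn mulfV// expr1n.
Qed.

Lemma normc_prod (I : Type) (s : seq I) (F : I -> C) :
  normc (\prod_(x <- s) F x) = \prod_(x <- s) normc (F x).
Proof. by apply: (big_morph _ (@normcM R)); exact: normc1. Qed.

Lemma ln_prod (I : eqType) (s : seq I) (F : I -> R) : {in s, forall x, 0 < F x} ->
  ln (\prod_(x <- s) F x) = \sum_(x <- s) ln (F x).
Proof.
elim: s => [|x s IH] Fs; first by rewrite !big_nil ln1.
rewrite !big_cons lnM ?IH// ?posrE.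
- by move=> y sy; apply: Fs; rewrite inE sy orbT.
- by apply: Fs; rewrite mem_head.
- rewrite big_seq; apply: prodr_gt0 => y sy.
  by apply: Fs; rewrite inE sy orbT.
Qed.

Lemma normc_1B_ge (m : C) : 1 - normc m <= normc (1 - m).
Proof.
rewrite lerBlDr; have := le_normcD (1 - m) m.
by rewrite subrK normc1.
Qed.

Lemma normc_1B_le (m : C) : normc (1 - m) <= 1 + normc m.
Proof. by have := le_normcD 1 (- m); rewrite normc1 normcN. Qed.

Lemma sqr_normc_1B (t : R) (m : C) :
  normc (1 - t%:C * m) ^+ 2 = 1 + t ^+ 2 * normc m ^+ 2 - 2 * t * Re m.
Proof. by rewrite !sqr_normcE !ReImE/=; ring. Qed.

Section averaging.
Variables (r rho : R) (l : C).
Hypotheses (r0 : 0 <= r) (rho0 : 0 <= rho) (rho1 : rho < 1) (l1 : normc l < 1).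

Let U x := normc (1 - rho%:C * (l * x)).
Let V x := normc (1 - l * x).

Let nlx x : normc x = 1 -> normc (l * x) < 1.
Proof. by move=> nx; rewrite normcM nx mulr1. Qed.

Let U_ge x : normc x = 1 -> 1 - rho <= U x.
Proof.
move=> /nlx nx; apply: le_trans (normc_1B_ge _).
rewrite lerB// normcM normcR ger0_norm// ler_piMr//.
exact: ltW.
Qed.

Let U_gt0 x : normc x = 1 -> 0 < U x.
Proof. by move=> nx; apply: lt_le_trans (U_ge nx); rewrite subr_gt0. Qed.

Let V_gt0 x : normc x = 1 -> 0 < V x.
Proof. by move=> nx; apply: lt_le_trans (normc_1B_ge _); rewrite subr_gt0 nlx. Qed.

Let U2E x : normc x = 1 -> U x ^+ 2 = 1 + rho ^+ 2 * normc l ^+ 2 - 2 * rho * Re (l * x).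
Proof. by move=> nx; rewrite sqr_normc_1B normcM nx mulr1. Qed.

Let V2E x : normc x = 1 -> V x ^+ 2 = 1 + normc l ^+ 2 - 2 * Re (l * x).
Proof.
move=> nx; have := sqr_normc_1B 1 (l * x).
by rewrite mul1r normcM nx !mulr1 expr1n mul1r.
Qed.

Let monoU x y : normc x = 1 -> normc y = 1 -> Re (l * x) <= Re (l * y) -> U y <= U x.
Proof.
move=> nx ny xy; rewrite -(@ler_pXn2r _ 2)// ?nnegrE ?normc_ge0//.
by rewrite !U2E// lerD2l lerN2 ler_wpM2l// mulr_ge0.
Qed.

(** After squaring, the difference of the two sides factors as
    [2 * (b - a) * (1 - rho) * (1 - rho * m)], with [a], [b] the two real parts and [m] the squared
    modulus of [l]. This is the monotonicity of [U / V] in the real part. *)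
Let monoUV x y : normc x = 1 -> normc y = 1 -> Re (l * x) <= Re (l * y) ->
  U x * V y <= U y * V x.
Proof.
move=> nx ny xy; rewrite -(@ler_pXn2r _ 2)// ?nnegrE ?mulr_ge0 ?normc_ge0//.
rewrite !exprMn !U2E// !V2E// -subr_ge0.
have m1 : normc l ^+ 2 <= 1 by rewrite expr_le1// ?normc_ge0// ltW.
have m0 : 0 <= normc l ^+ 2 by exact: sqr_ge0.
move: (normc l ^+ 2) m0 m1 (Re (l * x)) (Re (l * y)) xy => m m0 m1 a b ab.
rewrite (_ : _ - _ = 2 * ((b - a) * (1 - rho) * (1 - rho * m))); last by ring.
rewrite !mulr_ge0// ?subr_ge0//; first exact: ltW.
by rewrite mulr_ile1// ltW.
Qed.

Let L0 : 0 <= ln 2 - ln (1 - rho).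
Proof.
by rewrite subr_ge0 ler_ln ?posrE ?subr_gt0// lerBlDr ler_wpDr// ler1n.
Qed.

(* [U^(-r)] and [ln (U / V)] are both nondecreasing in [Re (l * x)], and the sum of
   the latter is bounded below independently of [size s], its exponential being a
   quotient of the polynomials [1 - m ^+ size s]. Chebyshev's sum inequality then
   bounds below the average of [V^(-r) >= U^(-r) * (1 + r * ln (U / V))]. *)
Lemma average_kernel_le (s : seq C) : (0 < size s)%N ->
  {in s, forall x, normc x = 1} ->
  (forall m : C, \prod_(x <- s) (1 - m * x) = 1 - m ^+ size s) ->
  \sum_(x <- s) U x `^ (- r) <=
  \sum_(x <- s) V x `^ (- r) + r * (1 - rho) `^ (- r) * (ln 2 - ln (1 - rho)).
Proof.
move=> s0 ns ps.
pose X x := U x `^ (- r); pose Y x := ln (U x) - ln (V x).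
have rho10 : 0 < 1 - rho by rewrite subr_gt0.
have XY : {in s &, forall x y, 0 <= (X x - X y) * (Y x - Y y)}.
  have key x y : normc x = 1 -> normc y = 1 -> Re (l * x) <= Re (l * y) ->
      X x <= X y /\ Y x <= Y y.
    move=> nx ny xy; split.
      rewrite /X !powRN lef_pV2 ?posrE ?powR_gt0 ?U_gt0//.
      by apply: ge0_ler_powR; rewrite ?nnegrE ?(ltW (U_gt0 _))//; exact: monoU.
    rewrite /Y lerBlDr addrAC lerBrDr.
    rewrite -!lnM ?posrE ?U_gt0 ?V_gt0// ler_ln ?posrE ?mulr_gt0 ?U_gt0 ?V_gt0//.
    exact: monoUV.
  move=> x y /ns nx /ns ny; have [xy|/ltW xy] := leP (Re (l * x)) (Re (l * y)).
    have [h1 h2] := key _ _ nx ny xy.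
    by rewrite -mulrNN (opprB (X x)) (opprB (Y x)) mulr_ge0// subr_ge0.
  have [h1 h2] := key _ _ ny nx xy.
  by rewrite mulr_ge0// subr_ge0.
have Xge x : 0 <= X x by exact: powR_ge0.
(* The modulus of [1 - (rho * l) ^+ N] is at least [1 - rho], that of [1 - l ^+ N] at most 2;
   neither bound involves [N]. *)
have sumY : ln (1 - rho) - ln 2 <= \sum_(x <- s) Y x.
  rewrite sumrB -!ln_prod; last 2 first.
  - by move=> x /ns; exact: V_gt0.
  - by move=> x /ns; exact: U_gt0.
  rewrite -!normc_prod ps.
  have -> : \prod_(x <- s) (1 - rho%:C * (l * x)) = 1 - (rho%:C * l) ^+ size s.
    by rewrite -ps; apply: eq_bigr => x _; rewrite mulrA.
  have lN : normc (l ^+ size s) < 1.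
    by rewrite normcX exprn_ilt1// ?normc_ge0// -lt0n.
  have rlN : normc ((rho%:C * l) ^+ size s) <= rho.
    rewrite normcX normcM normcR ger0_norm//.
    have rl : rho * normc l <= rho by rewrite ler_piMr// ltW.
    apply: le_trans rl; rewrite ler_iXnr// ?mulr_ge0 ?normc_ge0//.
    by rewrite mulr_ile1 ?normc_ge0// ltW.
  have hU := normc_1B_ge ((rho%:C * l) ^+ size s).
  have hV := normc_1B_ge (l ^+ size s).
  have hV' := normc_1B_le (l ^+ size s).
  by apply: lerB; rewrite ler_ln ?posrE//; lra.
have sumX : \sum_(x <- s) X x <= (size s)%:R * (1 - rho) `^ (- r).
  apply: (@le_trans _ _ (\sum_(x <- s) (1 - rho) `^ (- r))); last first.
    by rewrite big_const_seq count_predT iter_addr_0 mulr_natl.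
  rewrite big_seq [leRHS]big_seq; apply: ler_sum => x /ns nx.
  rewrite /X !powRN lef_pV2 ?posrE ?powR_gt0 ?U_gt0//.
  by apply: ge0_ler_powR; rewrite ?nnegrE ?(ltW (U_gt0 _))// ?(ltW rho10)// U_ge.
have VX : \sum_(x <- s) X x + r * \sum_(x <- s) X x * Y x <= \sum_(x <- s) V x `^ (- r).
  rewrite mulr_sumr -big_split/= big_seq [leRHS]big_seq; apply: ler_sum => x /ns nx.
  have -> : V x `^ (- r) = X x * expR (r * Y x).
    rewrite /X /powR !gt_eqF ?U_gt0 ?V_gt0// -expRD; congr expR.
    by rewrite /Y; ring.
  by rewrite mulrCA -{1}(mulr1 (X x)) -mulrDr ler_wpM2l// expR_ge1Dx.
have N0 : 0 < (size s)%:R :> R by rewrite ltr0n.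
have SX0 : 0 <= \sum_(x <- s) X x by exact: sumr_ge0.
have cheb := chebyshev_sum XY.
move: L0 cheb sumY; set L := ln 2 - _; set SY := \sum_(x <- s) Y x.
set XYs := \sum_(x <- s) X x * Y x => L0' cheb sumY.
(* Chebyshev's inequality carries a factor [size s], which cancels the one in [sumX]: hence an error
   independent of the number of roots. *)
suff h : - ((1 - rho) `^ (- r) * L) <= XYs.
  have := ler_wpM2l r0 h; rewrite mulrN mulrA => h'.
  by rewrite -lerBlDr; apply: le_trans VX; rewrite lerD2l.
rewrite -(ler_pM2l N0); apply: le_trans cheb.
apply: (@le_trans _ _ ((\sum_(x <- s) X x) * - L)).
  by rewrite !mulrN lerN2 mulrA ler_wpM2r.
by rewrite ler_wpM2l// opprB.
Qed.
End averaging.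

End roots_of_unity_average.

(** * Moments on the sphere and inside it *)

Section kernel_moments.
Variable R : realType.
Local Open Scope ereal_scope.
Local Notation C := R[i].
Local Notation muC := (@lebesgueC R).
Implicit Types (n : nat) (r : R).

Definition kap n r (z w : n.-tuple C) : R := (normc (1 - cdot z w) `^ (- r))%R.
Definition moment n r (z : n.-tuple C) : \bar R :=
  \int[@dv R n]_(w in @unit_ball R n) (kap r z w)%:E.

Lemma kap_ge0 n r (z w : n.-tuple C) : (0 <= kap r z w)%R.
Proof. exact: powR_ge0. Qed.

Lemma measurable_kap d (T : measurableType d) n r (f g : T -> n.-tuple C) :
  measurable_fun setT f -> measurable_fun setT g ->
  measurable_fun setT (fun x => kap r (f x) (g x)).
Proof. by move=> mf mg; rewrite /kap; tmeas. Qed.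

Definition moment_axis n r (N : R) : \bar R := \int[lebesgueCn R n.+1]_w
  (ppow 0 (1 - nrm2 w) * normc (1 - N%:C * conjc (thead w)) `^ (- r))%:E.

Lemma moment_unitary n r (z : n.+1.-tuple C) : moment r z =
  ((fine (ballvol R n.+1))^-1)%:E * moment_axis n r (Num.sqrt (nrm2 z)).
Proof.
have mk : measurable_fun setT (fun w => (kap r z w)%:E).
  by apply/measurable_EFinP; apply: measurable_kap => //; exact: measurable_cst.
rewrite /moment (ge0_integral_dv mk); last by move=> w; rewrite lee_fin kap_ge0.
apply: (congr1 (mule _)).
pose h (x : C * R) : \bar R := (ppow 0 (1 - x.2) * normc (1 - x.1) `^ (- r))%:E.
have mh : measurable_fun setT h by rewrite /h; tmeas.
have h0 x : 0 <= h x by rewrite lee_fin mulr_ge0 ?ppow_ge0 ?powR_ge0.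
apply: etrans (integral_unitary z mh h0).
by apply: eq_integral => w _; rewrite -EFinM.
Qed.

Lemma moment_eq n r (z z' : n.+1.-tuple C) : nrm2 z = nrm2 z' -> moment r z = moment r z'.
Proof. by move=> zz'; rewrite !moment_unitary zz'. Qed.

Lemma moment_axis1 n r : moment_axis n r 1 = (fine (ballvol R n))%:E * disc_integral n r.
Proof.
have mF : measurable_fun setT (fun w : n.+1.-tuple C =>
    (ppow 0 (1 - nrm2 w) * normc (1 - 1%:C * conjc (thead w)) `^ (- r))%:E) by tmeas.
apply: etrans (ge0_integral_lebesgueCn mF _) _.
  by move=> w; rewrite lee_fin mulr_ge0 ?ppow_ge0 ?powR_ge0.
have V0 : (0 <= fine (ballvol R n))%R by exact/ltW/ballvol_gt0.
rewrite /disc_integral -ge0_integralMl; last 3 first.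
- by tmeas.
- by move=> a; rewrite mulr_ge0 ?ppow_ge0 ?powR_ge0.
- exact: V0.
apply: eq_integral => a _.
transitivity (\int[lebesgueCn R n]_t
    (normc (1 - a) `^ (- r) * ppow 0 (1 - normc a ^+ 2 - nrm2 t))%:E).
  apply: eq_integral => t _; rewrite -/(ccons a t) nrm2_ccons thead_ccons mulrC opprD addrA.
  congr (_ `^ _ * _)%:E.
  rewrite -(normc_conj (1 - a)%R); congr normc.
  by apply: complex_ext; rewrite !ReImE/= ?ReImE/=; ring.
rewrite ge0_integralMl; last 3 first.
- by tmeas.
- by move=> t; exact: ppow_ge0.
- exact: powR_ge0.
rewrite volume_nrm2_lt ballvol_fin -!EFinM; congr EFin; ring.
Qed.

(** The dimension is [n.+1], so [n + 2] is the [d + 1] of the theorem. *)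
Definition moment_sphere n r : R :=
  gammaR (n%:R + 2) * gammaR (n%:R + 2 - r) / gammaR (n%:R + 2 - r / 2) ^+ 2.

(** With [m = n + 2 - r / 2], the beta factor has denominator [gammaR (2 * m - 1)] and the Cauchy
    integral has it as numerator; the powers of 2 are inverse to each other. *)
Let disc_integral_fin n r : (r < n%:R + 2)%R -> disc_integral n r =
  (pi * gammaR (n%:R + 1) * (gammaR (n%:R + 2 - r) / gammaR (n%:R + 2 - r / 2) ^+ 2))%:E.
Proof.
move=> rn; have n0 : (0 <= n%:R :> R)%R by exact: ler0n.
have p0 : (0 < n%:R + 2 - r)%R by lra.
have p1 : (0 < n%:R + 1 :> R)%R by lra.
have p2 : (2^-1 < n%:R + 2 - r / 2)%R by lra.
rewrite disc_integralE (betE p0 p1) (cauchyE p2) -!EFinM; congr EFin.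
have -> : (n%:R + 2 - r + (n%:R + 1) = 2 * (n%:R + 2 - r / 2) - 1)%R by field.
have -> : (2 - 2 * (n%:R + 2 - r / 2) = - (2 * n%:R + 2 - r))%R by field.
have g0 : (0 < 2 * (n%:R + 2 - r / 2) - 1)%R by lra.
have p3 : (0 < n%:R + 2 - r / 2)%R by lra.
have alg (P A B D G q : R) : (0 < P)%R -> (0 < D)%R -> (0 < G)%R ->
    (P * (A * B / D) * (q * P^-1 * D / G ^+ 2) = q * B * (A / G ^+ 2))%R.
  by move=> /lt0r_neq0 P0 /lt0r_neq0 D0 /lt0r_neq0 G0; field; rewrite G0 D0 P0.
rewrite powRN; apply: alg; [exact: powR_gt0|exact: gammaR_gt0|exact: gammaR_gt0].
Qed.

Lemma dv_ball1 n : @dv R n (@unit_ball R n) = 1.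
Proof.
have mB := @measurable_unit_ball R n.
rewrite -(@probability_setT _ _ _ (@dv R n)) -(setUv (@unit_ball R n)).
rewrite measureU ?setICr//; last exact: measurableC.
by rewrite -[X in _ = _ + X]/(dv _) dv_setC adde0.
Qed.

(** The disc integral gives the moment up to a constant [K] free of the exponent. At exponent 0 the
    moment is the total mass 1, which determines [K] without evaluating any volume. *)
Lemma moment_sphereE n r (z : n.+1.-tuple C) : (r < n%:R + 2)%R -> nrm2 z = 1%R ->
  moment r z = (moment_sphere n r)%:E.
Proof.
move=> rn z1; have n0 : (0 <= n%:R :> R)%R by exact: ler0n.
have p0 : (0 < n%:R + 2 :> R)%R by lra.
have p1 : (0 < n%:R + 1 :> R)%R by lra.
have m0 : moment 0 z = 1.
  rewrite /moment; under eq_integral do rewrite /kap oppr0 powRr0.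
  rewrite integral_cst; last exact: measurable_unit_ball.
  by rewrite mul1e; exact: dv_ball1.
have e s : (s < n%:R + 2)%R -> moment s z = ((fine (ballvol R n.+1))^-1 * fine (ballvol R n) *
    (pi * gammaR (n%:R + 1)) * (gammaR (n%:R + 2 - s) / gammaR (n%:R + 2 - s / 2) ^+ 2))%:E.
  move=> sn; rewrite moment_unitary z1 sqrtr1 moment_axis1 disc_integral_fin//.
  by rewrite -!EFinM; congr EFin; ring.
move: m0; rewrite !e// mul0r !subr0 => -[].
have := gammaR_gt0 p0; rewrite /moment_sphere; set K := (_ * (pi * _))%R.
have alg (k G Q : R) : (0 < G)%R -> (k * (G / G ^+ 2) = 1)%R -> k = G.
  move=> /lt0r_neq0 G0; have -> : (G / G ^+ 2 = G^-1)%R by field.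
  by move=> /(congr1 ( *%R^~ G)); rewrite divfK// mul1r.
by move=> G0 /(alg _ _ 0%R G0) ->; rewrite mulrA.
Qed.

Lemma cdot_axis n (c : C) (w : n.+1.-tuple C) :
  cdot (ccons c [tuple 0%R | _ < n]) w = (c * conjc (thead w))%R.
Proof.
have [a [t ->]] := tuple_cconsP w.
rewrite cdot_ccons thead_ccons /cdot big1 ?addr0// => j _.
by rewrite tnth_mktuple mul0r.
Qed.

Lemma nrm2_axis n (c : C) : nrm2 (ccons c [tuple 0%R | _ < n]) = (normc c ^+ 2)%R.
Proof.
rewrite nrm2_ccons /nrm2 big1 ?addr0// => j _.
by rewrite tnth_mktuple normc0 expr0n.
Qed.

Lemma nrm2_head n (w : n.+1.-tuple C) : (normc (thead w) ^+ 2 <= nrm2 w)%R.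
Proof.
by have [a [t ->]] := tuple_cconsP w; rewrite nrm2_ccons thead_ccons lerDl nrm2_ge0.
Qed.

(** For [x] among the [N]-th roots of unity, unitary invariance gives all points [rho * x] on the
    first axis the moment of [z], and all points [x] the moment on the sphere. Integrating
    [average_kernel_le] in [w] thus compares [N] copies of each, with an error [K] independent of
    [N]. *)
Lemma moment_le n r (z : n.+1.-tuple C) : (0 <= r)%R -> (r < n%:R + 2)%R ->
  (nrm2 z < 1)%R -> moment r z <= (moment_sphere n r)%:E.
Proof.
move=> r0 rn z1.
pose rho := Num.sqrt (nrm2 z).
have rho0 : (0 <= rho)%R by exact: sqrtr_ge0.
have rho1 : (rho < 1)%R by rewrite -sqrtr1 ltr_sqrt.
pose e (c : C) : n.+1.-tuple C := ccons c [tuple 0%R | _ < n].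
pose K := (r * (1 - rho) `^ (- r) * (ln 2 - ln (1 - rho)))%R.
have mB := @measurable_unit_ball R n.+1.
have key (N : nat) : (0 < N)%N ->
    N%:R%:E * moment r z <= (N%:R * moment_sphere n r + K)%:E.
  move=> N0; have [s [sN ns ps]] := @prod_unity_roots R N N0.
  have m1 x : x \in s -> moment r (e (rho%:C * x))%R = moment r z.
    move=> /ns nx; apply: moment_eq; rewrite nrm2_axis normcM nx mulr1 normcR.
    by rewrite real_normK ?num_real// sqr_sqrtr// nrm2_ge0.
  have m2 x : x \in s -> moment r (e x) = (moment_sphere n r)%:E.
    by move=> /ns nx; rewrite moment_sphereE// nrm2_axis nx expr1n.
  have mk c : measurable_fun (@unit_ball R n.+1) (fun w => (kap r (e c) w)%:E).
    apply: measurable_funTS; apply/measurable_EFinP.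
    by apply: (@measurable_kap _ _ n.+1 r (cst (e c)) id).
  have k0 c w : @unit_ball R n.+1 w -> 0 <= (kap r (e c) w)%:E.
    by rewrite lee_fin kap_ge0.
  have sum_moment (c : C) : \int[@dv R n.+1]_(w in @unit_ball R n.+1)
      (\sum_(x <- s) (kap r (e (c * x)%R) w)%:E) = \sum_(x <- s) moment r (e (c * x))%R.
    by rewrite (ge0_integral_sum _ mB (fun x => mk (c * x)%R) (fun x => k0 (c * x)%R)).
  have -> : N%:R%:E * moment r z = \sum_(x <- s) moment r (e (rho%:C * x))%R.
    rewrite big_seq (eq_bigr (fun=> moment r z)) => [|x /m1//].
    rewrite -big_seq big_const_seq count_predT sN.
    elim: (N) => [|k IH]; first by rewrite mul0e.
    by rewrite iterS -IH -natr1 EFinD ge0_muleDl ?lee_fin// mul1e addeC.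
  have S2 : \sum_(x <- s) moment r (e (1 * x))%R = (N%:R * moment_sphere n r)%:E.
    rewrite big_seq (eq_bigr (fun=> (moment_sphere n r)%:E)) => [|x]; last first.
      by rewrite mul1r; exact: m2.
    by rewrite -big_seq sumEFin big_const_seq count_predT sN iter_addr_0 mulr_natl.
  rewrite EFinD -S2 -[X in X <= _](sum_moment rho%:C) -[X in _ <= X + _](sum_moment 1%R).
  have K0 : (0 <= K)%R.
    rewrite mulr_ge0// ?mulr_ge0// ?powR_ge0// subr_ge0 ler_ln ?posrE ?subr_gt0//.
    by rewrite lerBlDr ler_wpDr// ler1n.
  have -> : K%:E = \int[@dv R n.+1]_(w in @unit_ball R n.+1) K%:E.
    by rewrite integral_cst//= -[X in _ * X]/(dv (@unit_ball R n.+1)) dv_ball1 mule1.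
  rewrite -ge0_integralD//; last 2 first.
  - by move=> w Bw; apply: sume_ge0 => x _; exact: k0.
  - by apply: emeasurable_sum => x; exact: mk.
  apply: ge0_le_integral => //.
  - by move=> w Bw; apply: sume_ge0 => x _; exact: k0.
  - by apply: emeasurable_sum => x; exact: mk.
  - by apply: emeasurable_funD => //; apply: emeasurable_sum => x; exact: mk.
  move=> w Bw; rewrite !sumEFin -EFinD lee_fin.
  have l1 : (normc (conjc (thead w)) < 1)%R.
    rewrite normc_conj -(@expr_lt1 _ 2)// ?normc_ge0//.
    exact: le_lt_trans (nrm2_head w) Bw.
  have := @average_kernel_le R r rho (conjc (thead w)) r0 rho0 rho1 l1 s.
  rewrite sN => /(_ N0 ns ps) h.
  have -> : (\sum_(x <- s) kap r (e (rho%:C * x)) w =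
      \sum_(x <- s) normc (1 - rho%:C * (conjc (thead w) * x)) `^ (- r))%R.
    by apply: eq_bigr => x _; rewrite /kap cdot_axis -mulrA [(x * _)%R]mulrC.
  have -> : (\sum_(x <- s) kap r (e (1 * x)) w =
      \sum_(x <- s) normc (1 - conjc (thead w) * x) `^ (- r))%R.
    by apply: eq_bigr => x _; rewrite /kap cdot_axis mul1r mulrC.
  exact: h.
(* The case [N = 1] already shows that the moment is finite, so that it can be treated as a real. *)
have := key 1%N isT; rewrite mul1e mul1r.
have M0 : 0 <= moment r z by apply: integral_ge0 => w _; rewrite lee_fin kap_ge0.
move: (moment r z) M0 key => [m| |]// m0 key _; rewrite lee_fin leNgt; apply/negP => lt_m.
(* An [N] with [N * (m - A) > K], where [A] is the moment on the sphere; it contradicts [key]. *)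
pose b := Num.bound `|K / (m - moment_sphere n r)|%R; pose N := b.+1.
have := key N isT; rewrite -EFinM lee_fin; apply/negP; rewrite -ltNge.
rewrite addrC -ltrBrDr -mulrBr -ltr_pdivrMr ?subr_gt0//.
apply: (@lt_le_trans _ _ b%:R).
  exact: le_lt_trans (ler_norm _) (archi_boundP (normr_ge0 _)).
by rewrite ler_nat.
Qed.

Lemma continuous_powR_gt0 (a x : R) : (0 < x)%R ->
  {for x, continuous (fun y : R => y `^ a)%R}.
Proof.
move=> x0; apply/differentiable_continuous/derivable1_diffP/derivable_powR.
by rewrite in_itv/= x0.
Qed.

(** Fatou's lemma along points of the first axis tending to the sphere: for [w] in the open ball the
    kernel converges, and semicontinuity in this direction is what the lower bound asks for. *)
Lemma moment_sphere_le n r (M : \bar R) : (r < n%:R + 2)%R ->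
  (forall rho : R, (0 <= rho)%R -> (rho < 1)%R ->
     moment r (ccons rho%:C [tuple 0%R | _ < n]) <= M) ->
  (moment_sphere n r)%:E <= M.
Proof.
move=> rn hM.
have n1 : nrm2 (ccons 1%R [tuple 0%R | _ < n] : n.+1.-tuple C) = 1%R.
  by rewrite nrm2_axis normc1 expr1n.
rewrite -(moment_sphereE rn n1) /moment.
pose e (t : R) : n.+1.-tuple C := ccons t%:C [tuple 0%R | _ < n].
pose t_ (k : nat) : R := (1 - k.+1%:R^-1)%R.
have t0 k : (0 <= t_ k)%R by rewrite /t_ subr_ge0 invf_le1 ?ltr0n// ler1n.
have t1 k : (t_ k < 1)%R by rewrite /t_ ltrBlDr ltrDl invr_gt0 ltr0n.
have mB := @measurable_unit_ball R n.+1.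
have cvgt : t_ k @[k --> \oo] --> (1%R : R).
  rewrite -[X in _ --> X]subr0; apply: cvgB; first exact: cvg_cst.
  exact: cvg_harmonic.
have cvgt2 : (t_ k ^+ 2)%R @[k --> \oo] --> (1 ^+ 2 : R)%R.
  rewrite (_ : (fun k => _) = fun k => t_ k * t_ k)%R; last exact/funext.
  by rewrite expr2; exact: cvgM.
have cvgk w : @unit_ball R n.+1 w -> (kap r (e (t_ k)) w)%:E @[k --> \oo] --> (kap r (e 1%R) w)%:E.
  move=> Bw; apply: cvg_EFin; first by near=> k.
  rewrite /comp /=.
  set l := conjc (thead w).
  (* A real power of a polynomial in [t] that is positive at [t = 1], so continuity of powers on the
     positive reals suffices. *)
  have kE t : kap r (e t) w = ((1 + t ^+ 2 * normc l ^+ 2 - 2 * t * Re l) `^ (- (r / 2)))%R.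
    rewrite /kap cdot_axis -/l -sqr_normc_1B -(powR_mulrn 2 (normc_ge0 _)) -powRrM.
    by congr powR; field.
  have l1 : (normc l < 1)%R.
    rewrite normc_conj -(@expr_lt1 _ 2)// ?normc_ge0//.
    exact: le_lt_trans (nrm2_head w) Bw.
  have -> : (fun k => kap r (e (t_ k)) w) = fun k =>
      ((1 + t_ k ^+ 2 * normc l ^+ 2 - 2 * t_ k * Re l) `^ (- (r / 2)))%R.
    by apply/funext => k; exact: kE.
  rewrite kE.
  have b0 : (0 < 1 + 1 ^+ 2 * normc l ^+ 2 - 2 * 1 * Re l)%R.
    rewrite -sqr_normc_1B mul1r exprn_gt0//.
    by apply: lt_le_trans (normc_1B_ge _); rewrite subr_gt0.
  have cb : (1 + t_ k ^+ 2 * normc l ^+ 2 - 2 * t_ k * Re l)%R @[k --> \oo] -->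
      (1 + 1 ^+ 2 * normc l ^+ 2 - 2 * 1 * Re l : R)%R.
    apply: cvgB; last by apply: cvgM; [apply: cvgM => //|]; exact: cvg_cst.
    apply: cvgD; first exact: cvg_cst.
    by apply: cvgM; [exact: cvgt2|exact: cvg_cst].
  exact: (cvg_comp _ _ cb (@continuous_powR_gt0 (- (r / 2))%R _ b0)).
apply: (@le_trans _ _ (\int[@dv R n.+1]_(w in @unit_ball R n.+1)
    limn_einf (fun k => (kap r (e (t_ k)) w)%:E))).
  rewrite le_eqVlt; apply/orP; left; apply/eqP; apply: eq_integral => w.
  by rewrite inE => /cvgk /cvg_limn_einf_sup[-> _].
apply: le_trans (fatou _ mB _ _) _.
- move=> k; apply: measurable_funTS; apply/measurable_EFinP.
  by apply: (@measurable_kap _ _ n.+1 r (cst (e (t_ k))) id).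
- by move=> k w _; rewrite lee_fin kap_ge0.
rewrite limn_einf_lim; apply: lime_le; first exact: is_cvg_einfs.
near=> k; apply: le_trans (hM _ (t0 k) (t1 k)).
by apply: ereal_inf_lbound; exists k => /=.
Unshelve. all: by end_near. Qed.

End kernel_moments.

(** * The two operators and the Schur test *)

Section complex_powers.
Variable R : realType.
Local Notation C := R[i].
Implicit Types (u v : C) (a : R).

Lemma normc_cpow u a : normc (cpow u a) = normc u `^ a.
Proof.
rewrite /cpow /normc !exprMn -mulrDr cos2Dsin2 mulr1 sqrtr_sqr ger0_norm//.
exact: powR_ge0.
Qed.

(** Exhibits the real and imaginary parts of the inverse kernel. When the modulus of the power is 0,
    both sides are 0 since the inverse of 0 is 0. *)
Lemma cpow_inv u a : (cpow u a)^-1 =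
  (normc u `^ (- a) * cos (a * carg u)) +i* (- (normc u `^ (- a) * sin (a * carg u))).
Proof.
have [p0|p0] := eqVneq (normc u `^ a) 0.
  have -> : cpow u a = 0 by rewrite /cpow p0 !mul0r.
  by rewrite invr0 powRN p0 invr0 !mul0r oppr0.
apply: (mulfI (x := cpow u a)).
  by rewrite -normc_eq0 normc_cpow.
rewrite mulfV; last by rewrite -normc_eq0 normc_cpow.
rewrite powRN; set q := normc u `^ a in p0 *.
have := cos2Dsin2 (a * carg u); set c := cos _; set s := sin _ => cs.
by apply: complex_ext; rewrite !ReImE/= -/q -/c -/s; [rewrite -cs|]; field.
Qed.

Lemma atan_ge0 (t : R) : 0 <= t -> 0 <= atan t.
Proof.
move=> t0; rewrite leNgt; apply/negP => y0.
have c0 : 0 < cos (atan t) by rewrite cos_atan invr_gt0 sqrtr_gt0 ltr_wpDr// sqr_ge0.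
have s0 : 0 < sin (- atan t).
  apply: sin_gt0_pi; rewrite oppr_gt0 y0/=.
  by have := atan_gtNpi2 t; have := pi_gt0 R; lra.
have := atanK t; rewrite /tan => e; move: t0; rewrite -e.
rewrite pmulr_lge0 ?invr_gt0//; apply/negP; rewrite -ltNge.
by rewrite sinN oppr_gt0 in s0.
Qed.

(** The cosine of [atan t] is [1 / sqrt (1 + t ^+ 2)], here [Re u / normc u]; on the right
    half-plane, which contains every [1 - cdot z w] for [z], [w] in the ball, the sign of [Im u]
    then selects the same angle on both sides. *)
Lemma cargE u : 0 < Re u -> carg u = atan (Im u / Re u).
Proof.
move=> u0; set t := Im u / Re u.
have e : Re u / normc u = cos (atan t).
  rewrite cos_atan; have -> : normc u = Re u * Num.sqrt (1 + t ^+ 2).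
    rewrite -[in RHS](ger0_norm (ltW u0)) -sqrtr_sqr -sqrtrM ?sqr_ge0//.
    rewrite -[LHS]ger0_norm ?normc_ge0// -sqrtr_sqr sqr_normcE; congr Num.sqrt.
    by rewrite /t; field; rewrite gt_eqF.
  by rewrite invfM mulrA mulfV ?mul1r// gt_eqF.
have pi0 := pi_gt0 R.
have tN := atan_gtNpi2 t; have tP := atan_ltpi2 t.
rewrite /carg e; case: (leP 0 (Im u)) => i0.
  have t0 : 0 <= atan t by apply: atan_ge0; rewrite divr_ge0// ltW.
  by rewrite cosK// in_itv/= t0/=; lra.
have t0 : 0 <= - atan t.
  by rewrite -atanN; apply: atan_ge0; rewrite -mulNr divr_ge0 ?oppr_ge0 ?ltW.
by rewrite -cosN cosK ?opprK// in_itv/= t0/=; lra.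
Qed.

(* The principal argument on the right half-plane; the exponent [-1] instead of an
   inverse makes measurability a case of that of [powR]. *)
Definition rarg u : R := atan (Im u * Re u `^ (-1)).

Lemma carg_rarg u : 0 < Re u -> carg u = rarg u.
Proof. by move=> u0; rewrite cargE// /rarg powR_inv1// ltW. Qed.

Lemma measurable_atan_fun d (T : measurableType d) (f : T -> R) :
  measurable_fun setT f -> measurable_fun setT (fun x => atan (f x)).
Proof.
move=> mf; apply: measurableT_comp mf; apply: continuous_measurable_fun => x.
exact: continuous_atan.
Qed.

Lemma measurable_cos_fun d (T : measurableType d) (f : T -> R) :
  measurable_fun setT f -> measurable_fun setT (fun x => cos (f x)).
Proof.
move=> mf; apply: measurableT_comp mf; apply: continuous_measurable_fun => x.
exact: continuous_cos.
Qed.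

Lemma measurable_sin_fun d (T : measurableType d) (f : T -> R) :
  measurable_fun setT f -> measurable_fun setT (fun x => sin (f x)).
Proof.
move=> mf; apply: measurableT_comp mf; apply: continuous_measurable_fun => x.
exact: continuous_sin.
Qed.

Lemma measurable_rarg d (T : measurableType d) (f : T -> C) :
  measurable_fun setT f -> measurable_fun setT (fun x => rarg (f x)).
Proof.
move=> mf; apply: measurable_atan_fun; apply: measurable_funM.
  exact: measurable_Im_fun.
exact/measurable_powR_fun/measurable_Re_fun.
Qed.

End complex_powers.

Section kernel_bounds.
Variable R : realType.
Local Notation C := R[i].
Variable n : nat.
Implicit Types z w : n.-tuple C.

Lemma normc_sum_le (I : Type) (s : seq I) (F : I -> C) :
  normc (\sum_(i <- s) F i) <= \sum_(i <- s) normc (F i).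
Proof.
elim: s => [|i s IH]; first by rewrite !big_nil normc0.
by rewrite !big_cons; apply: le_trans (le_normcD _ _) _; rewrite lerD2l.
Qed.

(** The termwise bound [2 * a * b <= a ^+ 2 + b ^+ 2] does the work of Cauchy-Schwarz: for [w] in
    the ball it keeps [normc (cdot z w)] at distance [(1 - nrm2 z) / 2] from 1, uniformly in [w]. *)
Lemma normc_cdot_le z w : normc (cdot z w) <= (nrm2 z + nrm2 w) / 2.
Proof.
apply: le_trans (normc_sum_le _ _) _.
rewrite /nrm2 -big_split/= mulr_suml; apply: ler_sum => j _.
rewrite normcM normc_conj; have := sqr_ge0 (normc (tnth z j) - normc (tnth w j)).
by nra.
Qed.

Lemma one_sub_cdot_gt z w : nrm2 w < 1 ->
  (1 - nrm2 z) / 2 < 1 - normc (cdot z w).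
Proof. by move=> w1; have := normc_cdot_le z w; lra. Qed.

Lemma normc_one_sub_cdot_gt z w : nrm2 w < 1 ->
  (1 - nrm2 z) / 2 < normc (1 - cdot z w).
Proof.
by move=> /(one_sub_cdot_gt z) h; apply: lt_le_trans h (normc_1B_ge _).
Qed.

Lemma normc_ge_Re u : Re u <= normc u :> R.
Proof. exact: le_trans (ler_norm _) (normr_Re_le _). Qed.

Lemma Re_one_sub_cdot_gt z w : nrm2 w < 1 ->
  (1 - nrm2 z) / 2 < Re (1 - cdot z w).
Proof.
move=> /(one_sub_cdot_gt z) h; apply: lt_le_trans h _.
by rewrite !ReImE lerD2l lerN2 normc_ge_Re.
Qed.

Lemma kap_le r z w : 0 <= r -> nrm2 z < 1 -> nrm2 w < 1 ->
  kap r z w <= ((1 - nrm2 z) / 2) `^ (- r).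
Proof.
move=> r0 z1 w1; have d0 : 0 < (1 - nrm2 z) / 2 by rewrite divr_gt0// subr_gt0.
have h := normc_one_sub_cdot_gt z w1.
rewrite /kap !powRN lef_pV2 ?posrE ?powR_gt0//; last exact: lt_trans h.
by apply: ge0_ler_powR; rewrite ?nnegrE ?(ltW d0) ?(ltW h)//; exact: ltW (lt_trans d0 h).
Qed.

Lemma kap_gt0 r z w : nrm2 z < 1 -> nrm2 w < 1 -> 0 < kap r z w.
Proof.
move=> z1 w1; rewrite powR_gt0//; apply: lt_trans (normc_one_sub_cdot_gt z w1).
by rewrite divr_gt0// subr_gt0.
Qed.

Lemma kapC r z w : kap r z w = kap r w z.
Proof.
rewrite /kap -normc_conj; congr (normc _ `^ _).
rewrite rmorphB rmorph1; congr (_ - _).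
rewrite /cdot rmorph_sum; apply: eq_bigr => j _.
by rewrite rmorphM/= conjcK mulrC.
Qed.

Lemma kap_powR r s z w : kap r z w `^ s = kap (r * s) z w.
Proof. by rewrite /kap -powRrM mulNr. Qed.

End kernel_bounds.

Section operator_domination.
Variable R : realType.
Local Open Scope ereal_scope.
Local Notation C := R[i].
Variable n : nat.
Local Notation nu := (@dv R n).
Local Notation B := (@unit_ball R n).
Implicit Types (f u : n.-tuple C -> C) (g : n.-tuple C -> R) (z w : n.-tuple C).

Let mB : measurable B := @measurable_unit_ball R n.

(** Projecting on the direction [(c, s)] of the integral [J] makes its modulus the integral of the
    real function [c * Re (u w) + s * Im (u w)], which is at most [normc (u w)] as [(c, s)] is a
    unit vector. *)
Lemma normc_cintegral_le u g :
  measurable_fun B (fun w => Re (u w)) -> measurable_fun B (fun w => Im (u w)) ->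
  measurable_fun B g -> (forall w, B w -> (normc (u w) <= g w)%R) ->
  \int[nu]_(w in B) (g w)%:E < +oo ->
  (normc (cintegral B u))%:E <= \int[nu]_(w in B) (g w)%:E.
Proof.
move=> mr mi mg ug goo.
have g0 w : B w -> (0 <= g w)%R by move=> Bw; apply: le_trans (ug _ Bw); exact: normc_ge0.
have ig : nu.-integrable B (EFin \o g).
  apply/integrableP; split; first exact/measurable_EFinP.
  rewrite (eq_integral (fun w => (g w)%:E))// => w; rewrite inE => Bw.
  by rewrite /= ger0_norm// g0.
have le_int (v : n.-tuple C -> R) : measurable_fun B v ->
    (forall w, B w -> (`|v w| <= g w)%R) -> nu.-integrable B (EFin \o v).
  move=> mv vg; apply: (le_integrable mB _ _ ig); first exact/measurable_EFinP.
  by move=> w Bw; rewrite /= lee_fin (ger0_norm (g0 _ Bw)) vg.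
have ir : nu.-integrable B (EFin \o (fun w => Re (u w))).
  by apply: le_int => // w Bw; exact: le_trans (normr_Re_le _) (ug _ Bw).
have ii : nu.-integrable B (EFin \o (fun w => Im (u w))).
  by apply: le_int => // w Bw; exact: le_trans (normr_Im_le _) (ug _ Bw).
have -> : \int[nu]_(w in B) (g w)%:E = (\int[nu]_(w in B) g w)%R%:E.
  by rewrite /Rintegral fineK//; exact: integrable_fin_num.
rewrite lee_fin.
set J := cintegral B u; have [J0|J0] := eqVneq (normc J) 0%R.
  by rewrite J0; apply: Rintegral_ge0.
pose c := (Re J / normc J)%R; pose s := (Im J / normc J)%R.
have cs : (c ^+ 2 + s ^+ 2 = 1)%R.
  by rewrite /c /s !expr_div_n -mulrDl -sqr_normcE divff// expf_neq0.
have cxsy x : (`|c * Re x + s * Im x| <= normc x)%R.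
  rewrite -(@ler_pXn2r _ 2)// ?nnegrE ?normr_ge0 ?normc_ge0//.
  rewrite real_normK ?num_real// sqr_normcE.
  rewrite -[leRHS]mul1r -cs -subr_ge0.
  rewrite (_ : _ - _ = (c * Im x - s * Re x) ^+ 2)%R ?sqr_ge0//.
  by ring.
have c1 x : (`|c * Re x| <= normc x)%R.
  have c1 : (`|c| <= 1)%R by rewrite -(@expr_le1 _ 2)// real_normK ?num_real// -cs lerDl sqr_ge0.
  by rewrite normrM; apply: le_trans (ler_pM _ _ c1 (normr_Re_le x)) _; rewrite ?normr_ge0 ?mul1r.
have s1 x : (`|s * Im x| <= normc x)%R.
  have s1 : (`|s| <= 1)%R by rewrite -(@expr_le1 _ 2)// real_normK ?num_real// -cs lerDr sqr_ge0.
  by rewrite normrM; apply: le_trans (ler_pM _ _ s1 (normr_Im_le x)) _; rewrite ?normr_ge0 ?mul1r.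
have mcr : measurable_fun B (fun w => c * Re (u w))%R.
  by apply: measurable_funM => //; exact: measurable_cst.
have msi : measurable_fun B (fun w => s * Im (u w))%R.
  by apply: measurable_funM => //; exact: measurable_cst.
have -> : normc J = (\int[nu]_(w in B) (c * Re (u w) + s * Im (u w)))%R.
  rewrite RintegralD//; last 2 first.
  - by apply: le_int => // w Bw; apply: le_trans (ug _ Bw); exact: c1.
  - by apply: le_int => // w Bw; apply: le_trans (ug _ Bw); exact: s1.
  rewrite !RintegralZl// -/(Re J) -/(Im J) /c /s mulrAC -expr2 [X in (_ + X)%R]mulrAC -expr2.
  by rewrite -mulrDl -sqr_normcE expr2 mulfK.
apply: le_Rintegral => //.
- apply: le_int; first exact: measurable_funD.
  by move=> w Bw; apply: le_trans (ug _ Bw); exact: cxsy.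
- by move=> w Bw; apply: le_trans (ug _ Bw); apply: le_trans (cxsy _); exact: ler_norm.
Qed.

Lemma cLnorm_fin (r : R) f : (0 < r)%R ->
  cLnorm r%:E f <= 1 -> \int[nu]_w (normc (f w) `^ r)%:E <= 1.
Proof.
move=> r0 f1; rewrite (_ : \int[nu]_w _ = (cLnorm r%:E f) `^ r).
  rewrite -[leRHS](poweR1r r); apply: (gt0_ler_poweR (ltW r0)) => //.
  - by rewrite in_itv/= Lnorm_ge0 leey.
  - by rewrite in_itv/= lee01 leey.
have r0' : r != 0%R by rewrite gt_eqF.
apply: etrans (esym (poweR_Lnorm _ _ r0')); apply: eq_integral => w _.
by rewrite /= ger0_norm ?normc_ge0.
Qed.

Lemma cLnorm_infty f : cLnorm +oo f <= 1 -> {ae nu, forall w, (normc (f w) <= 1)%R}.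
Proof.
rewrite /cLnorm unlock /= ifT; last by rewrite probability_setT.
move=> /ess_supP; apply: filterS => w /=.
by rewrite lee_fin ger0_norm// normc_ge0.
Qed.

(** The measure has mass 1, so for finite exponents [t <= 1 + t ^ r] suffices. *)
Lemma cLnorm_integrable p f : measurable_fun setT f -> 1 <= p -> cLnorm p f <= 1 ->
  \int[nu]_(w in B) (normc (f w))%:E < +oo.
Proof.
move=> mf p1 f1.
have mn : measurable_fun setT (fun w => normc (f w)) by exact: measurable_normc.
have -> : \int[nu]_(w in B) (normc (f w))%:E = \int[nu]_w (normc (f w))%:E.
  rewrite integral_dv_ball//; first exact/measurable_EFinP.
  by move=> w; rewrite lee_fin normc_ge0.
case: p p1 f1 => [r| |]//.
- rewrite lee_fin => r1 /cLnorm_fin => /(_ (lt_le_trans ltr01 r1)) h.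
  have mr : measurable_fun setT (fun w => normc (f w) `^ r)%R by exact: measurable_powR_fun.
  apply: (@le_lt_trans _ _ (\int[nu]_w (1%:E + (normc (f w) `^ r)%:E))).
    apply: ge0_le_integral => //.
    - by move=> w _; rewrite lee_fin normc_ge0.
    - exact/measurable_EFinP.
    - by apply: emeasurable_funD => //; exact/measurable_EFinP.
    move=> w _; rewrite -EFinD lee_fin.
    have [n1|n1] := leP (normc (f w)) 1%R; first by rewrite ler_wpDr ?powR_ge0.
    by rewrite ler_wpDl// le1r_powR// ltW.
  rewrite ge0_integralD//; last 2 first.
  - by move=> w _; rewrite lee_fin powR_ge0.
  - exact/measurable_EFinP.
  rewrite integral_cst//= mul1e probability_setT.
  by apply: le_lt_trans (leeD2l _ h) _; rewrite -EFinD ltry.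
- move=> _ /cLnorm_infty h.
  apply: (@le_lt_trans _ _ (\int[nu]_w 1%:E)); last first.
    by rewrite integral_cst//= mul1e probability_setT ltry.
  apply: ae_ge0_le_integral => //.
  + by move=> w _; rewrite lee_fin normc_ge0.
  + exact/measurable_EFinP.
  + by move: h; apply: filterS => w h _; rewrite lee_fin.
Qed.

End operator_domination.

Section kernels.
Variable R : realType.
Local Notation C := R[i].
Variable n : nat.
Implicit Types (z w : n.-tuple C) (a : R).

(** On the ball this is the inverse of [cpow (1 - cdot z w) a]; the use of [rarg] makes it
    measurable on the whole space. *)
Definition ckap a z w : C :=
  (kap a z w * cos (a * rarg (1 - cdot z w))) +i*
  (- (kap a z w * sin (a * rarg (1 - cdot z w)))).

Lemma normc_ckap a z w : normc (ckap a z w) = kap a z w.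
Proof.
rewrite /ckap /normc sqrrN !exprMn -mulrDr cos2Dsin2 mulr1 sqrtr_sqr ger0_norm//.
exact: kap_ge0.
Qed.

Lemma measurable_ckap d (T : measurableType d) a (f g : T -> n.-tuple C) :
  measurable_fun setT f -> measurable_fun setT g ->
  measurable_fun setT (fun x => ckap a (f x) (g x)).
Proof.
move=> mf mg; have mk := measurable_kap a mf mg.
have mr : measurable_fun setT (fun x => a * rarg (1 - cdot (f x) (g x))).
  apply: measurable_funM; first exact: measurable_cst.
  by apply: measurable_rarg; tmeas.
apply: measurable_complexP; rewrite /ckap/=.
  by apply: measurable_funM => //; exact: measurable_cos_fun.
by apply: measurable_oppr_fun; apply: measurable_funM => //; exact: measurable_sin_fun.
Qed.

Lemma ckapE a z w : nrm2 z < 1 -> nrm2 w < 1 -> (cpow (1 - cdot z w) a)^-1 = ckap a z w.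
Proof.
move=> z1 w1; rewrite cpow_inv carg_rarg//; apply: le_lt_trans (Re_one_sub_cdot_gt z w1).
by rewrite divr_ge0// subr_ge0 ltW.
Qed.

Lemma KopE a f z : nrm2 z < 1 ->
  Kop a f z = cintegral (@unit_ball R n) (fun w => f w * ckap a z w).
Proof.
move=> z1; rewrite /Kop mem_set//; rewrite /cintegral.
by congr (_ +i* _); apply: eq_Rintegral => w; rewrite inE => Bw; rewrite ckapE.
Qed.

Lemma Kop_out a f z : ~ unit_ball z -> Kop a f z = 0.
Proof. by move=> Bz; rewrite /Kop memNset. Qed.

Lemma Kop_plusE a f z : nrm2 z < 1 ->
  Kop_plus a f z = cintegral (@unit_ball R n) (fun w => f w * (kap a z w)%:C).
Proof.
move=> z1; rewrite /Kop_plus mem_set//; rewrite /cintegral.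
have e w : f w / (normc (1 - cdot z w) `^ a)%:C = f w * (kap a z w)%:C.
  by rewrite /kap powRN fmorphV.
by congr (_ +i* _); apply: eq_Rintegral => w _; rewrite e.
Qed.

Lemma Kop_plus_out a f z : ~ unit_ball z -> Kop_plus a f z = 0.
Proof. by move=> Bz; rewrite /Kop_plus memNset. Qed.

End kernels.

Section domination.
Variable R : realType.
Local Open Scope ereal_scope.
Local Notation C := R[i].
Variable n : nat.
Local Notation nu := (@dv R n).
Local Notation B := (@unit_ball R n).
Implicit Types (f u : n.-tuple C -> C) (z w : n.-tuple C) (a : R).

Let mB : measurable B := @measurable_unit_ball R n.

(** The positive operator applied to the modulus of [f], kept in [\bar R] so that no default value
    of a divergent real integral intervenes. *)
Definition absop a f z := \int[nu]_(w in B) (normc (f w) * kap a z w)%:E.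

Lemma absop_ge0 a f z : 0 <= absop a f z.
Proof. by apply: integral_ge0 => w _; rewrite lee_fin mulr_ge0 ?normc_ge0 ?kap_ge0. Qed.

Lemma measurable_absop_integrand a f z : measurable_fun setT f ->
  measurable_fun setT (fun w => normc (f w) * kap a z w)%R.
Proof.
move=> mf; apply: measurable_funM; first exact: measurable_normc.
by apply: measurable_kap => //; exact: measurable_cst.
Qed.

Lemma absop_lty a f z : (0 <= a)%R -> measurable_fun setT f ->
  \int[nu]_(w in B) (normc (f w))%:E < +oo -> (nrm2 z < 1)%R -> absop a f z < +oo.
Proof.
move=> a0 mf foo z1; pose M := (((1 - nrm2 z) / 2) `^ (- a))%R.
have mn := measurable_normc mf.
apply: (@le_lt_trans _ _ (\int[nu]_(w in B) (M%:E * (normc (f w))%:E))).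
  apply: ge0_le_integral => //.
  - by move=> w _; rewrite lee_fin mulr_ge0 ?normc_ge0 ?kap_ge0.
  - by apply: measurable_funTS; apply/measurable_EFinP; exact: measurable_absop_integrand.
  - apply: measurable_funTS; apply/measurable_EFinP.
    by apply: measurable_funM => //; exact: measurable_cst.
  by move=> w Bw; rewrite -EFinM lee_fin mulrC ler_wpM2r ?normc_ge0// kap_le.
rewrite ge0_integralZl_EFin//; last first.
- exact: powR_ge0.
- by apply: measurable_funTS; apply/measurable_EFinP.
- by move=> w _; rewrite lee_fin normc_ge0.
by rewrite lte_mul_pinfty// lee_fin powR_ge0.
Qed.

Lemma normc_Kop_le a f z : (0 <= a)%R -> measurable_fun setT f ->
  \int[nu]_(w in B) (normc (f w))%:E < +oo -> (nrm2 z < 1)%R ->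
  (normc (Kop a f z))%:E <= absop a f z.
Proof.
move=> a0 mf foo z1; rewrite KopE//.
have mu : measurable_fun setT (fun w => f w * ckap a z w)%R.
  by apply: measurable_mulc => //; apply: measurable_ckap => //; exact: measurable_cst.
apply: (normc_cintegral_le (g := fun w => normc (f w) * kap a z w)%R).
- exact/measurable_funTS/measurable_Re_fun.
- exact/measurable_funTS/measurable_Im_fun.
- by apply: measurable_funTS; exact: measurable_absop_integrand.
- by move=> w _; rewrite normcM normc_ckap.
- exact: absop_lty.
Qed.

Lemma normc_Kop_plus_le a f z : (0 <= a)%R -> measurable_fun setT f ->
  \int[nu]_(w in B) (normc (f w))%:E < +oo -> (nrm2 z < 1)%R ->
  (normc (Kop_plus a f z))%:E <= absop a f z.
Proof.
move=> a0 mf foo z1; rewrite Kop_plusE//.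
have mu : measurable_fun setT (fun w => f w * (kap a z w)%:C)%R.
  apply: measurable_mulc => //; apply: measurable_complexP => /=; last exact: measurable_cst.
  by apply: measurable_kap => //; exact: measurable_cst.
apply: (normc_cintegral_le (g := fun w => normc (f w) * kap a z w)%R).
- exact/measurable_funTS/measurable_Re_fun.
- exact/measurable_funTS/measurable_Im_fun.
- by apply: measurable_funTS; exact: measurable_absop_integrand.
- by move=> w _; rewrite normcM normcR ger0_norm ?kap_ge0.
- exact: absop_lty.
Qed.

Lemma Kop_plus_normc a f z : (nrm2 z < 1)%R ->
  Kop_plus a (fun w => (normc (f w))%:C) z = (fine (absop a f z))%:C%C.
Proof.
move=> z1; rewrite Kop_plusE// /cintegral; apply: complex_ext => /=.
  rewrite /Rintegral; congr fine; apply: eq_integral => w _.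
  by rewrite mulr0 subr0.
rewrite (_ : (fun w => _) = cst 0%R); last first.
  by apply/funext => w /=; rewrite mulr0 mul0r addr0.
by rewrite /Rintegral integral0.
Qed.

(* [ge0_le_integral] does not apply to images under [Kop], whose measurability is
   not established. *)
Lemma le_integral_ge0 d (T : measurableType d) (mu : {measure set T -> \bar R})
    (f g : T -> \bar R) :
  (forall x, 0 <= f x) -> (forall x, f x <= g x) -> \int[mu]_x f x <= \int[mu]_x g x.
Proof.
move=> f0 fg; have g0 x : 0 <= g x by exact: le_trans (fg x).
rewrite !ge0_integralTE//; apply: le_ereal_sup => _ [h hf <-].
by exists h => // x; exact: le_trans (hf x) (fg x).
Qed.

Lemma le_cLnorm q f u : 1 <= q ->
  (forall z, normc (f z) <= normc (u z))%R -> cLnorm q f <= cLnorm q u.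
Proof.
move=> q1 fu; rewrite /cLnorm !Lnorm.unlock; case: q q1 => [r| |]; last by rewrite leeNy_eq.
  2: move=> _ /=; do 2 (rewrite ifT; last by rewrite probability_setT).
  2: apply: le_ess_sup; apply: nearW => z /=.
  2: by rewrite lee_fin !ger0_norm ?normc_ge0.
rewrite lee_fin => r1; have r0 : (0 <= r)%R by exact: le_trans r1.
have inI (x : \bar R) : 0 <= x -> x \in `[0, +oo] by move=> x0; rewrite in_itv/= x0 leey.
have h (g : n.-tuple C -> C) z : (0 <= `|(normc (g z))%:E|)%E by exact: abse_ge0.
have ri0 : (0 <= r^-1)%R by rewrite invr_ge0.
apply: (gt0_ler_poweR ri0).
- by apply: inI; apply: integral_ge0 => z _; exact: poweR_ge0.
- by apply: inI; apply: integral_ge0 => z _; exact: poweR_ge0.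
apply: le_integral_ge0 => z; first exact: poweR_ge0.
apply: (gt0_ler_poweR r0); [exact/inI/h|exact/inI/h|].
by rewrite /= lee_fin !ger0_norm ?normc_ge0.
Qed.

Lemma cLnorm_normc q f : cLnorm q (fun w => (normc (f w))%:C%C) = cLnorm q f.
Proof.
rewrite /cLnorm; congr Lnorm; apply/funext => w.
by rewrite normcR ger0_norm ?normc_ge0.
Qed.

(** The competitor for the positive operator is the modulus of [f]: it has the same norm as [f], and
    its image is [absop a f], finite at every point of the ball. *)
Lemma opnorm_Kop_le a p q : (0 <= a)%R -> 1 <= p -> 1 <= q ->
  opnorm p q (@Kop R n a) <= opnorm p q (@Kop_plus R n a).
Proof.
move=> a0 p1 q1; apply: ge_ereal_sup => _ [f [mf f1] <-].
pose g w := (normc (f w))%:C%C.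
have mg : measurable_fun setT g.
  apply: measurable_complexP => /=; last exact: measurable_cst.
  exact: measurable_normc.
apply: (@le_trans _ _ (cLnorm q (Kop_plus a g))); last first.
  by apply: ereal_sup_ubound; exists g => //; split => //; rewrite cLnorm_normc.
apply: le_cLnorm => // z; have [z1|z1] := pselect (unit_ball z); last first.
  by rewrite Kop_out// normc0 normc_ge0.
have foo := cLnorm_integrable mf p1 f1.
rewrite Kop_plus_normc// normcR ger0_norm ?fine_ge0 ?absop_ge0//.
rewrite -lee_fin fineK; first exact: normc_Kop_le.
by rewrite ge0_fin_numE ?absop_ge0// absop_lty.
Qed.

End domination.

(** * Weighted means and the Schur test *)

Section weighted_means.
Variable R : realType.
Implicit Types a b c x y t M k g p r s : R.

Lemma powR_le_tangent a x M : 0 < M -> 0 <= a -> 0 <= x ->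
  a `^ x <= M `^ x * expR (x * (a / M - 1)).
Proof.
move=> M0 a0 x0.
have -> : expR (x * (a / M - 1)) = expR (a / M - 1) `^ x.
  by rewrite /powR gt_eqF ?expR_gt0// expRK.
rewrite -powRM ?expR_ge0 ?(ltW M0)//; apply: ge0_ler_powR; rewrite ?nnegrE//.
  by rewrite mulr_ge0 ?expR_ge0 ?(ltW M0).
rewrite mulrC -ler_pdivrMr//; apply: le_trans (expR_ge1Dx _).
by rewrite addrC subrK.
Qed.

(** Polya's argument: [1 + y <= expR y] is applied to each base divided by the weighted mean [M].
    The exponents then add up to [M / M - 1 = 0]. *)
Lemma weighted_amgm3 a b c x y t : 0 <= a -> 0 <= b -> 0 <= c ->
  0 <= x -> 0 <= y -> 0 <= t -> x + y + t = 1 ->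
  a `^ x * b `^ y * c `^ t <= x * a + y * b + t * c.
Proof.
move=> a0 b0 c0 x0 y0 t0 e1; set M := x * a + y * b + t * c.
have xa : 0 <= x * a by exact: mulr_ge0.
have yb : 0 <= y * b by exact: mulr_ge0.
have tc : 0 <= t * c by exact: mulr_ge0.
have : 0 <= M by rewrite /M !addr_ge0.
rewrite le_eqVlt => /predU1P[M0|M0].
  (* If the mean is 0, some weight is positive and its base is 0. A base of zero weight would not
     do, since [powR] with exponent 0 is 1. *)
  have zero u v : 0 < u -> u * v = 0 -> v `^ u = 0.
    move=> u0 /eqP; rewrite mulf_eq0 (gt_eqF u0)/= => /eqP ->.
    by rewrite powR0// gt_eqF.
  rewrite -M0; have : 0 < x \/ 0 < y \/ 0 < t.
    have [|x0'] := ltP 0 x; first by left.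
    have [|y0'] := ltP 0 y; first by right; left.
    by right; right; lra.
  have [xa0 yb0 tc0] : [/\ x * a = 0, y * b = 0 & t * c = 0].
    by move: M0; rewrite /M => M0; split; lra.
  by move=> [/zero|[/zero|/zero]] -> //; rewrite ?mulr0 ?mul0r.
have Mpow : M `^ x * M `^ y * M `^ t = M.
  by rewrite -!powRD ?(gt_eqF M0) ?implybT// e1 powRr1// ltW.
apply: le_trans (_ : _ <= M `^ x * expR (x * (a / M - 1)) *
  (M `^ y * expR (y * (b / M - 1))) * (M `^ t * expR (t * (c / M - 1)))) _.
  apply: ler_pM; rewrite ?mulr_ge0 ?powR_ge0 ?powR_le_tangent//.
  by apply: ler_pM; rewrite ?powR_ge0 ?powR_le_tangent.
rewrite (_ : _ * _ * _ = (M `^ x * M `^ y * M `^ t) * (expR (x * (a / M - 1)) *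
  expR (y * (b / M - 1)) * expR (t * (c / M - 1)))); last by ring.
rewrite Mpow -!expRD (_ : _ + _ = 0) ?expR0 ?mulr1//.
have -> : x * (a / M - 1) + y * (b / M - 1) + t * (c / M - 1) = M / M - (x + y + t).
  by rewrite /M; ring.
by rewrite divff ?gt_eqF// e1 subrr.
Qed.

(* AM-GM for [(k * g^p / M)^x * (k / A)^(1 - 1/p) * (g^p)^(1/p - x)]. Each of the
   three bases has integral at most 1 for the [M] and [A] used in the Schur test. *)
Lemma schur_pointwise k g p x M A : 0 < k -> 0 <= g -> 1 <= p -> 0 <= x -> x <= p^-1 ->
  0 < M -> 0 < A ->
  g * k `^ (1 - p^-1 + x) <= M `^ x * A `^ (1 - p^-1) *
    (x * (k * g `^ p / M) + (1 - p^-1) * (k / A) + (p^-1 - x) * g `^ p).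
Proof.
move=> k0 g0 p1 x0 xp M0 A0; have p0 : 0 < p by exact: lt_le_trans p1.
have ip1 : p^-1 <= 1 by rewrite invf_le1.
set G := g `^ p; have G0 : 0 <= G by exact: powR_ge0.
have h := @weighted_amgm3 (k * G / M) (k / A) G x (1 - p^-1) (p^-1 - x).
have {}h : (k * G / M) `^ x * (k / A) `^ (1 - p^-1) * G `^ (p^-1 - x) <=
    x * (k * G / M) + (1 - p^-1) * (k / A) + (p^-1 - x) * G.
  apply: h; rewrite ?subr_ge0//; last by ring.
  - by rewrite divr_ge0 ?mulr_ge0 ?(ltW k0) ?(ltW M0).
  - by rewrite divr_ge0 ?(ltW k0) ?(ltW A0).
apply: le_trans (ler_wpM2l _ h); last by rewrite mulr_ge0 ?powR_ge0.
move: g0; rewrite le_eqVlt => /predU1P[g0|g0].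
  by rewrite -g0 mul0r !mulr_ge0 ?powR_ge0.
have Gg : G `^ p^-1 = g by rewrite /G -powRrM divff ?gt_eqF// powRr1// ltW.
have pG : 0 < G by rewrite powR_gt0.
have gE : g = G `^ (p^-1 - x) * G `^ x by rewrite -powRD ?(gt_eqF pG) ?implybT// subrK.
have kE : k `^ (1 - p^-1 + x) = k `^ (1 - p^-1) * k `^ x by rewrite -powRD ?(gt_eqF k0) ?implybT.
rewrite {1}gE kE.
rewrite !powRM ?divr_ge0 ?mulr_ge0 ?invr_ge0 ?(ltW k0) ?(ltW M0) ?(ltW A0)//.
have hx : M `^ x * M^-1 `^ x = 1 by rewrite -powRM ?invr_ge0 ?(ltW M0)// divff ?gt_eqF// powR1.
have hA : A `^ (1 - p^-1) * A^-1 `^ (1 - p^-1) = 1.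
  by rewrite -powRM ?invr_ge0 ?(ltW A0)// divff ?gt_eqF// powR1.
move: hx hA; set e := M `^ x; set e' := M^-1 `^ x; set h1 := A `^ _; set h2 := A^-1 `^ _.
move=> hx hA; rewrite [leRHS](_ : _ = (e * e') * (h1 * h2) *
  (G `^ (p^-1 - x) * G `^ x * (k `^ (1 - p^-1) * k `^ x))); last by ring.
by rewrite hx hA !mul1r.
Qed.

End weighted_means.

Section schur_test.
Variable R : realType.
Local Open Scope ereal_scope.
Local Notation C := R[i].
Variables (n : nat) (r : R).
Hypotheses (r0 : (0 <= r)%R) (rn : (r < n%:R + 2)%R).
Local Notation nu := (@dv R n.+1).
Local Notation B := (@unit_ball R n.+1).
Local Notation A := (@moment_sphere R n r).
Implicit Types (f : n.+1.-tuple C -> C) (z w : n.+1.-tuple C).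

Let mB : measurable B := @measurable_unit_ball R n.+1.

Lemma moment_sphere_gt0 : (0 < A)%R.
Proof.
have n0 : (0 <= n%:R :> R)%R by exact: ler0n.
apply: divr_gt0; [apply: mulr_gt0|apply: exprn_gt0]; apply: gammaR_gt0.
- by rewrite ltr_wpDl.
- by rewrite subr_gt0.
- by rewrite subr_gt0; apply: le_lt_trans rn; rewrite ler_pdivrMr// ler_peMr// ler1n.
Qed.

Definition wmoment p f z := \int[nu]_w (kap r z w * normc (f w) `^ p)%:E.

Let measurable_wm p f d (X : measurableType d) (g h : X -> n.+1.-tuple C) :
  measurable_fun setT f -> measurable_fun setT g -> measurable_fun setT h ->
  measurable_fun setT (fun x => kap r (g x) (h x) * normc (f (h x)) `^ p)%R.
Proof.
move=> mf mg mh; apply: measurable_funM; first exact: measurable_kap.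
apply: measurable_powR_fun; apply: measurable_normc.
exact: (measurableT_comp mf mh).
Qed.

(** Here [x] stands for [1/q]. The bound on [wmoment] is multiplied by [x] so that [x = 0], the case
    [q = +oo], fits the same statement even where [wmoment] is infinite. *)
Lemma absop_le_wmoment p x f z M : (1 <= p)%R -> (0 <= x)%R -> (x <= p^-1)%R ->
  measurable_fun setT f -> \int[nu]_w (normc (f w) `^ p)%:E <= 1 -> (nrm2 z < 1)%R ->
  (0 < M)%R -> x%:E * wmoment p f z <= (x * M)%:E ->
  absop (r * (1 - p^-1 + x)) f z <= (M `^ x * A `^ (1 - p^-1))%:E.
Proof.
move=> p1 x0 xp mf f1 z1 M0 hM; have A0 := moment_sphere_gt0.
have y0 : (0 <= 1 - p^-1)%R by rewrite subr_ge0 invf_le1// (lt_le_trans ltr01).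
have t0 : (0 <= p^-1 - x)%R by rewrite subr_ge0.
set c := (M `^ x * A `^ (1 - p^-1))%R.
have c0 : (0 <= c)%R by rewrite mulr_ge0 ?powR_ge0.
pose u1 w := (kap r z w * normc (f w) `^ p)%R.
pose u2 w := kap r z w.
pose u3 w := (normc (f w) `^ p)%R.
have m2 : measurable_fun setT u2 by apply: measurable_kap => //; exact: measurable_cst.
have m3 : measurable_fun setT u3 by apply: measurable_powR_fun; exact: measurable_normc.
have m1 : measurable_fun setT u1 by exact: measurable_funM.
have u10 w : (0 <= u1 w)%R by rewrite mulr_ge0 ?kap_ge0 ?powR_ge0.
have u20 w : (0 <= u2 w)%R by exact: kap_ge0.
have u30 w : (0 <= u3 w)%R by exact: powR_ge0.
pose c1 := (c * (x / M))%R; pose c2 := (c * ((1 - p^-1) / A))%R.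
pose c3 := (c * (p^-1 - x))%R.
have c10 : (0 <= c1)%R by apply: mulr_ge0 => //; apply: divr_ge0 => //; exact: ltW.
have c20 : (0 <= c2)%R by apply: mulr_ge0 => //; apply: divr_ge0 => //; exact: ltW.
have c30 : (0 <= c3)%R by exact: mulr_ge0.
have m1' : measurable_fun B (fun w => (u1 w)%:E) by apply: measurable_funTS; exact/measurable_EFinP.
have m2' : measurable_fun B (fun w => (u2 w)%:E) by apply: measurable_funTS; exact/measurable_EFinP.
have m3' : measurable_fun B (fun w => (u3 w)%:E) by apply: measurable_funTS; exact/measurable_EFinP.
have mc k (u : n.+1.-tuple C -> R) : measurable_fun B (fun w => (u w)%:E) ->
    measurable_fun B (fun w => k%:E * (u w)%:E).
  by move=> mu; apply: emeasurable_funM => //; exact: measurable_cst.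
apply: (@le_trans _ _ (\int[nu]_(w in B)
    (c1%:E * (u1 w)%:E + (c2%:E * (u2 w)%:E + c3%:E * (u3 w)%:E)))).
  apply: ge0_le_integral => //.
  - by move=> w _; rewrite lee_fin mulr_ge0 ?normc_ge0 ?kap_ge0.
  - apply: measurable_funTS; apply/measurable_EFinP; exact: measurable_absop_integrand.
  - by apply: emeasurable_funD; [exact: mc|apply: emeasurable_funD; exact: mc].
  move=> w Bw; rewrite -!EFinM -!EFinD lee_fin -kap_powR.
  have := schur_pointwise (kap_gt0 r z1 Bw) (normc_ge0 (f w)) p1 x0 xp M0 A0.
  move=> /le_trans; apply; rewrite le_eqVlt; apply/orP; left; apply/eqP.
  by rewrite /u1 /u2 /u3 /c1 /c2 /c3 -/c; ring.
have e0 k (u : n.+1.-tuple C -> R) : (0 <= k)%R -> (forall w, 0 <= u w)%R ->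
    forall w, B w -> 0 <= k%:E * (u w)%:E.
  by move=> k0 u0 w _; rewrite mule_ge0// lee_fin.
rewrite ge0_integralD//; [|exact: e0| exact: mc | |]; last 2 first.
- by move=> w Bw; rewrite adde_ge0// e0.
- by apply: emeasurable_funD; exact: mc.
rewrite ge0_integralD//; [|exact: e0|exact: mc|exact: e0|exact: mc].
have u_ge0 (u : n.+1.-tuple C -> R) : (forall w, 0 <= u w)%R ->
  forall w, B w -> 0 <= (u w)%:E by move=> u0 w _; rewrite lee_fin.
rewrite !ge0_integralZl_EFin//; try exact: u_ge0.
have I1 : \int[nu]_(w in B) (u1 w)%:E = wmoment p f z.
  by rewrite /wmoment integral_dv_ball//; exact/measurable_EFinP.
have I2 : \int[nu]_(w in B) (u2 w)%:E <= A%:E by exact: moment_le.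
have I3 : \int[nu]_(w in B) (u3 w)%:E <= 1.
  by rewrite -integral_dv_ball//; exact/measurable_EFinP.
(* The three weights [x], [1 - p^-1], [p^-1 - x] add up to 1, and each normalised base integrates to
   at most 1. *)
have -> : c%:E = (c * x)%:E + ((c * (1 - p^-1))%:E + c3%:E).
  by rewrite -!EFinD; congr EFin; rewrite /c3; ring.
apply: leeD; [|apply: leeD].
- rewrite I1 (_ : c1 = c / M * x)%R; last by rewrite /c1; ring.
  rewrite EFinM -muleA; apply: le_trans (lee_wpmul2l _ hM) _.
    by rewrite lee_fin divr_ge0// ltW.
  rewrite -EFinM lee_fin [leLHS](_ : _ = c * x * (M / M))%R; last by ring.
  by rewrite divff ?mulr1 ?gt_eqF.
- apply: le_trans (lee_wpmul2l _ I2) _; first by rewrite lee_fin.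
  by rewrite -EFinM lee_fin /c2 -mulrA mulfVK// gt_eqF.
- apply: le_trans (lee_wpmul2l _ I3) _; first by rewrite lee_fin.
  by rewrite mule1.
Qed.

Lemma wmoment_ge0 p f z : 0 <= wmoment p f z.
Proof. by apply: integral_ge0 => w _; rewrite lee_fin mulr_ge0 ?kap_ge0 ?powR_ge0. Qed.

(** By Tonelli and the symmetry of the kernel, the inner integral in [z] is a moment at [w], hence
    at most [A]. *)
Lemma integral_wmoment_le p f : measurable_fun setT f ->
  \int[nu]_w (normc (f w) `^ p)%:E <= 1 -> \int[nu]_z wmoment p f z <= A%:E.
Proof.
move=> mf f1; have A0 := moment_sphere_gt0.
have mH : measurable_fun setT (fun x : n.+1.-tuple C * n.+1.-tuple C =>
    (kap r x.1 x.2 * normc (f x.2) `^ p)%:E).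
  by apply/measurable_EFinP; apply: measurable_wm.
have H0 (x : n.+1.-tuple C * n.+1.-tuple C) : 0 <= (kap r x.1 x.2 * normc (f x.2) `^ p)%:E.
  by rewrite lee_fin mulr_ge0 ?kap_ge0 ?powR_ge0.
apply: (@le_trans _ _ (\int[nu]_w \int[nu]_z (kap r z w * normc (f w) `^ p)%:E)).
  rewrite le_eqVlt; apply/orP; left; apply/eqP.
  exact: (fubini_tonelli (m1 := nu) (m2 := nu) _ mH H0).
have mG : measurable_fun setT (fun w => \int[nu]_z (kap r z w * normc (f w) `^ p)%:E).
  exact: (measurable_fun_fubini_tonelli_G (m1 := nu) _ mH H0).
have mfp : measurable_fun setT (fun w => (normc (f w) `^ p)%:E).
  by apply/measurable_EFinP; apply: measurable_powR_fun; exact: measurable_normc.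
have G0 w : 0 <= \int[nu]_z (kap r z w * normc (f w) `^ p)%:E.
  by apply: integral_ge0 => z _; rewrite lee_fin mulr_ge0 ?kap_ge0 ?powR_ge0.
rewrite (integral_dv_ball mG G0).
apply: (@le_trans _ _ (\int[nu]_(w in B) (A%:E * (normc (f w) `^ p)%:E))).
  apply: ge0_le_integral => //.
  - exact: measurable_funTS.
  - by apply: emeasurable_funM; [exact: measurable_cst|exact: measurable_funTS].
  move=> w Bw; have mk : measurable_fun setT (fun z => kap r w z).
    by apply: measurable_kap => //; exact: measurable_cst.
  rewrite (eq_integral (fun z => (normc (f w) `^ p * kap r w z)%:E)); last first.
    by move=> z _; rewrite kapC mulrC.
  rewrite ge0_integralMl ?powR_ge0//; last by move=> z; exact: kap_ge0.
  rewrite muleC integral_dv_ball//; last 2 first.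
  - exact/measurable_EFinP.
  - by move=> z; rewrite lee_fin kap_ge0.
  by rewrite lee_wpmul2r ?lee_fin ?powR_ge0//; exact: moment_le.
rewrite ge0_integralZl_EFin//; last 3 first.
- by move=> w _; rewrite lee_fin powR_ge0.
- exact: measurable_funTS.
- exact: ltW.
rewrite -integral_dv_ball//; last by move=> w; rewrite lee_fin powR_ge0.
by apply: le_trans (lee_wpmul2l _ f1) _; rewrite ?mule1// lee_fin ltW.
Qed.

(** The [q]-th power of the pointwise bound with [M] equal to [wmoment p f z]. As [M] has to be
    positive, a small [e] is first added to it; an infinite [wmoment] makes the right-hand side
    infinite. *)
Lemma Kop_plus_pow_le p q f z : (1 <= p)%R -> (0 < q)%R -> (q^-1 <= p^-1)%R ->
  measurable_fun setT f -> cLnorm p%:E f <= 1 ->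
  (normc (Kop_plus (r * (1 - p^-1 + q^-1)) f z) `^ q)%:E <=
  (A `^ (q * (1 - p^-1)))%:E * wmoment p f z.
Proof.
move=> p1 q0 qp mf f1; set y := (1 - p^-1)%R; set a := (r * (y + q^-1))%R.
have p0 : (0 < p)%R by exact: lt_le_trans p1.
have [z1|z1] := pselect (unit_ball z); last first.
  rewrite Kop_plus_out// normc0 powR0 ?gt_eqF//.
  by rewrite mule_ge0 ?wmoment_ge0// lee_fin powR_ge0.
have q10 : (0 <= q^-1)%R by rewrite invr_ge0 ltW.
have y0 : (0 <= y)%R by rewrite subr_ge0 invf_le1.
have a0 : (0 <= a)%R by apply: mulr_ge0 => //; exact: addr_ge0.
have foo : \int[nu]_(w in B) (normc (f w))%:E < +oo.
  by apply: (cLnorm_integrable mf _ f1); rewrite lee_fin.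
have fp := cLnorm_fin p0 f1.
have K := normc_Kop_plus_le a0 mf foo z1.
set X := normc _ in K *.
have c0 : (0 < A `^ (q * y))%R by rewrite powR_gt0// moment_sphere_gt0.
have XM M : (0 < M)%R -> wmoment p f z <= M%:E -> (X `^ q <= A `^ (q * y) * M)%R.
  move=> M0 hM.
  have XM : (X <= M `^ q^-1 * A `^ y)%R.
    rewrite -lee_fin; apply: le_trans K _.
    apply: absop_le_wmoment => //.
    by rewrite EFinM; apply: lee_wpmul2l.
  have -> : (A `^ (q * y) * M = (M `^ q^-1 * A `^ y) `^ q)%R.
    rewrite powRM ?powR_ge0// -!powRrM mulVf ?gt_eqF// powRr1 ?(ltW M0)//.
    by rewrite mulrC [(y * q)%R]mulrC.
  by apply: ge0_ler_powR => //; rewrite ?nnegrE ?(ltW q0) ?normc_ge0// mulr_ge0 ?powR_ge0.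
have := wmoment_ge0 p f z; case E : (wmoment p f z) => [v| |]//; last first.
  by move=> _; rewrite gt0_muley ?leey// lte_fin.
rewrite lee_fin => v0; rewrite -EFinM lee_fin; apply/ler_addgt0Pr => e e0.
have -> : (A `^ (q * y) * v + e = A `^ (q * y) * (v + e / A `^ (q * y)))%R.
  by rewrite [RHS]mulrDr [X in (_ = _ + X)%R]mulrCA divff ?mulr1// gt_eqF.
have d0 : (0 < e / A `^ (q * y))%R by exact: divr_gt0.
by apply: XM; rewrite ?ltr_wpDl// E lee_fin lerDl ltW.
Qed.

(** Integrating the pointwise bound in [z] adds one factor [A] to [A ^ (q * (1 - p^-1))]; the [q]-th
    root of the product has exponent [1 - p^-1 + q^-1]. *)
Lemma cLnorm_Kop_plus_le p q f : (1 <= p)%R -> (0 < q)%R -> (q^-1 <= p^-1)%R ->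
  measurable_fun setT f -> cLnorm p%:E f <= 1 ->
  cLnorm q%:E (Kop_plus (r * (1 - p^-1 + q^-1)) f) <= (A `^ (1 - p^-1 + q^-1))%:E.
Proof.
move=> p1 q0 qp mf f1; set y := (1 - p^-1)%R; set K := Kop_plus _ f.
have p0 : (0 < p)%R by exact: lt_le_trans p1.
have A0 := moment_sphere_gt0.
have fp := cLnorm_fin p0 f1.
have mW : measurable_fun setT (wmoment p f).
  apply: (measurable_fun_fubini_tonelli_F (m2 := nu)
    (fun x => (kap r x.1 x.2 * normc (f x.2) `^ p)%:E)).
    by apply/measurable_EFinP; apply: measurable_wm.
  by move=> x; rewrite lee_fin mulr_ge0 ?kap_ge0 ?powR_ge0.
have IK : \int[nu]_z (normc (K z) `^ q)%:E <= (A `^ (q * y + 1))%:E.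
  apply: (@le_trans _ _ (\int[nu]_z ((A `^ (q * y))%:E * wmoment p f z))).
    apply: le_integral_ge0 => z; first by rewrite lee_fin powR_ge0.
    exact: Kop_plus_pow_le.
  rewrite ge0_integralZl_EFin ?powR_ge0//; last by move=> z _; exact: wmoment_ge0.
  have -> : (A `^ (q * y + 1) = A `^ (q * y) * A)%R.
    by rewrite powRD ?(gt_eqF A0) ?implybT// powRr1// ltW.
  rewrite EFinM; apply: lee_wpmul2l; first by rewrite lee_fin powR_ge0.
  exact: integral_wmoment_le.
rewrite /cLnorm Lnorm.unlock.
have -> : \int[nu]_x (`|(normc (K x))%:E| `^ q) = \int[nu]_z (normc (K z) `^ q)%:E.
  by apply: eq_integral => z _; rewrite /= ger0_norm ?normc_ge0.
have -> : (A `^ (y + q^-1) = (A `^ (q * y + 1)) `^ q^-1)%R.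
  by rewrite -powRrM mulrDl mul1r mulrAC divff ?mul1r ?gt_eqF.
rewrite -poweR_EFin; apply: gt0_ler_poweR IK; first by rewrite invr_ge0 ltW.
- rewrite in_itv/= leey andbT; apply: integral_ge0 => z _.
  by rewrite lee_fin powR_ge0.
- by rewrite in_itv/= leey lee_fin powR_ge0.
Qed.

Lemma cLnorm_infty_Kop_plus_le p f : (1 <= p)%R ->
  measurable_fun setT f -> cLnorm p%:E f <= 1 ->
  cLnorm +oo (Kop_plus (r * (1 - p^-1)) f) <= (A `^ (1 - p^-1))%:E.
Proof.
move=> p1 mf f1; have p0 : (0 < p)%R by exact: lt_le_trans p1.
have fp := cLnorm_fin p0 f1.
have y0 : (0 <= 1 - p^-1)%R by rewrite subr_ge0 invf_le1.
rewrite /cLnorm Lnorm.unlock /= ifT; last by rewrite probability_setT.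
apply/ess_supP; apply: nearW => z /=; rewrite ger0_norm ?normc_ge0//.
have [z1|z1] := pselect (unit_ball z); last first.
  by rewrite Kop_plus_out// normc0 lee_fin powR_ge0.
have foo : \int[nu]_(w in B) (normc (f w))%:E < +oo.
  by apply: (cLnorm_integrable mf _ f1); rewrite lee_fin.
apply: le_trans (normc_Kop_plus_le _ mf foo z1) _; first exact: mulr_ge0.
have := @absop_le_wmoment p 0%R f z 1%R p1 (lexx _).
rewrite addr0 powRr0 mul1r; apply => //; first by rewrite invr_ge0 ltW.
by rewrite mul0r mul0e.
Qed.

(** Here [f] is bounded by 1 almost everywhere, and the moment bound alone controls the operator. *)
Lemma cLnorm_infty_infty_Kop_plus_le f :
  measurable_fun setT f -> cLnorm +oo f <= 1 ->
  cLnorm +oo (Kop_plus r f) <= A%:E.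
Proof.
move=> mf f1; have foo : \int[nu]_(w in B) (normc (f w))%:E < +oo.
  by apply: (cLnorm_integrable mf _ f1); rewrite leey.
rewrite /cLnorm Lnorm.unlock /= ifT; last by rewrite probability_setT.
apply/ess_supP; apply: nearW => z /=; rewrite ger0_norm ?normc_ge0//.
have [z1|z1] := pselect (unit_ball z); last first.
  by rewrite Kop_plus_out// normc0 lee_fin; exact/ltW/moment_sphere_gt0.
apply: le_trans (normc_Kop_plus_le r0 mf foo z1) _.
apply: le_trans (moment_le r0 rn z1).
have mk : measurable_fun setT (fun w => kap r z w).
  by apply: measurable_kap => //; exact: measurable_cst.
apply: ae_ge0_le_integral => //.
- by move=> w _; rewrite lee_fin mulr_ge0 ?normc_ge0 ?kap_ge0.
- apply: measurable_funTS; apply/measurable_EFinP; exact: measurable_absop_integrand.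
- by move=> w _; rewrite lee_fin kap_ge0.
- by apply: measurable_funTS; apply/measurable_EFinP.
have := cLnorm_infty f1; apply: filterS => w h _.
by rewrite lee_fin ler_piMl ?kap_ge0.
Qed.

End schur_test.

Section operator_bound.
Variable R : realType.
Local Open Scope ereal_scope.
Implicit Types (p q : \bar R).

Lemma rinv_fin (x : R) : (0 < x)%R -> rinv x%:E = x^-1%R.
Proof. by move=> x0; rewrite /rinv inver gt_eqF. Qed.

Lemma rinv_infty : rinv +oo = 0%R :> R.
Proof. by rewrite /rinv invey. Qed.

Lemma rinv_infty_le p q : 1 <= q -> (rinv q <= rinv p)%R -> p = +oo -> q = +oo.
Proof.
case: q => [q| |]//.
rewrite lee_fin => q1 + pE; rewrite pE rinv_infty rinv_fin ?(lt_le_trans ltr01)//.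
by rewrite leNgt invr_gt0 (lt_le_trans ltr01 q1).
Qed.

Lemma opnorm_Kop_plus_le n (a : R) p q (s := (1 - (rinv p - rinv q))%R) :
  (0 < a)%R -> 1 <= p -> 1 <= q -> (rinv q <= rinv p)%R -> (0 < s)%R ->
  (a / s < n%:R + 2)%R ->
  opnorm p q (@Kop_plus R n.+1 a) <= (moment_sphere n (a / s) `^ s)%:E.
Proof.
move=> a0 p1 q1 qp s0 hs; apply: ge_ereal_sup => _ [f [mf f1] <-].
have r0 : (0 <= a / s)%R by rewrite divr_ge0// ltW.
have -> : a = (a / s * s)%R by rewrite divfK// gt_eqF.
rewrite [(a / s * s / s)%R]mulfK ?gt_eqF//.
have gt0 (x : R) : 1 <= x%:E -> (0 < x)%R by rewrite lee_fin => /(lt_le_trans ltr01).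
case: p @s p1 qp s0 hs f1 r0 => [x| |] s p1; last by move: p1; rewrite leeNy_eq.
- case: q @s q1 => [y| |] s q1; last by move: q1; rewrite leeNy_eq.
  + move=> qp s0 hs f1 r0.
    have sE : s = (1 - x^-1 + y^-1)%R by rewrite /s !rinv_fin ?gt0// opprB addrA addrAC.
    rewrite [X in Kop_plus (_ * X)]sE [X in (_ `^ X)%R]sE.
    apply: (cLnorm_Kop_plus_le r0 hs) => //; first exact: gt0.
    by rewrite -!rinv_fin ?gt0.
  + move=> _ s0 hs f1 r0.
    have sE : s = (1 - x^-1)%R by rewrite /s rinv_fin ?gt0// rinv_infty subr0.
    rewrite [X in Kop_plus (_ * X)]sE [X in (_ `^ X)%R]sE.
    exact: (cLnorm_infty_Kop_plus_le r0 hs).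
- move=> qp s0 hs f1 r0; have qE := rinv_infty_le q1 qp erefl.
  have sE : s = 1%R by rewrite /s qE subrr subr0.
  rewrite [X in Kop_plus (_ * X)]sE [X in (_ `^ X)%R]sE mulr1.
  rewrite powRr1; last exact/ltW/moment_sphere_gt0.
  rewrite qE; exact: (cLnorm_infty_infty_Kop_plus_le r0 hs).
Qed.

End operator_bound.

(** * Sharpness for [q = +oo] *)

Section affine_approximation.
Variable R : realType.
Local Open Scope ereal_scope.
Local Notation C := R[i].
Variable n : nat.
Local Notation nu := (@dv R n).
Local Notation B := (@unit_ball R n).
Implicit Types (z w b v : n.-tuple C) (c : R).

Let mB : measurable B := @measurable_unit_ball R n.

Lemma cdot_caff c b v w : (cdot (caff c b v) w = c%:C%C * cdot v w + cdot b w)%R.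
Proof.
rewrite /cdot mulr_sumr -big_split/=; apply: eq_bigr => j _.
by rewrite tnth_mktuple mulrDl mulrA.
Qed.

(** Coordinatewise, the cross term [2 * c * |v| * |b|] is at most [c * |v|^2 + c * |b|^2]. *)
Lemma nrm2_caff_le c b v : (0 <= c)%R ->
  (nrm2 (caff c b v) <= (1 + c) * nrm2 b + (c + c ^+ 2) * nrm2 v)%R.
Proof.
move=> c0; rewrite /nrm2 !mulr_sumr -big_split/=; apply: ler_sum => j _.
rewrite tnth_mktuple; set x := tnth v j; set y := tnth b j.
have h : (normc (c%:C%C * x + y) <= c * normc x + normc y)%R.
  by apply: le_trans (le_normcD _ _) _; rewrite normcM normcR ger0_norm.
have {}h : (normc (c%:C%C * x + y) ^+ 2 <= (c * normc x + normc y) ^+ 2)%R.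
  by apply: lerXn2r => //; rewrite nnegrE ?addr_ge0 ?mulr_ge0 ?normc_ge0.
apply: le_trans h _; rewrite -subr_ge0.
rewrite (_ : _ - _ = c * (normc x - normc y) ^+ 2)%R; last by ring.
by rewrite mulr_ge0 ?sqr_ge0.
Qed.

(** The image of the ball under [v -> c * v + b] has positive volume, so no null set contains it;
    the bound on [c] keeps this image inside the ball. *)
Lemma caff_notin_null (N : set (n.-tuple C)) b c : measurable N -> nu N = 0 ->
  (nrm2 b < 1)%R -> (0 < c)%R -> (c <= (1 - nrm2 b) / 4)%R ->
  exists v, [/\ B v, B (caff c b v) & ~ N (caff c b v)].
Proof.
move=> mN N0 b1 c0 cb; have b0 := nrm2_ge0 b.
have inB v : B v -> B (caff c b v).
  rewrite !unit_ballE => v1; apply: le_lt_trans (nrm2_caff_le b v (ltW c0)) _.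
  by have v0 := nrm2_ge0 v; nra.
apply: contrapT => h.
have hN v : B v -> N (caff c b v).
  move=> Bv; apply: contrapT => Nv; apply: h; exists v; split => //; exact: inB.
have lN : lebesgueCn R n (N `&` B) = 0.
  have := N0; rewrite -[X in X = 0 -> _]/((fine (ballvol R n))^-1%:E * lebesgueCn R n (N `&` B)).
  move/eqP; rewrite mule_eq0 eqe invr_eq0 gt_eqF ?ballvol_gt0//=.
  by move/eqP.
have mNB : measurable (N `&` B) by exact: measurableI.
pose f w : \bar R := (\1_(N `&` B) w : R)%:E.
have mf : measurable_fun setT f by apply/measurable_EFinP; exact: measurable_indic.
have f0 w : 0 <= f w by rewrite lee_fin.
have If : \int[lebesgueCn R n]_w f w = 0.
  by apply: etrans (integral_indic _ _ mNB) _; rewrite ?setIT.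
have := ge0_integralCn_affine b mf f0 c0; rewrite If => /eqP.
rewrite mule_eq0 eqe expf_eq0 sqrf_eq0 (gt_eqF c0) andbF/= => /eqP I0.
have : lebesgueCn R n B <= \int[lebesgueCn R n]_w f (caff c b w).
  rewrite -[X in lebesgueCn R n X]setIT -integral_indic//.
  apply: ge0_le_integral => //.
  - by apply/measurable_EFinP; exact: measurable_indic.
  - by apply: (measurableT_comp mf); apply: measurable_caff; exact: measurable_id.
  move=> w _; rewrite /f !indicE; case: (boolP (w \in B)) => [|_]; last by rewrite lee_fin.
  rewrite inE => Bw; rewrite mem_set//; split; [exact: hN|exact: inB].
by rewrite I0 leNgt unit_ball_volume_gt0.
Qed.

End affine_approximation.

Section operator_limits.
Variable R : realType.
Local Notation C := R[i].
Variable n : nat.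
Local Notation nu := (@dv R n).
Local Notation B := (@unit_ball R n).
Implicit Types (f : n.-tuple C -> C) (z w : n.-tuple C).

Let mB : measurable B := @measurable_unit_ball R n.

Lemma cvg_ckap (a : R) (z_ : nat -> n.-tuple C) z w :
  Re (1 - cdot (z_ k) w) @[k --> \oo] --> (Re (1 - cdot z w) : R) ->
  Im (1 - cdot (z_ k) w) @[k --> \oo] --> (Im (1 - cdot z w) : R) ->
  (0 < Re (1 - cdot z w))%R ->
  Re (ckap a (z_ k) w) @[k --> \oo] --> (Re (ckap a z w) : R) /\
  Im (ckap a (z_ k) w) @[k --> \oo] --> (Im (ckap a z w) : R).
Proof.
set x := Re _; set y := Im _ => cx cy x0.
have kE z' : kap a z' w =
    ((Re (1 - cdot z' w) * Re (1 - cdot z' w) + Im (1 - cdot z' w) * Im (1 - cdot z' w)) `^ (- (a / 2)))%R.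
  rewrite -!expr2 -sqr_normcE -(powR_mulrn 2 (normc_ge0 _)) -powRrM /kap.
  by congr powR; field.
have ck : kap a (z_ k) w @[k --> \oo] --> kap a z w.
  rewrite kE (_ : (fun k => kap a (z_ k) w) = fun k => ((Re (1 - cdot (z_ k) w) *
    Re (1 - cdot (z_ k) w) + Im (1 - cdot (z_ k) w) * Im (1 - cdot (z_ k) w)) `^ (- (a / 2)))%R);
    last by apply/funext => k; exact: kE.
  have b0 : (0 < x * x + y * y)%R by rewrite ltr_pwDl ?mulr_gt0// -expr2 sqr_ge0.
  have cb : (Re (1 - cdot (z_ k) w) * Re (1 - cdot (z_ k) w) +
      Im (1 - cdot (z_ k) w) * Im (1 - cdot (z_ k) w))%R @[k --> \oo] --> (x * x + y * y : R)%R.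
    by apply: cvgD; exact: cvgM.
  exact: (cvg_comp _ _ cb (@continuous_powR_gt0 _ (- (a / 2))%R _ b0)).
have ct : (a * rarg (1 - cdot (z_ k) w))%R @[k --> \oo] --> (a * rarg (1 - cdot z w))%R.
  apply: cvgM; first exact: cvg_cst.
  have c1 : (Re (1 - cdot (z_ k) w) `^ (-1))%R @[k --> \oo] --> (x `^ (-1))%R.
    exact: (cvg_comp _ _ cx (@continuous_powR_gt0 _ (-1)%R _ x0)).
  exact: (cvg_comp _ _ (cvgM cy c1) (@continuous_atan _ _)).
split.
  by apply: cvgM => //; exact: (cvg_comp _ _ ct (@continuous_cos _ _)).
by apply: cvgN; apply: cvgM => //; exact: (cvg_comp _ _ ct (@continuous_sin _ _)).
Qed.

Local Open Scope ereal_scope.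

(** Dominated convergence; the common bound [rho] on [nrm2 (z_ k)] provides one majorant for all
    [k]. Only the real part of the limit is retained, which loses nothing for [extremal], whose
    product with the kernel at [z0] is real and nonnegative on the ball. *)
Lemma le_Kop_limit (a y rho : R) f (z_ : nat -> n.-tuple C) z :
  (0 <= a)%R -> measurable_fun setT f -> \int[nu]_(w in B) (normc (f w))%:E < +oo ->
  (rho < 1)%R -> (forall k, nrm2 (z_ k) <= rho)%R -> (nrm2 z < 1)%R ->
  (forall w, B w -> Re (1 - cdot (z_ k) w)%R @[k --> \oo] --> (Re (1 - cdot z w)%R : R)) ->
  (forall w, B w -> Im (1 - cdot (z_ k) w)%R @[k --> \oo] --> (Im (1 - cdot z w)%R : R)) ->
  (forall k, normc (Kop a f (z_ k)) <= y)%R ->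
  \int[nu]_(w in B) (Re (f w * ckap a z w)%R)%:E <= y%:E.
Proof.
move=> a0 mf foo rho1 z_rho z1 cRe cIm hy.
have z_1 k : (nrm2 (z_ k) < 1)%R by exact: le_lt_trans (z_rho k) rho1.
pose M := (((1 - rho) / 2) `^ (- a))%R.
pose u k w : R := Re (f w * ckap a (z_ k) w)%R.
have mu_ k : measurable_fun B (fun w => (u k w)%:E).
  apply: measurable_funTS; apply/measurable_EFinP; apply: measurable_Re_fun.
  by apply: measurable_mulc => //; apply: measurable_ckap => //; exact: measurable_cst.
have mn := measurable_normc mf.
have kM k w : B w -> (kap a (z_ k) w <= M)%R.
  move=> Bw; apply: le_trans (kap_le a0 (z_1 k) Bw) _.
  have d0 : (0 < (1 - rho) / 2)%R by rewrite divr_gt0// subr_gt0.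
  have d1 : ((1 - rho) / 2 <= (1 - nrm2 (z_ k)) / 2)%R by rewrite ler_pM2r// lerD2l lerN2.
  have d2 := lt_le_trans d0 d1.
  rewrite /M !powRN lef_pV2 ?posrE ?powR_gt0//.
  by apply: ge0_ler_powR; rewrite ?nnegrE ?(ltW d0) ?(ltW d2).
have uM k w : B w -> `|(u k w)%:E| <= (M * normc (f w))%:E.
  move=> Bw; rewrite /= lee_fin; apply: (@le_trans _ _ (normc (f w * ckap a (z_ k) w)%R)).
    exact: normr_Re_le.
  by rewrite normcM normc_ckap mulrC ler_wpM2r ?normc_ge0// kM.
have M0 : (0 <= M)%R by exact: powR_ge0.
have ig : nu.-integrable B (fun w => (M * normc (f w))%:E).
  apply/integrableP; split.
    apply: measurable_funTS; apply/measurable_EFinP.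
    by apply: measurable_funM => //; exact: measurable_cst.
  rewrite (eq_integral (fun w => M%:E * (normc (f w))%:E)); last first.
    by move=> w _; rewrite /= ger0_norm// mulr_ge0 ?normc_ge0.
  rewrite ge0_integralZl_EFin//; last 2 first.
  - by move=> w _; rewrite lee_fin normc_ge0.
  - by apply: measurable_funTS; apply/measurable_EFinP.
  by rewrite lte_mul_pinfty// lee_fin.
have iu k : nu.-integrable B (fun w => (u k w)%:E).
  apply: (le_integrable mB _ _ ig) => // w Bw.
  rewrite [leRHS]gee0_abs; first exact: uM.
  by rewrite lee_fin mulr_ge0 ?normc_ge0.
have cu w : B w -> (u k w)%:E @[k --> \oo] --> (Re (f w * ckap a z w)%R)%:E.
  move=> Bw; apply: cvg_EFin; first by near=> k.
  have x0 : (0 < Re (1 - cdot z w)%R)%R.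
    by apply: le_lt_trans (Re_one_sub_cdot_gt z Bw); rewrite divr_ge0// subr_ge0 ltW.
  have [c1 c2] := cvg_ckap a (cRe w Bw) (cIm w Bw) x0.
  rewrite (_ : _ \o _ = fun k => Re (f w) * Re (ckap a (z_ k) w) -
    Im (f w) * Im (ckap a (z_ k) w))%R; last by apply/funext => k; rewrite /u /= ReM.
  by rewrite ReM; apply: cvgB; apply: cvgM => //; exact: cvg_cst.
have fing w : B w -> (M * normc (f w))%:E \is a fin_num by [].
have h := dominated_cvg mB mu_ cu fing ig uM.
rewrite -(cvg_lim _ h)//; apply: lime_le; first by apply/cvg_ex; eexists; exact: h.
apply: nearW => k; have If := integrable_fin_num mB (iu k).
rewrite -(fineK If) lee_fin; apply: le_trans (hy k).
apply: le_trans (normc_ge_Re _); rewrite KopE//.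
Unshelve. all: by end_near. Qed.

End operator_limits.

(** * The extremal function at an interior point *)

Section extremal_function.
Variable R : realType.
Local Open Scope ereal_scope.
Local Notation C := R[i].
Variables (n : nat) (r s : R) (z0 : n.+1.-tuple C).
Hypotheses (r0 : (0 <= r)%R) (rn : (r < n%:R + 2)%R).
Hypotheses (s0 : (0 < s)%R) (z01 : (nrm2 z0 < 1)%R).
Local Notation nu := (@dv R n.+1).
Local Notation B := (@unit_ball R n.+1).
Implicit Types z w : n.+1.-tuple C.

Let mB : measurable B := @measurable_unit_ball R n.+1.

Let m := fine (moment r z0).

Let mk a : measurable_fun setT (fun w => kap a z0 w).
Proof. by apply: measurable_kap => //; exact: measurable_cst. Qed.

Lemma moment_fin_num : moment r z0 \is a fin_num.
Proof.
rewrite ge0_fin_numE; first exact: le_lt_trans (moment_le r0 rn z01) (ltry _).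
by apply: integral_ge0 => w _; rewrite lee_fin kap_ge0.
Qed.

Let momentE : moment r z0 = m%:E.
Proof. by rewrite /m fineK// moment_fin_num. Qed.

Let m_gt0 : (0 < m)%R.
Proof.
have h : (2 `^ (- r))%:E <= moment r z0.
  apply: (@le_trans _ _ (\int[nu]_(w in B) (2 `^ (- r))%:E)).
    rewrite integral_cst// [X in _ * X](_ : _ = 1) ?mule1//; exact: dv_ball1.
  apply: ge0_le_integral => //.
  - by apply: measurable_funTS; apply/measurable_EFinP.
  move=> w Bw; rewrite lee_fin /kap.
  have d0 : (0 < normc (1 - cdot z0 w))%R.
    by apply: lt_trans (normc_one_sub_cdot_gt z0 Bw); rewrite divr_gt0// subr_gt0.
  have d2 : (normc (1 - cdot z0 w) <= 2)%R.
    apply: le_trans (le_normcD _ _) _; rewrite normcN normc1.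
    have := z01; have := normc_cdot_le z0 w; have : (nrm2 w < 1)%R by []; lra.
  rewrite !powRN lef_pV2 ?posrE ?powR_gt0//.
  by apply: ge0_ler_powR; rewrite ?nnegrE ?(ltW d0).
by rewrite -lte_fin -momentE; apply: lt_le_trans h; rewrite lte_fin powR_gt0.
Qed.

Let kapD a b w : B w -> (kap a z0 w * kap b z0 w = kap (a + b) z0 w)%R.
Proof.
move=> Bw; have d0 : (0 < normc (1 - cdot z0 w))%R.
  by apply: lt_trans (normc_one_sub_cdot_gt z0 Bw); rewrite divr_gt0// subr_gt0.
by rewrite /kap opprD powRD// (gt_eqF d0) implybT.
Qed.

(** The normalisation: for finite [p] with [1 - s = 1/p], the [p]-th power of the modulus of
    [extremal] is [c ^ p * kap r z0] on the ball, with integral [c ^ p * m = 1]. For [p = +oo],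
    [s = 1] and [c = 1]. *)
Let c := (m `^ (- (1 - s)))%R.
Let c_ge0 : (0 <= c)%R. Proof. exact: powR_ge0. Qed.

(* On the ball this is [c * kap (r - r * s) z0 w] times the phase of
   [(1 - <z0, w>) ^ (r * s)]. *)
Definition extremal w : C :=
  ((c * kap (r - 2 * (r * s)) z0 w)%:C%C * conjc (ckap (r * s) z0 w))%R.

Lemma measurable_extremal : measurable_fun setT extremal.
Proof.
apply: measurable_mulc; last first.
  by apply: measurable_conjc; apply: measurable_ckap => //; exact: measurable_cst.
apply: measurable_complexP => /=; last exact: measurable_cst.
by apply: measurable_funM => //; exact: measurable_cst.
Qed.

Lemma normc_extremal w : B w -> (normc (extremal w) = c * kap (r * (1 - s)) z0 w)%R.
Proof.
move=> Bw; rewrite /extremal normcM normcR normc_conj normc_ckap ger0_norm; last first.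
  by rewrite mulr_ge0 ?kap_ge0.
rewrite -mulrA kapD//; congr (_ * kap _ _ _)%R; ring.
Qed.

Lemma extremalM w : B w ->
  (extremal w * ckap (r * s) z0 w = (c * kap r z0 w)%:C%C)%R.
Proof.
move=> Bw; rewrite /extremal -mulrA.
have -> : (conjc (ckap (r * s) z0 w) * ckap (r * s) z0 w =
    (normc (ckap (r * s) z0 w) ^+ 2)%:C%C)%R.
  by rewrite sqr_normcE; apply: complex_ext; rewrite !ReImE/=; ring.
rewrite normc_ckap -rmorphM/= -mulrA expr2 !kapD//.
rewrite [X in kap X](_ : _ = r)%R//; ring.
Qed.

Lemma cLnorm_extremal p : 1 <= p -> (1 - s)%R = rinv p -> cLnorm p extremal <= 1.
Proof.
have mn := measurable_normc measurable_extremal.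
case: p => [p| |]; last by rewrite leeNy_eq.
- rewrite lee_fin => p1; have p0 := lt_le_trans ltr01 p1.
  rewrite rinv_fin// => sp; rewrite /cLnorm Lnorm.unlock.
  have -> : \int[nu]_x (`|(normc (extremal x))%:E| `^ p) = 1.
    transitivity (\int[nu]_x (normc (extremal x) `^ p)%:E).
      by apply: eq_integral => z _; rewrite /= ger0_norm ?normc_ge0.
    rewrite integral_dv_ball; last 2 first.
    - by apply/measurable_EFinP; exact: measurable_powR_fun.
    - by move=> w; rewrite lee_fin powR_ge0.
    transitivity (\int[nu]_(w in B) ((c `^ p)%:E * (kap r z0 w)%:E)).
      apply: eq_integral => w; rewrite inE => Bw.
      rewrite normc_extremal// powRM ?kap_ge0// kap_powR sp -mulrA mulVf ?mulr1//.
      by rewrite gt_eqF.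
    rewrite ge0_integralZl_EFin ?powR_ge0//; last 2 first.
    - by move=> w _; rewrite lee_fin kap_ge0.
    - by apply: measurable_funTS; apply/measurable_EFinP.
    rewrite -/(moment r z0) momentE -EFinM /c -powRrM sp mulNr mulVf ?gt_eqF//.
    by rewrite powR_inv1 ?(ltW m_gt0)// mulVf ?gt_eqF.
  by rewrite poweR1r.
- move=> _; rewrite rinv_infty => /eqP; rewrite subr_eq0 => /eqP sE.
  rewrite /cLnorm Lnorm.unlock /= ifT; last by rewrite probability_setT.
  (* On the ball the modulus is identically 1; off the ball it is not controlled, but the complement
     is a null set. *)
  apply/ess_supP; exists (~` B); split; [exact: measurableC|exact: dv_setC|].
  apply: subsetC => w Bw; suff : `|(normc (extremal w))%:E| <= 1 by [].
  rewrite gee0_abs lee_fin ?normc_ge0// normc_extremal//.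
  by rewrite /c -sE subrr oppr0 mulr0 /kap oppr0 !powRr0 mulr1.
Qed.

(** The norm bounds the image of [extremal] only off a null set [N]. Points [e k * v k + z0]
    avoiding [N] and tending to [z0] carry the bound to [z0], where the integral is
    [c * m = m ^ s]. *)
Lemma moment_le_opnorm p (y : R) : 1 <= p -> (1 - s)%R = rinv p ->
  opnorm p +oo (@Kop R n.+1 (r * s)) <= y%:E -> (m `^ s <= y)%R.
Proof.
move=> p1 sp hy; have me := measurable_extremal; have e1 := cLnorm_extremal p1 sp.
have foo := cLnorm_integrable me p1 e1.
have {hy} : cLnorm +oo (Kop (r * s) extremal) <= y%:E.
  by apply: le_trans hy; apply: ereal_sup_ubound; exists extremal.
rewrite /cLnorm Lnorm.unlock /= ifT; last by rewrite probability_setT.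
move=> /ess_supP[N [mN N0 sN]].
have b0 := nrm2_ge0 z0.
pose delta := ((1 - nrm2 z0) / 4)%R.
have d0 : (0 < delta)%R by rewrite divr_gt0// subr_gt0.
pose e (k : nat) : R := (delta * k.+1%:R^-1)%R.
have e0 k : (0 < e k)%R by rewrite mulr_gt0// invr_gt0 ltr0n.
have ed k : (e k <= delta)%R.
  by rewrite /e ger_pMr// invf_le1 ?ltr0n// ler1n.
have /choice[v hv] : forall k, exists v, [/\ B v, B (caff (e k) z0 v) & ~ N (caff (e k) z0 v)].
  by move=> k; exact: caff_notin_null.
pose z_ k := caff (e k) z0 (v k).
have cv : e k @[k --> \oo] --> (0%R : R).
  rewrite -[X in _ --> X](mulr0 delta); apply: cvgM; first exact: cvg_cst.
  exact: cvg_harmonic.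
have sq (x_ : nat -> R) : (forall k, `|x_ k| <= 1)%R -> (e k * x_ k)%R @[k --> \oo] --> (0%R : R).
  move=> x1; apply: (@squeeze_cvgr _ _ _ _ (fun k => - e k)%R e) => //.
    apply: nearW => k; have := x1 k; rewrite ler_norml => /andP[xl xu].
    have := e0 k; by nra.
  by rewrite -[X in _ --> X]oppr0; exact: cvgN.
have vw k w : B w -> (normc (cdot (v k) w) <= 1)%R.
  move=> Bw; have [Bv _ _] := hv k; have := normc_cdot_le (v k) w.
  have : (nrm2 w < 1)%R by []; have : (nrm2 (v k) < 1)%R by []; lra.
(* With [delta = (1 - nrm2 z0) / 4] this [rho] is [1 - delta]. It bounds [nrm2 (z_ k)] because
   [nrm2_caff_le] adds at most [e k * (nrm2 z0 + 1 + e k)], hence at most [3 * delta]. *)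
have := @le_Kop_limit R n.+1 (r * s) y (nrm2 z0 + 3 * delta) extremal z_ z0.
have -> : \int[nu]_(w in B) (Re (extremal w * ckap (r * s) z0 w)%R)%:E = (m `^ s)%:E.
  transitivity (\int[nu]_(w in B) (c%:E * (kap r z0 w)%:E)).
    by apply: eq_integral => w; rewrite inE => Bw; rewrite extremalM.
  rewrite ge0_integralZl_EFin//; last 2 first.
  - by move=> w _; rewrite lee_fin kap_ge0.
  - by apply: measurable_funTS; apply/measurable_EFinP.
  rewrite -/(moment r z0) momentE -EFinM /c -[X in (_ * X)%R]powRr1 ?(ltW m_gt0)//.
  by rewrite -powRD ?(gt_eqF m_gt0) ?implybT//; congr (_ `^ _)%:E; ring.
rewrite lee_fin; apply => //.
- by rewrite mulr_ge0// ltW.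
- by have := z01; rewrite /delta; lra.
- move=> k; apply: le_trans (nrm2_caff_le z0 (v k) (ltW (e0 k))) _.
  have [Bv _ _] := hv k; have v1 : (nrm2 (v k) < 1)%R by [].
  have v0 := nrm2_ge0 (v k); have := e0 k; have := ed k.
  have : (delta <= 1)%R by rewrite /delta; lra.
  move: (e k) (nrm2 (v k)) (nrm2 z0) v1 v0 z01 b0 => x t b v1 v0 b1 b0 hd hx x0.
  by nra.
- move=> w Bw; rewrite (_ : (fun k => _) = fun k =>
    (Re (1 - cdot z0 w)%R - e k * Re (cdot (v k) w))%R); last first.
    by apply/funext => k; rewrite /z_ cdot_caff !ReImE/=; ring.
  rewrite -[X in _ --> X]subr0; apply: cvgB; first exact: cvg_cst.
  by apply: sq => k; exact: le_trans (normr_Re_le _) (vw k w Bw).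
- move=> w Bw; rewrite (_ : (fun k => _) = fun k =>
    (Im (1 - cdot z0 w)%R - e k * Im (cdot (v k) w))%R); last first.
    by apply/funext => k; rewrite /z_ cdot_caff !ReImE/=; ring.
  rewrite -[X in _ --> X]subr0; apply: cvgB; first exact: cvg_cst.
  by apply: sq => k; exact: le_trans (normr_Im_le _) (vw k w Bw).
- move=> k; have [_ Bz Nz] := hv k.
  have : ~ ~ (`|normc (Kop (r * s) extremal (z_ k))|%:E <= y%:E).
    by move=> h; apply: Nz; exact: sN.
  by move/contrapT; rewrite lee_fin ger0_norm ?normc_ge0.
Qed.

End extremal_function.

Section sharpness.
Variable R : realType.
Local Open Scope ereal_scope.

(** For a finite norm [y], the bounds [m ^ s <= y] at interior points become [m <= y ^ (1/s)], a
    form that [moment_sphere_le] carries to the sphere. *)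
Lemma moment_sphere_le_opnorm n (r s : R) p : (0 <= r)%R -> (r < n%:R + 2)%R ->
  (0 < s)%R -> 1 <= p -> (1 - s)%R = rinv p ->
  (moment_sphere n r `^ s)%:E <= opnorm p +oo (@Kop R n.+1 (r * s)).
Proof.
move=> r0 rn s0 p1 sp; have A0 := moment_sphere_gt0 r0 rn.
have key (y rho : R) : opnorm p +oo (@Kop R n.+1 (r * s)) <= y%:E ->
    (0 <= rho)%R -> (rho < 1)%R ->
    let m := fine (moment r (ccons rho%:C%C [tuple 0%R | _ < n])) in
    moment r (ccons rho%:C%C [tuple 0%R | _ < n]) = m%:E /\ (0 <= m)%R /\ (m `^ s <= y)%R.
  move=> hy rho0 rho1 m.
  have z1 : (nrm2 (ccons rho%:C%C [tuple 0%R | _ < n] : n.+1.-tuple R[i]) < 1)%R.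
    by rewrite nrm2_axis normcR ger0_norm// expr_lt1.
  split; first by rewrite /m fineK// moment_fin_num.
  split; last exact: moment_le_opnorm hy.
  by apply: fine_ge0; apply: integral_ge0 => w _; rewrite lee_fin kap_ge0.
case E : (opnorm p +oo (@Kop R n.+1 (r * s))) => [y| |]; rewrite ?leey//; last first.
  (* A norm equal to [-oo] would bound the nonnegative [m ^ s] by [-1]. *)
  have [|_ [_]] := key (-1)%R 0%R _ (lexx _) ltr01; first by rewrite E leNye.
  by rewrite leNgt (lt_le_trans _ (powR_ge0 _ _))// ltrN10.
have y0 : (0 <= y)%R.
  have [|_ [_]] := key y 0%R _ (lexx _) ltr01; first by rewrite E.
  by apply: le_trans; exact: powR_ge0.
have si0 : (0 <= s^-1)%R by rewrite invr_ge0 ltW.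
have : (moment_sphere n r)%:E <= (y `^ s^-1)%:E.
  apply: moment_sphere_le => // rho rho0 rho1.
  have [|-> [m0 my]] := key y rho _ rho0 rho1; first by rewrite E.
  rewrite lee_fin -[leLHS](powRr1 m0) -(divff (lt0r_neq0 s0)) powRrM.
  by apply: ge0_ler_powR; rewrite ?nnegrE ?powR_ge0.
rewrite !lee_fin => h; rewrite -[leRHS](powRr1 y0) -(mulVf (lt0r_neq0 s0)) powRrM.
by apply: ge0_ler_powR; rewrite ?nnegrE ?powR_ge0 ?(ltW A0) ?(ltW s0).
Qed.

Lemma GammaE (x : R) : Gamma x = gammaR x.
Proof.
rewrite /Gamma /Rintegral /gammaR /gam integral_mkcond; congr fine.
apply: eq_integral => t _; rewrite patchE; case: ifPn.
  by rewrite inE /= in_itv/= andbT => t0; rewrite /ppow t0.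
by rewrite notin_setE /= in_itv/= andbT => /negP t0; rewrite /ppow (negbTE t0) mul0r.
Qed.

End sharpness.

Theorem proposition6p4 (R : realType) (d : nat) (alpha : R) (p q : \bar R)
    (d_ge1 : (1 <= d)%N)
    (alpha_gt0 : 0 < alpha) (alpha_lt : alpha < d%:R + 1)
    (p_ge1 : (1 <= p)%E) (q_ge1 : (1 <= q)%E)
    (pq_lt : rinv p - (1 - alpha / (d%:R + 1)) < rinv q)
    (pq_le : rinv q <= rinv p) :
  let s : R := 1 - (rinv p - rinv q) in
  let C : R :=
    (Gamma (d%:R + 1) * Gamma (d%:R + 1 - alpha / s) /
      Gamma (d%:R + 1 - alpha / (2 * s)) ^+ 2) `^ s in
  [/\ (opnorm p q (@Kop R d alpha) <= opnorm p q (@Kop_plus R d alpha))%E,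
      (opnorm p q (@Kop_plus R d alpha) <= C%:E)%E
    & q = +oo%E ->
      opnorm p q (@Kop R d alpha) = opnorm p q (@Kop_plus R d alpha) /\
      opnorm p q (@Kop_plus R d alpha) = C%:E].
Proof.
move=> s C; case: d d_ge1 alpha_lt pq_lt @C => [//|n _ alpha_lt pq_lt C].
have n1E : n.+1%:R + 1 = n%:R + 2 :> R by rewrite -addn1 natrD -addrA.
have n2 : 0 < n%:R + 2 :> R by rewrite ltr_wpDl.
(* The strict lower bound on [rinv q] says exactly that [alpha / s < d + 1], the range in which the
   closed form of the moment on the sphere holds. *)
have as_gt : alpha / (n%:R + 2) < s.
  by move: pq_lt; rewrite n1E /s; lra.
have s0 : 0 < s by apply: lt_trans as_gt; exact: divr_gt0.
have r0 : 0 <= alpha / s by rewrite divr_ge0// ltW.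
have rn : alpha / s < n%:R + 2 by rewrite ltr_pdivrMr// mulrC -ltr_pdivrMr.
have CE : C = moment_sphere n (alpha / s) `^ s.
  have e : alpha / (2 * s) = alpha / s / 2 by rewrite invfM mulrA mulrAC.
  by rewrite /C !GammaE n1E e.
have le1 : (opnorm p q (@Kop R n.+1 alpha) <= opnorm p q (@Kop_plus R n.+1 alpha))%E.
  exact: (opnorm_Kop_le n.+1 (ltW alpha_gt0) p_ge1 q_ge1).
have le2 : (opnorm p q (@Kop_plus R n.+1 alpha) <= C%:E)%E.
  by rewrite CE; exact: opnorm_Kop_plus_le.
split; [exact: le1|exact: le2|move=> qE].
(* For [q = +oo], [1 - s] is [rinv p], as the normalisation of the extremal function demands; the
   resulting bound closes the chain of inequalities. *)
have le3 : (C%:E <= opnorm p q (@Kop R n.+1 alpha))%E.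
  have sp : 1 - s = rinv p by rewrite /s qE rinv_infty subr0 opprB addrC subrK.
  have := moment_sphere_le_opnorm r0 rn s0 p_ge1 sp.
  by rewrite CE qE divfK ?lt0r_neq0.
split; apply/le_anti/andP; split.
- exact: le1.
- exact: le_trans le2 le3.
- exact: le2.
- exact: le_trans le3 le1.
Qed.
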